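(* Let $G$ be a compact connected Lie group, let $\Omega$ be a $G$-bundle over $(M,\mathcal{A})$ with projection $\pi$ and trivializations $\psi_U$, let $\mu$ be a compatible probability measure on $\Omega$ and $(g_t)_{t\in\mathbb{R}}$ a compatible flow with velocities $v_U:U\to Lie(G)$. Let $T$ be a maximal torus of $G$, $R=\dim T$, $\chi:T\to\mathbb{T}^R$ an isomorphism of Lie groups, and $h:Lie(G)\to G$ a measurable map such that $H_v\subset h(v)T h(v)^{-1}$ for all $v\in Lie(G)$. For $U\in\mathcal{A}$ and $x\in U$ put $w_U(x)=D\chi(e)\big(Ad_{h(v_U(x))^{-1}}(v_U(x))\big)\in\mathbb{R}^R$, and let $\mu'=\mu_\pi$. If for all $U\in\mathcal{A}$, $w_U$ is $\mathcal{C}^1$, $\mu'_{|U}\ll\lambda$ and $$\mu'\left(\bigcup_{\xi\in\mathbb{Z}^R\setminus\{0\}}\{x\in U:d\langle\xi|w_U(x)\rangle=0\}\setminus\{x\in U:\langle\xi|w_U(x)\rangle=0\}\right)=0,$$ then the dynamical system $(\Omega,\mu,(g_t)_{t\in\mathbb{R}})$ has Keplerian shear.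
   Context: $\mathbb{T}=\mathbb{R}/\mathbb{Z}$; $e$ is the neutral element of $G$; $\langle\cdot|\cdot\rangle$ is the Euclidean inner product; $d\langle\xi|w_U(x)\rangle$ is the differential at $x$ of $x\mapsto\langle\xi|w_U(x)\rangle$; $\mu'_{|U}\ll\lambda$ means absolute continuity with respect to Lebesgue measure read in the chart $U$. $G$-bundle: $M$ is an $n$-dimensional Lindelöf $\mathcal{C}^1$ manifold with atlas $\mathcal{A}$ (elements identified with chart domains $U\subset M$), $\Omega$ is a topological space with its Borel $\sigma$-algebra and a Borel probability measure $\mu$, $\pi:\Omega\to M$ is continuous, and for each $U\in\mathcal{A}$ there is a homeomorphism $\psi_U:\pi^{-1}(U)\to U\times G$ with $\pi_1\circ\psi_U=\pi_{|\pi^{-1}(U)}$, where $\pi_1$ is the first projection. Compatible flow: for all $U\in\mathcal{A}$ there is a measurable $v_U:U\to Lie(G)$ such that $\psi_U\circ g_t\circ\psi_U^{-1}(x,y)=(x,\exp(tv_U(x))y)$ for all $t\in\mathbb{R}$, $(x,y)\in U\times G$. Compatible measure: $\mu'=\mu_\pi$ is the push-forward of $\mu$ by $\pi$; for every $U\in\mathcal{A}$ the push-forward of $\mu_{|\pi^{-1}(U)}$ by $\psi_U$ equals $\mu'_{|U}\otimes\mathcal{H}$ with $\mathcal{H}$ the normalized Haar measure on $G$. For $v\in Lie(G)$, $H_v=\overline{\{\exp(tv):t\in\mathbb{R}\}}$. $Ad_g(v)=\frac{d}{dt}\,g\exp(tv)g^{-1}\big|_{t=0}$. $D\chi(e):Lie(T)\to\mathbb{R}^R$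 is the differential of $\chi$ at $e$. $\mathcal{I}=\{A\text{ measurable}:\forall t\in\mathbb{R},\ \mu(A\,\Delta\, g_t^{-1}(A))=0\}$. Keplerian shear: for all $f\in L^2_\mu(\Omega)$, $f\circ g_t\rightharpoonup\mathbb{E}_\mu(f|\mathcal{I})$ weakly in $L^2_\mu(\Omega)$ as $t\to+\infty$. *)

(* Defs.v *)
From HB Require Import structures.
From mathcomp Require Import all_boot all_order all_algebra.
From mathcomp Require Import all_classical all_reals all_analysis.

Set Implicit Arguments.
Unset Strict Implicit.
Unset Printing Implicit Defensive.

Import Order.TTheory GRing.Theory Num.Theory.
Import numFieldNormedType.Exports.

Local Open Scope classical_set_scope.
Local Open Scope ring_scope.

Notation borel X := (g_sigma_algebraType (@open X)).

Definition lindelof (X : topologicalType) := forall (I : Type) (D : I -> set X),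
  (forall i, open (D i)) -> [set: X] `<=` \bigcup_i D i ->
  exists2 J : set I, countable J & [set: X] `<=` \bigcup_(i in J) D i.

Definition homeo_between (X Y : topologicalType) (A : set X) (B : set Y)
    (f : X -> Y) (g : Y -> X) :=
  [/\ set_fun A B f, set_fun B A g,
      (forall x, A x -> g (f x) = x) & (forall y, B y -> f (g y) = y)] /\
  {within A, continuous f} /\ {within B, continuous g}.

Section calculus.
Context {R : realType}.

(* Iterated directional derivatives: for V finite-dimensional and U open this
   is the usual notion of a map of class C^k on U. *)
Fixpoint Cdiff (k : nat) (V W : normedModType R) (U : set V) (f : V -> W)
    : Prop :=
  match k with
  | 0%N => forall x, U x -> {for x, continuous f}
  | k'.+1 => (forall x, U x -> differentiable f x) /\
             (forall v, Cdiff k' U (fun x => 'd f x v))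
  end.

(* Lebesgue measure on R^n, characterized by the volume of boxes. *)
Definition is_lebesgue n
    (lam : {measure set (borel 'rV[R]_n) -> \bar R}) :=
  forall a b : 'rV[R]_n, (forall i, a 0 i <= b 0 i) ->
    lam [set x : 'rV[R]_n | forall i, a 0 i <= x 0 i <= b 0 i] =
    (\prod_(i < n) (b 0 i - a 0 i))%:E.

Definition dotZ r (xi : 'rV[int]_r) (w : 'rV[R]_r) : R :=
  \sum_(i < r) (xi 0 i)%:~R * w 0 i.

End calculus.

Section manifolds.
Context {R : realType}.

(* Charts are total functions together with an inverse; only the values of crd
   on dom, and those of par on crd @` dom, are meaningful. *)
Record chart (X : topologicalType) (E : normedModType R) := Chart {
  dom : set X ;
  crd : X -> E ;
  par : E -> X }.

Definition is_chart X E (c : chart X E) :=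
  [/\ open (dom c), open (crd c @` dom c) &
      homeo_between (dom c) (crd c @` dom c) (crd c) (par c)].

Definition is_atlas (k : nat) X E (A : set (chart X E)) :=
  [/\ (forall c, A c -> is_chart c),
      (forall x, exists2 c, A c & dom c x) &
      (forall a b, A a -> A b ->
         Cdiff k (crd a @` (dom a `&` dom b)) (crd b \o par a))].

(* f is of class C^k on the open set D, read in the atlases A and B. *)
Definition Cmap (k : nat) X E Y F (A : set (chart X E)) (B : set (chart Y F))
    (D : set X) (f : X -> Y) :=
  (forall x, D x -> {for x, continuous f}) /\
  (forall a b, A a -> B b ->
     Cdiff k (crd a @` (D `&` dom a `&` f @^-1` dom b))
             (crd b \o f \o par a)).

Definition smooth X E Y F (A : set (chart X E)) (B : set (chart Y F)) D f :=
  forall k, Cmap k A B D f.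

(* Smoothness on an arbitrary subset S: local extension to smooth maps. *)
Definition smooth_on_subset X E Y F (A : set (chart X E))
    (B : set (chart Y F)) (S : set X) (f : X -> Y) :=
  forall p, S p -> exists (N : set X) (F' : X -> Y),
    [/\ open N, N p, smooth A B N F' & forall q, N q -> S q -> F' q = f q].

Definition euclidean_atlas (E : normedModType R) : set (chart E E) :=
  [set Chart setT id id].

Definition prod_chart X E Y F (a : chart X E) (b : chart Y F)
    : chart (X * Y)%type (E * F)%type :=
  Chart (dom a `*` dom b) (fun p => (crd a p.1, crd b p.2))
        (fun q => (par a q.1, par b q.2)).

Definition prod_atlas X E Y F (A : set (chart X E)) (B : set (chart Y F))
    : set (chart (X * Y)%type (E * F)%type) :=
  [set c | exists a b, [/\ A a, B b & c = prod_chart a b]].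

(* The curve gamma has velocity u at time 0, read in the chart a. *)
Definition velocity X E (a : chart X E) (gamma : R -> X) (u : E) :=
  [/\ dom a (gamma 0), {for 0, continuous gamma} &
      is_derive (0 : R) 1 (crd a \o gamma) u].

(* Differential at p of the restriction f : S -> Y, evaluated at the tangent
   vector u (read in the chart a); the value is read in the charts of B around
   f p, and is meant to be used when these charts agree to first order. *)
Definition tangent_map X n Y m (a : chart X 'rV[R]_n)
    (B : set (chart Y 'rV[R]_m)) (S : set X) (f : X -> Y) (p : X)
    (u : 'rV[R]_n) : 'rV[R]_m :=
  xget 0 [set w | forall gamma : R -> X,
    (forall t, S (gamma t)) -> gamma 0 = p -> velocity a gamma u ->
    forall b, B b -> dom b (f p) -> velocity b (f \o gamma) w].

End manifolds.

Section torus.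
Context {R : realType}.

Definition Zsubgroup : zmodClosed R :=
  GRing.ZmodClosed.clone R (@Num.int_num_subdef R) _.

Definition circle : Type := quotient_topology (@Quotient.quot R Zsubgroup).
HB.instance Definition _ := PointedTopological.on circle.
HB.instance Definition _ :=
  GRing.Zmodule.copy circle (@Quotient.quot R Zsubgroup).

Definition circle_proj (x : R) : circle :=
  (\pi_((@Quotient.quot R Zsubgroup)) x)%qT.

Definition torus_proj r (x : 'rV[R]_r) : 'rV[circle]_r :=
  map_mx circle_proj x.

(* The charts of T^r are the local inverses of the covering R^r -> T^r; in
   particular every tangent space of T^r is identified with R^r. *)
Definition torus_atlas r : set (chart 'rV[circle]_r 'rV[R]_r) :=
  [set c | is_chart c /\ par c = @torus_proj r].

End torus.
Arguments circle : clear implicits.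

#[short(type="pTopGroupType")]
HB.structure Definition PTopGroup := {G of Group G & PointedTopological G}.

Section lie_groups.
Context {R : realType} (d : nat) (G : pTopGroupType).
Local Open Scope group_scope.

Definition is_lie_group (AG : set (chart G 'rV[R]_d)) :=
  [/\ hausdorff_space G,
      (forall k, is_atlas k AG),
      smooth (prod_atlas AG AG) AG setT (fun p : G * G => p.1 * p.2) &
      smooth AG AG setT (fun x : G => x^-1)].

Context (AG : set (chart G 'rV[R]_d)).

Definition one_parameter_subgroup (gamma : R -> G) :=
  smooth (@euclidean_atlas R R) AG setT gamma /\
  (forall s t, gamma (s + t)%R = gamma s * gamma t).

(* In the following definitions Lie(G), the tangent space of G at the neutral
   element, is identified with R^d by means of a fixed chart c0 around it. *)
Context (c0 : chart G 'rV[R]_d).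

(* The one-parameter subgroup with velocity v exists and is unique, so the
   default value of xget is irrelevant. *)
Definition lie_exp (v : 'rV[R]_d) : G :=
  xget 1 [set x | exists gamma,
    [/\ one_parameter_subgroup gamma, velocity c0 gamma v & x = gamma 1%R]].

Definition Ad (g : G) (v : 'rV[R]_d) : 'rV[R]_d :=
  ('D_1 (fun t : R => crd c0 (g * lie_exp (t *: v)%R * g^-1)%g) 0)%R.

Definition lie_orbit_closure (v : 'rV[R]_d) : set G :=
  closure (range (fun t : R => lie_exp (t *: v)%R)).

Definition is_subgroup (S : set G) :=
  [/\ S 1, (forall x y, S x -> S y -> S (x * y)) & (forall x, S x -> S x^-1)].

(* chi restricts to an isomorphism of Lie groups from S onto T^r. *)
Definition torus_isomorphism (S : set G) r (chi : G -> 'rV[circle R]_r) :=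
  [/\ (forall x y, S x -> S y -> chi (x * y) = (chi x + chi y)%R),
      smooth_on_subset AG (@torus_atlas R r) S chi &
      exists theta : 'rV[circle R]_r -> G,
        [/\ (forall p, S (theta p)), (forall p, chi (theta p) = p),
            (forall x, S x -> theta (chi x) = x) &
            smooth (@torus_atlas R r) AG setT theta]].

Definition is_torus (S : set G) :=
  is_subgroup S /\
  exists (r : nat) (chi : G -> 'rV[circle R]_r), torus_isomorphism S chi.

Definition is_maximal_torus (S : set G) :=
  is_torus S /\ (forall S', is_torus S' -> S `<=` S' -> S' = S).

(* Meaningful on Lie(S) only, i.e. on velocities of curves in S. *)
Definition Dchi (S : set G) r (chi : G -> 'rV[circle R]_r)
    : 'rV[R]_d -> 'rV[R]_r :=
  tangent_map c0 (@torus_atlas R r) S chi 1.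

Definition normalized_haar (H : probability (borel G) R) :=
  forall (g : G) (A : set (borel G)), measurable A ->
    H [set g * x | x in A] = H A.

End lie_groups.

Section bundles.
Context {R : realType} (n d : nat) (M Omega : ptopologicalType)
  (G : pTopGroupType).
Context (A : set (chart M 'rV[R]_n)) (pi : Omega -> M)
  (psi : chart M 'rV[R]_n -> Omega -> M * G)
  (psiV : chart M 'rV[R]_n -> M * G -> Omega).

Definition is_bundle :=
  continuous pi /\
  forall U, A U ->
    homeo_between (pi @^-1` dom U) (dom U `*` [set: G]) (psi U) (psiV U) /\
    (forall o, dom U (pi o) -> (psi U o).1 = pi o).

Definition is_flow (g : R -> Omega -> Omega) :=
  (forall o, g 0 o = o) /\ (forall s t o, g (s + t) o = g s (g t o)).

Definition compatible_flow (AG : set (chart G 'rV[R]_d))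
    (c0 : chart G 'rV[R]_d) (v : chart M 'rV[R]_n -> M -> 'rV[R]_d)
    (g : R -> Omega -> Omega) :=
  forall U, A U ->
    measurable_fun (dom U : set (borel M)) (v U : borel M -> borel 'rV[R]_d) /\
    (forall t x y, dom U x ->
       dom U (pi (g t (psiV U (x, y)))) /\
       psi U (g t (psiV U (x, y))) =
         (x, (lie_exp AG c0 (t *: v U x) * y)%g)).

Context (mu : probability (borel Omega) R).

Definition base_measure : set (borel M) -> \bar R :=
  pushforward mu (pi : borel Omega -> borel M).

(* M and G are second countable (M is locally Euclidean and Lindelof, G is
   moreover compact), hence the product sigma-algebra of borel M * borel G is
   the Borel sigma-algebra of M * G. *)
Definition compatible_measure (H : probability (borel G) R) :=
  forall U, A U -> forall B : set (borel M * borel G), measurable B ->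
    mu (psi U @^-1` B `&` pi @^-1` dom U) =
    ((fun C : set (borel M) => base_measure (C `&` dom U)) \x H)%E B.

(* mu'_|U << lambda, read in the chart U *)
Definition chart_abs_continuous
    (lam : {measure set (borel 'rV[R]_n) -> \bar R}) (U : chart M 'rV[R]_n) :=
  forall B : set (borel 'rV[R]_n), measurable B -> lam B = 0%E ->
    base_measure (crd U @^-1` B `&` dom U) = 0%E.

Definition invariant_sets (g : R -> Omega -> Omega) : set (set (borel Omega)) :=
  [set B : set (borel Omega) |
     measurable B /\ forall t, mu (B `+` (g t : borel Omega -> _) @^-1` B) = 0%E].

Definition is_cond_exp (I : set (set (borel Omega))) (f F : borel Omega -> R) :=
  [/\ (forall B : set R, measurable B -> I (F @^-1` B)),
      mu.-integrable [set: borel Omega] (EFin \o F) &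
      (forall B, I B -> (\int[mu]_(x in B) (F x)%:E =
                         \int[mu]_(x in B) (f x)%:E)%E)].

Definition weak_L2_cvg (f : R -> borel Omega -> R) (F : borel Omega -> R) :=
  [/\ (forall t, f t \in Lfun mu 2%:E), F \in Lfun mu 2%:E &
      forall phi : borel Omega -> R, phi \in Lfun mu 2%:E ->
        (\int[mu]_x (f t x * phi x)) @[t --> +oo] --> \int[mu]_x (F x * phi x)].

Definition keplerian_shear (g : R -> Omega -> Omega) :=
  forall f : borel Omega -> R, f \in Lfun mu 2%:E ->
    exists F, is_cond_exp (invariant_sets g) f F /\
      weak_L2_cvg (fun t => f \o g t) F.

End bundles.

(* Main.v *)
Require Import Defs.
From HB Require Import structures.
From mathcomp Require Import all_boot all_order all_algebra.
From mathcomp Require Import all_classical all_reals all_analysis.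
From mathcomp Require Import measurable_realfun ring lra.
Import Order.TTheory GRing.Theory Num.Theory.
Import numFieldNormedType.Exports.
Local Open Scope classical_set_scope.
Local Open Scope ring_scope.

(** Let [theta : T^r -> T] be the inverse of [chi] and [th s = theta (s mod Z^r)].
    Every [h(v)^-1 exp(t v) h(v)] is a one-parameter subgroup of the maximal
    torus, hence equals [th (t w)] with [w = Dchi(Ad_(h(v)^-1) v)].  Conjugating
    each fibre by [h(v_U(x))], which preserves Haar measure, turns the flow into
    [(x, y) |-> (x, th (t w(x)) y)] on [M * G] with the measure [mu' * H].

    For Borel subsets [D, D'] of [G] the function [s |-> H (th(s)^-1 D :&: D')] is
    uniformly continuous and [Z^r]-periodic, so it is a uniform limit of
    trigonometric polynomials.  The correlations of rectangles therefore converge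
    as soon as all integrals over Borel sets of [cos (t <xi|w> + a)] against [mu']
    do.  Where [<xi|w> = 0] the integrand does not depend on [t]; elsewhere
    [d<xi|w> <> 0] almost everywhere, and the Riemann-Lebesgue lemma applies: a
    translation by half a period in a direction where the phase is strictly
    monotone reverses the sign of the cosine.

    Finally, if all correlations [mu (g_t^-1 A :&: B)] converge, then [f o g_t]
    converges weakly in [L^2]; the limit is represented by a function [F] which
    the flow leaves invariant and which is the conditional expectation of [f]. *)

Set Implicit Arguments.
Unset Strict Implicit.
Unset Printing Implicit Defensive.

(** * Square-integrable functions *)

(** The maps [h] and [v U] are only measurable, so conjugating the fibres by [h (v U x)] respects
    Borel structure but not topology. This is why the argument is phrased with measurable sets and
    correlations: [M] is cut into disjoint Borel pieces, each inside one of countably many charts,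
    and the maps [w U], which change from chart to chart, are glued along these pieces. Smoothness
    of [w U] is used inside a single chart. Countability also makes open subsets of [M * G]
    measurable for the product of the Borel sigma-algebras.

    Limits of correlations are not computed. Convergence is a Cauchy property stable under
    approximation, and the weak limit is then produced from the limiting linear functional by a
    representation theorem obtained from Radon-Nikodym.

    The half-period argument translates sets in Lebesgue measure, which is infinite. Cut to a cube
    it is finite but no longer invariant, so continuity of translations is proved for families of
    maps that increase measures by arbitrarily little. The same statement, on [G] with Haar measure,
    gives the uniform continuity needed for the trigonometric approximation. *)

(** The limit of [w] is eventually close to [u], so [u] is Cauchy at [+oo]. Density arguments need
    this form, since the limit of [u] is not known beforehand. *)
Lemma cvg_approx (R : realType) (u : R -> R) :
  (forall e, 0 < e -> exists w : R -> R, cvg (w t @[t --> +oo]) /\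
     \forall t \near +oo, `|u t - w t| <= e) -> cvg (u t @[t --> +oo]).
Proof.
move=> H; apply/cauchy_cvgP/cauchy_exP => e e0.
have e2 : 0 < e / 2 by rewrite divr_gt0.
have [w [/cvg_ex[l wl] uw]] := H _ e2.
exists l; rewrite -ball_normE /=.
near=> t => /=.
have h1 : `|l - w t| < e / 2 by near: t; move/cvgrPdist_lt: wl; apply.
have h2 : `|u t - w t| <= e / 2 by near: t.
have -> : l - u t = (l - w t) - (u t - w t) by ring.
apply: (le_lt_trans (ler_normB _ _)); rewrite [ltRHS]splitr.
exact: ltr_leD.
Unshelve. all: by end_near. Qed.

Section integrals.
Context d (T : measurableType d) (R : realType) (mu : probability T R).
Implicit Types (f g : T -> R) (A B : set T).

Definition L1 f := mu.-integrable setT (EFin \o f).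
Definition L2 f := measurable_fun setT f /\ L1 (fun x => f x ^+ 2).
Definition nsq f := \int[mu]_x (f x ^+ 2).

Lemma L1_le f g : measurable_fun setT f -> L1 g ->
  (forall x, `|f x| <= g x) -> L1 f.
Proof.
move=> mf ig fg; apply: (le_integrable _ _ _ ig) => //.
  exact/measurable_EFinP.
move=> x _ /=; rewrite lee_fin (le_trans (fg x))// ler_norm//.
Qed.

Lemma L1_cst c : L1 (fun=> c).
Proof. exact: finite_measure_integrable_cst. Qed.

Lemma L1_bnd f c : measurable_fun setT f -> (forall x, `|f x| <= c) -> L1 f.
Proof. by move=> mf fc; exact: L1_le mf (L1_cst c) fc. Qed.

Lemma L1D f g : L1 f -> L1 g -> L1 (fun x => f x + g x).
Proof. by move=> h1 h2; have := integrableD measurableT h1 h2. Qed.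

Lemma L1Z a f : L1 f -> L1 (fun x => a * f x).
Proof. by move=> h1; have := integrableZl measurableT a h1. Qed.

Lemma L1_meas f : L1 f -> measurable_fun setT f.
Proof. by move=> /measurable_int/measurable_EFinP. Qed.

Lemma intD f g : L1 f -> L1 g ->
  \int[mu]_x (f x + g x) = \int[mu]_x f x + \int[mu]_x g x.
Proof. by move=> ? ?; rewrite RintegralD. Qed.

Lemma intB f g : L1 f -> L1 g ->
  \int[mu]_x (f x - g x) = \int[mu]_x f x - \int[mu]_x g x.
Proof. by move=> ? ?; rewrite RintegralB. Qed.

Lemma intZ a f : L1 f -> \int[mu]_x (a * f x) = a * \int[mu]_x f x.
Proof. by move=> ?; rewrite RintegralZl. Qed.

Lemma le_int f g : L1 f -> L1 g -> (forall x, f x <= g x) ->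
  \int[mu]_x f x <= \int[mu]_x g x.
Proof. by move=> ? ? fg; rewrite le_Rintegral. Qed.

Lemma int_ge0 f : (forall x, 0 <= f x) -> 0 <= \int[mu]_x f x.
Proof. by move=> f0; exact: Rintegral_ge0. Qed.

Lemma int_norm f : L1 f -> `|\int[mu]_x f x| <= \int[mu]_x `|f x|.
Proof. by move=> ?; exact: le_normr_Rintegral. Qed.

Lemma int_cst c : \int[mu]_x c = c.
Proof.
transitivity (c * fine (mu setT)); first exact: Rintegral_cst.
by rewrite probability_setT mulr1.
Qed.

Lemma nsq_ge0 f : 0 <= nsq f.
Proof. by apply: int_ge0 => x; rewrite sqr_ge0. Qed.

Lemma L2Z a f : L2 f -> L2 (fun x => a * f x).
Proof.
move=> [mf fi]; split; first exact: measurable_funM.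
by have := L1Z (a ^+ 2) fi; congr (L1 _); apply/funext => x; rewrite exprMn.
Qed.

Lemma L2M f g : L2 f -> L2 g -> L1 (fun x => f x * g x).
Proof.
move=> [mf fi] [mg gi]; apply: (L1_le _ (L1D fi gi)).
  exact: measurable_funM.
move=> x; rewrite normrM.
have : 0 <= (`|f x| - `|g x|) ^+ 2 by rewrite sqr_ge0.
rewrite -[f x ^+ 2]real_normK ?num_real// -[g x ^+ 2]real_normK ?num_real//.
have := sqr_ge0 (`|f x| + `|g x|).
nra.
Qed.

Lemma L2D f g : L2 f -> L2 g -> L2 (fun x => f x + g x).
Proof.
move=> hf hg; split; first exact: measurable_funD hf.1 hg.1.
have := L1D (L1D hf.2 hg.2) (L1Z 2 (L2M hf hg)).
by congr (L1 _); apply/funext => x; ring.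
Qed.

Lemma L2N f : L2 f -> L2 (fun x => - f x).
Proof.
move=> /(L2Z (-1)); congr (L2 _); apply/funext => x; ring.
Qed.

Lemma L2B f g : L2 f -> L2 g -> L2 (fun x => f x - g x).
Proof. by move=> hf /L2N hg; exact: (L2D hf hg). Qed.

Lemma L2_bnd f c : measurable_fun setT f -> (forall x, `|f x| <= c) -> L2 f.
Proof.
move=> mf fc; split => //; apply: (@L1_bnd _ (c ^+ 2)).
  exact: measurable_funX.
by move=> x; rewrite normrX lerXn2r ?nnegrE// (le_trans _ (fc x)).
Qed.

Lemma L2_indic A : measurable A -> L2 \1_A.
Proof.
move=> mA; apply: (@L2_bnd _ 1); first exact: measurable_indic.
by move=> x; rewrite indicE; case: (_ \in _); rewrite ?normr0 ?normr1.
Qed.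

Lemma L2_L1 f : L2 f -> L1 f.
Proof.
move=> hf; have h1 : L2 (fun=> 1) by apply: (@L2_bnd _ 1) => // x; rewrite normr1.
by have := L2M hf h1; congr (L1 _); apply/funext => x; rewrite mulr1.
Qed.

(** Integrate [k * (|f| - |g| / k) ^+ 2 >= 0]. This plays the role of Cauchy-Schwarz: at each use
    [k] is tuned so that both terms are small. *)
Lemma young f g (k : R) : 0 < k -> L2 f -> L2 g ->
  `|\int[mu]_x (f x * g x)| <= k * nsq f + k^-1 * nsq g.
Proof.
move=> k0 hf hg; apply: (le_trans (int_norm (L2M hf hg))).
rewrite -intZ ?hf.2// -intZ ?hg.2// -intD; [|exact/L1Z/hf.2|exact/L1Z/hg.2].
apply: le_int.
- by have := L2M hf hg; exact: integrable_norm.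
- by apply: L1D; apply: L1Z; [exact: hf.2|exact: hg.2].
move=> x; rewrite normrM.
rewrite -[f x ^+ 2]real_normK ?num_real// -[g x ^+ 2]real_normK ?num_real//.
have kI : k * k^-1 = 1 by rewrite divff// gt_eqF.
have kI0 : 0 < k^-1 by rewrite invr_gt0.
have : 0 <= k * (`|f x| - k^-1 * `|g x|) ^+ 2 by rewrite mulr_ge0 ?sqr_ge0// ltW.
have -> : k * (`|f x| - k^-1 * `|g x|) ^+ 2 = k * `|f x| ^+ 2
   - 2 * (k * k^-1) * (`|f x| * `|g x|) + (k * k^-1) * k^-1 * `|g x| ^+ 2 by ring.
rewrite kI.
have := mulr_ge0 (normr_ge0 (f x)) (normr_ge0 (g x)).
set P := `|f x| * `|g x|; set Q := `|f x| ^+ 2; set S := `|g x| ^+ 2.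
nra.
Qed.

(** Bridge to [Lfun], whose norm is built on real powers; the estimates in between use [L2] and the
    squared norm [nsq]. *)
Lemma L2P f : f \in Lfun mu 2%:E <-> L2 f.
Proof.
split.
- move=> h; split; last exact: Lfun2_integrable_sqr.
  by move: h; rewrite inE => /andP[]; rewrite inE.
- move=> [mf fi]; rewrite inE; apply/andP; split; rewrite inE//=.
  rewrite /finite_norm unlock poweR_lty//.
  have := integrable_lty measurableT fi; congr (_ < _)%E.
  apply: eq_integral => x _ /=.
  by rewrite powR_mulrn// -normrX ger0_norm// sqr_ge0.
Qed.

Lemma int_indicM f A : measurable A -> \int[mu]_x (f x * \1_A x) = \int[mu]_(x in A) f x.
Proof.
move=> mA; rewrite [RHS]Rintegral_mkcond; apply: eq_Rintegral => x _.
by rewrite patchE indicE; case: (_ \in _); rewrite ?mulr1 ?mulr0.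
Qed.

Lemma int_indic A : measurable A -> \int[mu]_x \1_A x = fine (mu A).
Proof. by move=> mA; rewrite /Rintegral integral_indic// setIT. Qed.

Lemma nsq_indic A : measurable A -> nsq \1_A = fine (mu A).
Proof.
move=> mA; rewrite -int_indic//; apply: eq_Rintegral => x _.
by rewrite indicE; case: (_ \in _); rewrite ?expr1n ?expr0n.
Qed.

Lemma nsq_eq0 f : L2 f -> nsq f = 0 -> {ae mu, forall x, f x = 0}.
Proof.
move=> [mf fi] f0.
have : (\int[mu]_x `|(f x ^+ 2)%:E| = 0)%E.
  rewrite (@eq_integral _ _ _ mu setT (fun x => (f x ^+ 2)%:E)); last first.
    by move=> x _ /=; rewrite ger0_norm ?sqr_ge0.
  rewrite -[LHS]fineK; last exact: integrable_fin_num.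
  by congr (_%:E); exact: f0.
move/ae_eq_integral_abs => /(_ measurableT (measurable_int _ fi)).
by apply: filterS => x /(_ I)/= [] /eqP; rewrite sqrf_eq0 => /eqP.
Qed.

Lemma dct_int (f_ : nat -> T -> R) f g : (forall n, measurable_fun setT (f_ n)) ->
  (forall x, f_ ^~ x @ \oo --> f x) -> L1 g -> (forall n x, `|f_ n x| <= g x) ->
  (\int[mu]_x f_ n x) @[n --> \oo] --> \int[mu]_x f x.
Proof.
move=> mf ff gi fg.
have mfl : measurable_fun setT f.
  exact: (@measurable_fun_cvg _ _ _ _ f_).
have ff' x : EFin \o f_ ^~ x @ \oo --> (f x)%:E.
  by apply: cvg_EFin; [exact: nearW|exact: ff].
have [fi _ H] := @dominated_convergence _ _ _ mu setT measurableT
  (fun n => EFin \o f_ n) (EFin \o f) (EFin \o g)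
  (fun n => (iffRL (measurable_EFinP _ _)) (mf n))
  ((iffRL (measurable_EFinP _ _)) mfl)
  (aeW _ (fun x _ => ff' x)) gi
  (aeW _ (fun x n _ => fg n x)).
have ifn n : L1 (f_ n) by exact: L1_le (mf n) gi (fg n).
apply/fine_cvg; rewrite /Rintegral fineK ?(integrable_fin_num _ fi)//.
Qed.

End integrals.

(** * Density of step functions in [L^2] *)

Section L2_density.
Context d (T : measurableType d) (R : realType) (mu : probability T R).
Implicit Types (f g : T -> R) (A B : set T).
Local Notation L2 := (L2 mu).
Local Notation L1 := (L1 mu).
Local Notation nsq := (nsq mu).

Lemma measurable_trunc f (n : R) : measurable_fun setT f ->
  measurable [set y | `|f y| <= n].
Proof.
move=> mf; have h : measurable_fun setT (fun y => `|f y|) by exact: measurableT_comp.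
have := h measurableT _ (@measurable_itv _ `]-oo, n]).
by rewrite setTI; congr measurable; apply/seteqP; split => x /=; rewrite in_itv.
Qed.

Lemma trunc_cvg f : L2 f ->
  nsq (fun x => f x - f x * \1_[set y | `|f y| <= n%:R] x) @[n --> \oo] --> (0 : R).
Proof.
move=> hf; have mA (n : nat) := measurable_trunc n%:R hf.1.
have -> : (0 : R) = \int[mu]_x (0 : R) by rewrite int_cst.
apply: (@dct_int _ _ _ _ _ _ (fun x => f x ^+ 2)) => //.
- move=> n; apply/measurable_funX/measurable_funB; first exact: hf.1.
  by apply: measurable_funM; [exact: hf.1|exact: measurable_indic].
- move=> x; apply: cvg_near_cst; near=> n.
  rewrite indicE mem_set ?mulr1 ?subrr ?expr0n//=.
  by near: n; exact: nbhs_infty_ger.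
- exact: hf.2.
- move=> n x; rewrite indicE; case: (_ \in _).
    by rewrite mulr1 subrr expr0n/= normr0 sqr_ge0.
  by rewrite mulr0 subr0 ger0_norm ?sqr_ge0.
Unshelve. all: by end_near. Qed.

(** The range [[-K, K]] is cut into half-open cells of length [e], and [f] is rounded down to the
    left end of its cell. *)
Lemma step_approx f (K e : R) : measurable_fun setT f -> (forall x, `|f x| <= K) ->
  0 < e -> exists n (c : nat -> R) (A : nat -> set T),
   (forall i, measurable (A i)) /\
   forall x, `|f x - \sum_(i < n) c i * \1_(A i) x| <= e.
Proof.
move=> mf fK e0.
(* The [.+1] is there because the cell of the largest value [K] has index [truncn ((K + K) / e)]
   itself. *)
exists (Num.truncn ((K + K) / e)).+1, (fun i => i%:R * e - K),
  (fun i => f @^-1` `[i%:R * e - K, i.+1%:R * e - K[); split.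
  by move=> i; rewrite -[X in measurable X]setTI; exact: mf.
move=> x; have /andP[fK1 fK2] : - K <= f x <= K by rewrite -ler_norml.
have h0 : 0 <= (f x + K) / e by apply: divr_ge0; [lra|exact: ltW].
set k := Num.truncn ((f x + K) / e).
have /andP[k1 k2] := truncn_itv h0.
have kn : (k < (Num.truncn ((K + K) / e)).+1)%N.
  rewrite ltnS; apply: le_truncn; rewrite ler_pM2r ?invr_gt0//; lra.
rewrite (bigD1 (Ordinal kn))//= big1 ?addr0.
  rewrite ler_pdivlMr// in k1; rewrite ltr_pdivrMr// in k2.
  rewrite indicE mem_set/=; last by rewrite in_itv/= -/k; lra.
  rewrite mulr1 ler_norml; rewrite -natr1 in k2; apply/andP; split; nra.
move=> i ik; rewrite indicE memNset ?mulr0//= in_itv/= => /andP[i1 i2].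
move: ik; rewrite -val_eqE/= => /eqP; apply.
apply/esym/truncn_def => //; rewrite ler_pdivlMr// ltr_pdivrMr//; lra.
Qed.

(** Step functions come from indicators by linear combinations, bounded functions from step
    functions by uniform approximation, and all of [L2] by truncation. *)
Lemma L2_ind (P : (T -> R) -> Prop) :
  (forall A, measurable A -> P \1_A) ->
  (forall a f g, L2 f -> L2 g -> P f -> P g -> P (fun x => a * f x + g x)) ->
  (forall f, L2 f -> (forall e, 0 < e -> exists g, [/\ L2 g, P g &
      nsq (fun x => f x - g x) <= e]) -> P f) ->
  forall f, L2 f -> P f.
Proof.
move=> P1 PD Papp f hf.
have P0 : P (fun=> 0).
  have := P1 _ (@measurable0 _ T); congr P.
  by apply/funext => x; rewrite indicE in_set0.
have Psum n (c : nat -> R) (A : nat -> set T) : (forall i, measurable (A i)) ->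
    L2 (fun x => \sum_(i < n) c i * \1_(A i) x) /\
    P (fun x => \sum_(i < n) c i * \1_(A i) x).
  move=> mA; elim: n => [|n [IH1 IH2]].
    split.
      apply: (@L2_bnd _ _ _ _ _ 0) => [|x]; last by rewrite big_ord0 normr0.
      by under eq_fun do rewrite big_ord0; exact: measurable_cst.
    by have := P0; congr P; apply/funext => x; rewrite big_ord0.
  have E : (fun x => \sum_(i < n.+1) c i * \1_(A i) x) =
    (fun x => c n * \1_(A n) x + \sum_(i < n) c i * \1_(A i) x).
    by apply/funext => x; rewrite big_ord_recr/= addrC.
  by rewrite E; split; [apply: L2D => //; exact/L2Z/L2_indic|
    apply: PD => //; [exact: L2_indic|exact: P1]].
have Pb g K : measurable_fun setT g -> (forall x, `|g x| <= K) -> P g.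
  move=> mg gK; apply: Papp; first exact: L2_bnd mg gK.
  (* The total mass is 1, so a uniform error [Num.sqrt e] gives an [nsq] of at most [e]. *)
  move=> e e0; have se0 : 0 < Num.sqrt e by rewrite sqrtr_gt0.
  have [n [c [A [mA H]]]] := step_approx mg gK se0.
  have [h1 h2] := Psum n c A mA.
  exists (fun x => \sum_(i < n) c i * \1_(A i) x); split => //.
  rewrite -[leRHS](int_cst mu); apply: le_int.
  - exact: (L2B (L2_bnd _ mg gK) h1).2.
  - exact: L1_cst.
  move=> x; rewrite -[leRHS](sqr_sqrtr (ltW e0)) -real_normK ?num_real//.
  by rewrite lerXn2r ?nnegrE ?sqrtr_ge0.
apply: Papp => // e e0.
have /cvgrPdist_le/(_ _ e0)[n _ /(_ n (leqnn n))] := trunc_cvg hf.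
rewrite /= sub0r normrN ger0_norm ?nsq_ge0// => H.
have mA := measurable_trunc n%:R hf.1.
have m1 : measurable_fun setT (fun x => f x * \1_[set y | `|f y| <= n%:R] x).
  by apply: measurable_funM; [exact: hf.1|exact: measurable_indic].
have b1 x : `|f x * \1_[set y | `|f y| <= n%:R] x| <= n%:R.
  rewrite indicE; case: (boolP (_ \in _)) => [|_].
    by rewrite inE /= mulr1.
  by rewrite mulr0 normr0.
eexists; split; [exact: L2_bnd m1 b1|exact: Pb m1 b1|exact: H].
Qed.

End L2_density.

(** * Riesz representation by way of Radon-Nikodym *)

Section riesz.
Context d (T : measurableType d) (R : realType) (mu : probability T R).
Variable (La : (T -> R) -> R) (C : R).
Hypothesis LaD : forall a f g, L2 mu f -> L2 mu g ->
  La (fun x => a * f x + g x) = a * La f + La g.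
(* Continuity of [La] in [L^2], stated through Young's inequality so that no
   square root of an integral occurs. *)
Hypothesis Labnd : forall (k : R) f, 0 < k -> L2 mu f ->
  `|La f| <= k * C + k^-1 * nsq mu f.

Let nu (A : set T) : \bar R := if pselect (measurable A) then (La \1_A)%:E else 0%E.

Let nuE A : measurable A -> nu A = (La \1_A)%:E.
Proof. by rewrite /nu; case: pselect. Qed.

Let C0 : 0 <= C.
Proof.
have l0 : L2 mu (fun=> 0) by apply: (@L2_bnd _ _ _ _ _ 0) => // x; rewrite normr0.
have := le_trans (normr_ge0 _) (Labnd ltr01 l0).
rewrite /nsq (_ : (\int[mu]_x _) = 0); first by rewrite mul1r mulr0 addr0.
by rewrite -[RHS](int_cst mu 0); apply: eq_Rintegral => x _; rewrite expr0n.
Qed.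

Let La0 : La (fun=> 0) = 0.
Proof.
have l0 : L2 mu (fun=> 0) by apply: (@L2_bnd _ _ _ _ _ 0) => // x; rewrite normr0.
have := LaD 1 l0 l0; rewrite (_ : (fun _ => _) = fun=> 0).
  by rewrite mul1r => /eqP; rewrite -subr_eq0 opprD addrA subrr sub0r oppr_eq0 => /eqP.
by apply/funext => x; rewrite mulr0 addr0.
Qed.

Let nu0 : nu set0 = 0%E.
Proof.
rewrite nuE// (_ : \1_set0 = fun=> 0) ?La0//.
by apply/funext => x; rewrite indicE in_set0.
Qed.

Let nufin A : measurable A -> nu A \is a fin_num.
Proof. by move=> mA; rewrite nuE. Qed.

(** [k] makes the constant term of [Labnd] at most [e / 2], then [dlt] takes care of the other term.
    The [+ 1] avoids a division by [C = 0]. *)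
Let La_small (e : R) : 0 < e -> exists2 dlt : R, 0 < dlt & forall f, L2 mu f ->
  nsq mu f <= dlt -> `|La f| <= e.
Proof.
move=> e0; pose k := e / (2 * (C + 1)).
have k0 : 0 < k by rewrite divr_gt0// mulr_gt0// ltr_wpDl.
exists (e / 2 * k); first by rewrite mulr_gt0// divr_gt0.
move=> f hf hn; apply: (le_trans (Labnd k0 hf)).
have : k * C <= e / 2.
  rewrite /k invfM mulrA -mulrA ler_piMr ?divr_ge0 ?(ltW e0)//.
  by rewrite mulrC ler_pdivrMr ?mul1r ?lerDl// ltr_wpDl.
have : k^-1 * nsq mu f <= e / 2 by rewrite ler_pdivrMl// mulrC.
lra.
Qed.

(** Linearity gives finite additivity. The tails [D n] decrease to the empty set, so
    [nsq mu \1_(D n) = mu (D n)] tends to 0 and [La_small] applies. *)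
Let nu_sigma : semi_sigma_additive nu.
Proof.
move=> F mF tF mUF.
have finadd n : nu (\bigcup_(i < n) F i) = (\sum_(0 <= i < n) nu (F i))%E.
  elim: n => [|n IH]; first by rewrite big_nil bigcup_mkord big_ord0.
  have mB : measurable (\bigcup_(i < n) F i).
    by rewrite bigcup_mkord; apply: bigsetU_measurable.
  rewrite big_nat_recr//= -IH !nuE//; last first.
    by rewrite bigcup_mkord; apply: bigsetU_measurable.
  rewrite -EFinD -[La \1_(\bigcup_(i < n) F i)]mul1r -LaD; [|exact: L2_indic|exact: L2_indic].
  congr (La _)%:E; apply/funext => x; rewrite mul1r !indicE.
  have [xF|xF] := pselect (F n x).
    have xN : ~ (\bigcup_(i < n) F i) x.
      move=> [i /= ilt xi]; have := @trivIset_bigsetUI.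
      move/trivIsetP : tF => /(_ i n I I); rewrite ltn_eqF// => /(_ isT).
      by move=> E; have : set0 x by rewrite -E.
    rewrite mem_set; last by exists n => /=.
    by rewrite (memNset xN) mem_set// add0r.
  rewrite [x \in F n]memNset// addr0; congr ((nat_of_bool _)%:R).
  apply/idP/idP; rewrite !inE => -[i /= ilt xi]; exists i => //=.
    by rewrite ltnS leq_eqVlt in ilt; case/predU1P: ilt => // ien; rewrite ien in xi.
  exact: ltnW.
apply: cvg_trans; last first.
  apply: (_ : (fun n => nu (\bigcup_(i < n) F i)) @ \oo --> nu (\bigcup_n F n)).
  rewrite nuE//; apply: cvg_EFin.
    apply: nearW => n; apply: nufin.
    by rewrite bigcup_mkord; apply: bigsetU_measurable.
  apply/cvgrPdist_le => e e0; have [dl dl0 H] := La_small e0.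
  pose D n := (\bigcup_n F n) `\` \bigcup_(i < n) F i.
  have mD n : measurable (D n).
    apply: measurableD => //.
    by rewrite bigcup_mkord; apply: bigsetU_measurable.
  have Dto : mu (D n) @[n --> \oo] --> mu (\bigcap_n D n).
    apply: nonincreasing_cvg_mu => //.
    - by rewrite (le_lt_trans (probability_le1 mu (mD 0%N)))// ltry.
    - exact: bigcapT_measurable.
    - move=> m n mn; apply/subsetPset => x [xU xn]; split => //.
      by move=> [i /= im xi]; apply: xn; exists i => //=; exact: leq_trans im mn.
  have D0 : \bigcap_n D n = set0.
    apply/seteqP; split => // x xD.
    have [[n _ xn] _] := xD 0%N I.
    have [_] := xD n.+1 I; apply; exists n => //=.
  rewrite D0 measure0 in Dto.
  have /fine_cvgP[_ /cvgrPdist_le/(_ _ dl0)] := Dto.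
  apply: filterS => n /=; rewrite sub0r normrN => Hn.
  have mB : measurable (\bigcup_(i < n) F i).
    by rewrite bigcup_mkord; apply: bigsetU_measurable.
  rewrite nuE//=.
  have -> : La \1_(\bigcup_n F n) - La \1_(\bigcup_(i < n) F i) = La \1_(D n).
    apply/eqP; rewrite subr_eq -[La \1_(D n)]mul1r -LaD; [|exact: L2_indic|exact: L2_indic].
    apply/eqP; congr (La _); apply/funext => x; rewrite mul1r !indicE /D.
    rewrite in_setD.
    have [xB|xB] := pselect ((\bigcup_(i < n) F i) x).
      rewrite !mem_set//= ?add0r//.
      by case: xB => i _ xi; exists i.
    by rewrite (memNset xB) addr0 andbT.
  apply: H; first exact: L2_indic.
  by rewrite nsq_indic//; apply: le_trans Hn; rewrite ler_norm.
by rewrite (_ : (fun n => _) = (fun n => nu (\bigcup_(i < n) F i)))//; apply/funext.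
Qed.

HB.instance Definition _ := isCharge.Build _ T R nu nu0 nufin nu_sigma.

(** [F] is the density of the charge [A |-> La \1_A]. At first it is only known to be integrable,
    hence the order: indicators, step functions, bounded functions, then [F] in [L2], and finally
    all of [L2]. *)
Lemma riesz : exists F, L2 mu F /\ forall f, L2 mu f -> La f = \int[mu]_x (F x * f x).
Proof.
have numu : nu `<< mu.
  apply/null_content_dominatesP => A mA muA.
  rewrite nuE//; congr (_%:E); apply/eqP; rewrite -normr_eq0; apply/eqP/le_anti.
  rewrite normr_ge0 andbT; apply/ler_addgt0Pl => e e0; rewrite addr0.
  have [dl dl0 H] := La_small e0; apply: H; first exact: L2_indic.
  by rewrite nsq_indic// muA /= ltW.
pose f0 := Radon_Nikodym nu mu; pose F x := fine (f0 x).
have f0E : f0 = EFin \o F.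
  by apply/funext => x /=; rewrite fineK//; exact: Radon_Nikodym_fin_num.
have F1 : L1 mu F.
  by have := @Radon_Nikodym_integrable _ _ _ nu mu numu; rewrite -/f0 f0E.
have mF := L1_meas F1.
have bndL1 (f : T -> R) (c : R) : measurable_fun setT f -> (forall x, `|f x| <= c) ->
    L1 mu (fun x => F x * f x).
  move=> mf fc; apply: (@L1_le _ _ _ _ _ (fun x => c * `|F x|)).
  - exact: measurable_funM.
  - by apply: L1Z; exact: integrable_norm.
  - by move=> x; rewrite normrM mulrC ler_wpM2r.
have E1 A : measurable A -> La \1_A = \int[mu]_x (F x * \1_A x).
  move=> mA; rewrite int_indicM//.
  have RE : (La \1_A)%:E = (\int[mu]_(x in A) f0 x)%E.
    by rewrite -(nuE mA); exact: (Radon_Nikodym_integral numu).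
  by rewrite f0E in RE; have := congr1 fine RE.
have Esum n (c : nat -> R) (A : nat -> set T) : (forall i, measurable (A i)) ->
    [/\ L2 mu (fun x => \sum_(i < n) c i * \1_(A i) x),
     L1 mu (fun x => F x * \sum_(i < n) c i * \1_(A i) x) &
    La (fun x => \sum_(i < n) c i * \1_(A i) x) =
      \int[mu]_x (F x * \sum_(i < n) c i * \1_(A i) x)].
  move=> mA; elim: n => [|n [IH1 IH2 IH3]].
    have E0 : (fun x => \sum_(i < 0) c i * \1_(A i) x) = (fun x : T => 0 : R).
      by apply/funext => x; rewrite big_ord0.
    rewrite E0 La0; split.
    - by apply: (@L2_bnd _ _ _ _ _ 0) => // x; rewrite normr0.
    - apply: (@L1_bnd _ _ _ _ _ 0) => [|x]; last by rewrite big_ord0 mulr0 normr0.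
      by under eq_fun do rewrite big_ord0 mulr0; exact: measurable_cst.
    rewrite -[LHS](int_cst mu); apply: eq_Rintegral => x _.
    by rewrite big_ord0 mulr0.
  have E : (fun x => \sum_(i < n.+1) c i * \1_(A i) x) =
    (fun x => c n * \1_(A n) x + \sum_(i < n) c i * \1_(A i) x).
    by apply/funext => x; rewrite big_ord_recr/= addrC.
  have l1 : L1 mu (fun x => F x * \1_(A n) x).
    apply: (@bndL1 _ 1) => [|x]; first exact: measurable_indic.
    by rewrite indicE; case: (_ \in _); rewrite ?normr0 ?normr1.
  have E' : (fun x => F x * \sum_(i < n.+1) c i * \1_(A i) x) =
    (fun x => c n * (F x * \1_(A n) x) + F x * \sum_(i < n) c i * \1_(A i) x).
    by apply/funext => x; rewrite big_ord_recr/=; ring.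
  rewrite E E'; split.
  - by apply: L2D => //; exact/L2Z/L2_indic.
  - by apply: L1D => //; exact: L1Z.
  - rewrite intD ?intZ//; last exact: L1Z.
    rewrite LaD//; last exact: L2_indic.
    by rewrite IH3 E1.
have Eb (f : T -> R) (c : R) : measurable_fun setT f -> (forall x, `|f x| <= c) ->
    La f = \int[mu]_x (F x * f x).
  move=> mf fc; apply/eqP; rewrite -subr_eq0 -normr_eq0; apply/eqP/le_anti.
  rewrite normr_ge0 andbT; apply/ler_addgt0Pl => e e0; rewrite addr0.
  have e20 : 0 < e / 2 by rewrite divr_gt0.
  have [dl dl0 H] := La_small e20.
  pose I0 := \int[mu]_x `|F x|.
  have I00 : 0 <= I0 by exact: int_ge0.
  (* The first bound makes [La (f - s)] small through [La_small]; the second makes the integral of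
     [F * (f - s)] small although [F] is so far merely integrable. *)
  pose e1 := Num.min (Num.sqrt dl) (e / 2 / (I0 + 1)).
  have e10 : 0 < e1.
    by rewrite lt_min sqrtr_gt0 dl0 !divr_gt0// ltr_wpDl.
  have [n [cc [A [mA HA]]]] := step_approx mf fc e10.
  have [h1 h2 h3] := Esum n cc A mA.
  set s := (fun x => \sum_(i < n) cc i * \1_(A i) x) in HA h1 h2 h3.
  have hf : L2 mu f by exact: L2_bnd mf fc.
  have hfs : L2 mu (fun x => f x - s x) by exact: L2B.
  have -> : La f - \int[mu]_x (F x * f x) = La (fun x => f x - s x) - \int[mu]_x (F x * (f x - s x)).
    have -> : (fun x => f x - s x) = (fun x => (-1) * s x + f x).
      by apply/funext => x; ring.
    rewrite LaD// h3.
    have -> : \int[mu]_x (F x * (f x - s x)) = \int[mu]_x (F x * f x - F x * s x).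
      by apply: eq_Rintegral => x _; ring.
    rewrite intB//; last exact: bndL1 mf fc.
    ring.
  apply: (le_trans (ler_normB _ _)); rewrite [leRHS]splitr; apply: lerD.
    apply: H => //; rewrite -[leRHS](int_cst mu); apply: le_int.
    - exact: hfs.2.
    - exact: L1_cst.
    move=> x; rewrite -[leRHS](sqr_sqrtr (ltW dl0)) -real_normK ?num_real//.
    rewrite lerXn2r ?nnegrE ?sqrtr_ge0//.
    by apply: (le_trans (HA x)); rewrite /e1 ge_min lexx.
  have l1 : L1 mu (fun x => F x * (f x - s x)).
    by apply: (@bndL1 _ e1) => //; exact: hfs.1.
  apply: (le_trans (int_norm l1)).
  apply: (@le_trans _ _ (\int[mu]_x (e1 * `|F x|))).
    apply: le_int; first exact: integrable_norm.
      by apply: L1Z; exact: integrable_norm.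
    by move=> x; rewrite normrM mulrC ler_wpM2r// HA.
  rewrite intZ; last exact: integrable_norm.
  rewrite -/I0; apply: (@le_trans _ _ (e / 2 / (I0 + 1) * I0)).
    by rewrite ler_wpM2r// /e1 ge_min lexx orbT.
  rewrite -mulrA ler_piMr ?divr_ge0 ?(ltW e0)//.
  by rewrite mulrC ler_pdivrMr ?mul1r ?lerDl// ltr_wpDl.
have F2 : L2 mu F.
  split => //.
  pose FN n x := F x * \1_[set y | `|F y| <= n%:R] x.
  have mA (n : nat) := measurable_trunc n%:R mF.
  have mFN n : measurable_fun setT (FN n).
    by apply: measurable_funM => //; exact: measurable_indic.
  have bFN n x : `|FN n x| <= n%:R.
    rewrite /FN indicE; case: (boolP (_ \in _)) => [|_].
      by rewrite inE /= mulr1.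
    by rewrite mulr0 normr0.
  have FNsq n x : F x * FN n x = FN n x ^+ 2.
    by rewrite /FN indicE; case: (_ \in _); rewrite ?(mulr1, mulr0) ?expr0n ?expr2.
  (* Testing against the truncation gives [nsq (FN n) = La (FN n) <= 2 * C + nsq (FN n) / 2], by
     [Labnd] with [k = 2]. The bound does not depend on [n], so monotone convergence puts [F] in
     [L2]. *)
  have nFN n : nsq mu (FN n) <= 4 * C.
    have l2 : (0 : R) < 2 by [].
    have := Labnd l2 (L2_bnd mu (mFN n) (bFN n)).
    rewrite (Eb _ _ (mFN n) (bFN n)).
    have -> : \int[mu]_x (F x * FN n x) = nsq mu (FN n).
      by apply: eq_Rintegral => x _; rewrite FNsq.
    rewrite ger0_norm ?nsq_ge0//; lra.
  apply/integrableP; split; first by apply/measurable_EFinP; exact: measurable_funX.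
  apply: (@le_lt_trans _ _ (4 * C)%:E); last exact: ltry.
  have := @cvg_monotone_convergence _ _ _ mu setT measurableT
    (fun n x => (FN n x ^+ 2)%:E).
  move=> /(_ (fun n => (iffRL (measurable_EFinP _ _)) (measurable_funX 2 (mFN n)))).
  have p0 n (x : T) : setT x -> (0 <= (FN n x ^+ 2)%:E)%E by rewrite lee_fin sqr_ge0.
  move=> /(_ p0).
  have nd x : setT x -> nondecreasing_seq (fun n => (FN n x ^+ 2)%:E).
    move=> _ m n mn; rewrite lee_fin /FN !indicE.
    case: (boolP (x \in [set y | `|F y| <= m%:R])) => [|_]; last first.
      by rewrite mulr0 expr0n sqr_ge0.
    rewrite inE /= => Fm; rewrite mem_set//=.
    by apply: (le_trans Fm); rewrite ler_nat.
  move=> /(_ nd) H.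
  rewrite (_ : (\int[mu]_x _)%E = (\int[mu]_x (limn (fun n => (FN n x ^+ 2)%:E)))%E).
    rewrite -(cvg_lim (@ereal_hausdorff R) H); apply: lime_le.
      by apply/cvg_ex; eexists; exact: H.
    apply: nearW => n; have := nFN n; rewrite -lee_fin; congr (_ <= _)%E.
    rewrite /nsq /Rintegral fineK//.
    have [_ FNi] := L2_bnd mu (mFN n) (bFN n).
    exact: integrable_fin_num FNi.
  apply: eq_integral => x _.
  apply/esym/cvg_lim => //; apply: cvg_near_cst; near=> n.
  rewrite /= ger0_norm ?sqr_ge0// /FN indicE mem_set ?mulr1//=.
  by near: n; exact: nbhs_infty_ger.
exists F; split => // f hf.
apply: (@L2_ind _ _ _ mu (fun f => La f = \int[mu]_x (F x * f x))) hf => //.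
- move=> a f1 f2 hf1 hf2 E2 E3; have l1 := L2M F2 hf1; have l2 := L2M F2 hf2.
  rewrite LaD// E2 E3 -intZ// -intD//; last exact: L1Z.
  by apply: eq_Rintegral => x _; ring.
move=> f1 hf1 H.
apply/eqP; rewrite -subr_eq0 -normr_eq0; apply/eqP/le_anti.
rewrite normr_ge0 andbT; apply/ler_addgt0Pl => e e0; rewrite addr0.
have e20 : 0 < e / 2 by rewrite divr_gt0.
have [dl dl0 Hd] := La_small e20.
(* Tuned for [young]: [k * nsq mu F <= e / 4], and [g] is then taken so close to [f1] that the other
   term is at most [e / 4] as well. *)
pose k := e / 4 / (nsq mu F + 1).
have nF0 := nsq_ge0 mu F.
have k0 : 0 < k by rewrite !divr_gt0// ltr_wpDl.
have m0 : 0 < Num.min dl (k * (e / 4)) by rewrite lt_min dl0 mulr_gt0// divr_gt0.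
have [g [hg Eg ng]] := H _ m0.
have hfg : L2 mu (fun x => f1 x - g x) by exact: L2B.
have -> : La f1 - \int[mu]_x (F x * f1 x) =
    La (fun x => f1 x - g x) - \int[mu]_x (F x * (f1 x - g x)).
  have -> : (fun x => f1 x - g x) = (fun x => (-1) * g x + f1 x).
    by apply/funext => x; ring.
  rewrite LaD// Eg.
  have -> : \int[mu]_x (F x * (f1 x - g x)) = \int[mu]_x (F x * f1 x - F x * g x).
    by apply: eq_Rintegral => x _; ring.
  rewrite intB//; [ring|exact: L2M|exact: L2M].
apply: (le_trans (ler_normB _ _)); rewrite [leRHS]splitr; apply: lerD.
  by apply: Hd => //; apply: (le_trans ng); rewrite ge_min lexx.
apply: (le_trans (young k0 F2 hfg)).
have : k^-1 * nsq mu (fun x => f1 x - g x) <= e / 4.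
  by rewrite ler_pdivrMl//; apply: (le_trans ng); rewrite ge_min lexx orbT.
have : k * nsq mu F <= e / 4.
  rewrite /k -mulrA ler_piMr ?divr_ge0 ?(ltW e0)//.
  by rewrite mulrC ler_pdivrMr ?mul1r ?lerDl// ltr_wpDl.
lra.
Unshelve. all: by end_near. Qed.

End riesz.

(** * From convergence of correlations to Keplerian shear *)

Section measure_preserving.
Context d d' (X : measurableType d) (Y : measurableType d') (R : realType).
Variables (mu : {measure set X -> \bar R}) (P : {measure set Y -> \bar R}) (h : X -> Y).
Hypothesis mh : measurable_fun setT h.
Hypothesis ph : forall B, measurable B -> mu (h @^-1` B) = P B.

Lemma mp_integrable (f : Y -> R) : P.-integrable setT (EFin \o f) ->
  mu.-integrable setT (EFin \o (f \o h)).
Proof.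
move=> fi; have mf := measurable_int _ fi.
apply/integrableP; split.
  by apply/measurable_EFinP; apply: measurableT_comp => //; exact/measurable_EFinP.
move/integrableP: fi => [_]; congr (_ < _)%E.
rewrite (@eq_measure_integral _ _ _ _ (pushforward mu h)); last first.
  by move=> A mA _; rewrite -ph.
by rewrite ge0_integral_pushforward//; exact: measurableT_comp.
Qed.

Lemma mp_integral (f : Y -> R) : P.-integrable setT (EFin \o f) ->
  \int[mu]_x f (h x) = \int[P]_y f y.
Proof.
move=> fi; have mf := measurable_int _ fi.
rewrite /Rintegral; congr fine; apply/esym.
rewrite (@eq_measure_integral _ _ _ _ (pushforward mu h)); last first.
  by move=> A mA _; rewrite -ph.
by rewrite integral_pushforward//; have := mp_integrable fi.
Qed.

End measure_preserving.

Section shear.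
Context (R : realType) (Omega : ptopologicalType) (mu : probability (borel Omega) R).
Variable g : R -> borel Omega -> borel Omega.
Hypothesis gflow : is_flow g.
Hypothesis mg : forall t, measurable_fun setT (g t).
Hypothesis pg : forall t B, measurable B -> mu (g t @^-1` B) = mu B.
Hypothesis gcorr : forall A B, measurable A -> measurable B ->
  cvg (fine (mu (g t @^-1` A `&` B)) @[t --> +oo]).
Implicit Types f phi : borel Omega -> R.

Let L2g t f : L2 mu f -> L2 mu (f \o g t).
Proof.
move=> [mf fi]; split; first exact: measurableT_comp.
exact: (@mp_integrable _ _ _ _ R mu mu (g t) (mg t) (pg t) _ fi).
Qed.

Let intg t f : L1 mu f -> \int[mu]_x f (g t x) = \int[mu]_x f x.
Proof. exact: (@mp_integral _ _ _ _ R mu mu (g t) (mg t) (pg t)). Qed.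

Let nsqg t f : L2 mu f -> nsq mu (f \o g t) = nsq mu f.
Proof. by move=> [_ fi]; rewrite /nsq -(intg t fi). Qed.

Let corr f phi t := \int[mu]_x (f (g t x) * phi x).

Let corrDl a f1 f2 phi t : L2 mu f1 -> L2 mu f2 -> L2 mu phi ->
  corr (fun x => a * f1 x + f2 x) phi t = a * corr f1 phi t + corr f2 phi t.
Proof.
move=> h1 h2 hp; have h1p := L2M (L2g t h1) hp; have h2p := L2M (L2g t h2) hp.
rewrite /corr -intZ// -intD//; last exact: L1Z.
by apply: eq_Rintegral => x _ /=; ring.
Qed.

Let corrDr a f phi1 phi2 t : L2 mu f -> L2 mu phi1 -> L2 mu phi2 ->
  corr f (fun x => a * phi1 x + phi2 x) t = a * corr f phi1 t + corr f phi2 t.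
Proof.
move=> hf h1 h2; have h1p := L2M (L2g t hf) h1; have h2p := L2M (L2g t hf) h2.
rewrite /corr -intZ// -intD//; last exact: L1Z.
by apply: eq_Rintegral => x _ /=; ring.
Qed.

Let corr_young f phi t (k : R) : 0 < k -> L2 mu f -> L2 mu phi ->
  `|corr f phi t| <= k * nsq mu f + k^-1 * nsq mu phi.
Proof. by move=> k0 hf hp; rewrite -(nsqg t hf); apply: young => //; exact: L2g. Qed.

Let cvgZD (a : R) (u v : R -> R) : cvg (u t @[t --> +oo]) -> cvg (v t @[t --> +oo]) ->
  cvg (a * u t + v t @[t --> +oo]).
Proof. by move=> hu hv; apply: is_cvgD => //; exact: is_cvgMr. Qed.

(** [L2_ind] is applied in [phi] and, for [phi = \1_B], again in [f]. In both approximation steps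
    [corr_young] bounds the error uniformly in [t], because [nsq] is invariant under the flow. *)
Let corr_cvg f phi : L2 mu f -> L2 mu phi -> cvg (corr f phi t @[t --> +oo]).
Proof.
move=> hf; move: phi; apply: L2_ind => [B mB|a p1 p2 h1 h2 c1 c2|phi hphi H].
- move: f hf; apply: L2_ind => [A mA|a f1 f2 h1 h2 c1 c2|f hf H].
  + suff -> : corr \1_A \1_B = (fun t => fine (mu (g t @^-1` A `&` B))) by exact: gcorr.
    apply/funext => t.
    have mgA : measurable (g t @^-1` A) by rewrite -[X in measurable X]setTI; exact: mg.
    rewrite -int_indic; last exact: measurableI.
    by apply: eq_Rintegral => x _; rewrite indicI.
  + have hB := L2_indic mu mB.
    under eq_fun do rewrite corrDl//.
    exact: cvgZD.
  + apply: cvg_approx => e e0.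
    have nB := nsq_ge0 mu \1_B.
    (* This [k] gives [k^-1 * nsq mu \1_B <= e / 2]; [f'] is then chosen so that
       [k * nsq mu (f - f') <= e / 2]. *)
    pose k := 2 * (nsq mu \1_B + 1) / e.
    have k0 : 0 < k by rewrite !(divr_gt0, mulr_gt0)// ltr_wpDl.
    have ek : 0 < e / 2 / k by rewrite divr_gt0// divr_gt0.
    have [f' [hf' c' n']] := H _ ek.
    exists (corr f' \1_B); split => //; apply: nearW => t.
    have hB := L2_indic mu mB.
    have -> : corr f \1_B t - corr f' \1_B t = corr (fun x => f x - f' x) \1_B t.
      have -> : (fun x => f x - f' x) = (fun x => (-1) * f' x + f x).
        by apply/funext => x; ring.
      by rewrite corrDl//; ring.
    apply: (le_trans (corr_young _ k0 (L2B hf hf') hB)).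
    have : k * nsq mu (fun x => f x - f' x) <= e / 2.
      by rewrite mulrC -ler_pdivlMr.
    have : k^-1 * nsq mu \1_B <= e / 2.
      rewrite /k invf_div mulrC mulrA ler_pdivrMr ?mulr_gt0 ?ltr_wpDl//.
      nra.
    lra.
- under eq_fun do rewrite corrDr//.
  exact: cvgZD.
- apply: cvg_approx => e e0.
  have nf := nsq_ge0 mu f.
  pose k := e / 2 / (nsq mu f + 1).
  have k0 : 0 < k by rewrite !divr_gt0// ltr_wpDl.
  have ek : 0 < e / 2 * k by rewrite mulr_gt0// divr_gt0.
  have [f' [hf' c' n']] := H _ ek.
  exists (corr f f'); split => //; apply: nearW => t.
  have -> : corr f phi t - corr f f' t = corr f (fun x => phi x - f' x) t.
    have -> : (fun x => phi x - f' x) = (fun x => (-1) * f' x + phi x).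
      by apply/funext => x; ring.
    by rewrite corrDr//; ring.
  apply: (le_trans (corr_young _ k0 hf (L2B hphi hf'))).
  have : k^-1 * nsq mu (fun x => phi x - f' x) <= e / 2.
    by rewrite mulrC ler_pdivrMr.
  have : k * nsq mu f <= e / 2.
    rewrite /k mulrAC ler_pdivrMr ?ltr_wpDl//; nra.
  lra.
Qed.

(** The limits of [corr f phi] form a bounded linear functional of [phi], which [F] represents.
    Invariance of [F] comes from shifting time in the limit, and its integrals over invariant sets
    from correlations that are constant in [t]. *)
Lemma cvg_corr_shear : keplerian_shear mu g.
Proof.
move=> f /L2P hf.
pose La phi := lim (corr f phi t @[t --> +oo]).
have LaE phi : L2 mu phi -> corr f phi t @[t --> +oo] --> La phi.
  by move=> hp; exact: corr_cvg.
have LaD a p1 p2 : L2 mu p1 -> L2 mu p2 ->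
    La (fun x => a * p1 x + p2 x) = a * La p1 + La p2.
  move=> h1 h2; apply: cvg_lim => //.
  under eq_fun do rewrite corrDr//.
  by apply: cvgD; [apply: cvgMr; exact: LaE|exact: LaE].
have Lab (k : R) phi : 0 < k -> L2 mu phi -> `|La phi| <= k * nsq mu f + k^-1 * nsq mu phi.
  move=> k0 hp; 
  have H : `|corr f phi t| @[t --> +oo] --> `|La phi| by apply: cvg_norm; exact: LaE.
  rewrite -(cvg_lim (@norm_hausdorff _ _) H); apply: limr_le; first by apply/cvg_ex; eexists; exact: H.
  by apply: nearW => t; exact: corr_young.
have [F [hF FE]] := riesz LaD Lab.
(* Moving [g s] onto the test function shifts the time of the correlation by [s], which leaves its
   limit unchanged. Testing [F \o g s] and [F] against their difference then gives norm zero. *)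
have FI s : {ae mu, forall x, F (g s x) = F x}.
  have hFs := L2g s hF.
  have key phi : L2 mu phi -> \int[mu]_x (F (g s x) * phi x) = \int[mu]_x (F x * phi x).
    move=> hp; have hps := L2g (- s) hp.
    have gK x : g (- s) (g s x) = x by rewrite -gflow.2 addNr gflow.1.
    have -> : \int[mu]_x (F (g s x) * phi x) = \int[mu]_x (F x * phi (g (- s) x)).
      rewrite -(intg s (L2M hF hps)); apply: eq_Rintegral => x _ /=.
      by rewrite gK.
    rewrite -(FE _ hps) -(FE _ hp); apply: cvg_lim => //.
    have E t : corr f (phi \o g (- s)) t = corr f phi (t + s).
      rewrite /corr -(intg s (L2M (L2g t hf) hps)); apply: eq_Rintegral => x _ /=.
      by rewrite -gflow.2 gK.
    under eq_fun do rewrite E.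
    apply: (@cvg_comp _ _ _ (fun t => t + s) (corr f phi) +oo +oo) => //.
      apply/cvgryPge => A; near=> t; rewrite -lerBlDr; near: t.
      by apply: nbhs_pinfty_ge; rewrite num_real.
    exact: LaE.
  have hD := L2B hFs hF.
  have : nsq mu (fun x => F (g s x) - F x) = 0.
    have -> : nsq mu (fun x => F (g s x) - F x) = \int[mu]_x (F (g s x) * (F (g s x) - F x) - F x * (F (g s x) - F x)).
      by apply: eq_Rintegral => x _; ring.
    rewrite intB ?key ?subrr//; [exact: L2M hFs hD|exact: L2M].
  move/(nsq_eq0 hD); apply: filterS => x /eqP.
  by rewrite subr_eq0 => /eqP.
exists F; split; last first.
  split => [t||phi /L2P hp]; [by apply/L2P; exact: L2g|exact/L2P|].
  by rewrite -FE//; exact: LaE.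
split.
(* Preimages under [F] are invariant modulo null sets: membership can only change where
   [F (g t x) != F x]. *)
- move=> B mB; have mFB : measurable (F @^-1` B).
    by rewrite -[X in measurable X]setTI; exact: hF.1.
  split => // t.
  have [N [mN muN HN]] := FI t.
  have mgFB : measurable (g t @^-1` (F @^-1` B)).
    by rewrite -[X in measurable X]setTI; exact: mg.
  apply/eqP; rewrite eq_le measure_ge0 andbT -muN; apply: le_measure.
  + by rewrite inE; apply: measurableU; exact: measurableD.
  + by rewrite inE.
  move=> x H; apply: HN => /= E; move: H => -[] [] /=; rewrite ?E //.
- by have := L2_L1 hF.
move=> B [mB HB].
have conv (k : borel Omega -> R) : L1 mu k ->
    (\int[mu]_(x in B) (k x)%:E)%E = (\int[mu]_x (k x * \1_B x))%:E.
  move=> hk; rewrite int_indicM// /Rintegral fineK//.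
  apply: integrable_fin_num => //; exact: integrableS hk.
rewrite !conv; [|exact: L2_L1..]; congr (_%:E).
rewrite -FE; last exact: L2_indic.
(* For an invariant [B], replacing [\1_B] by [\1_B \o g t] changes nothing almost everywhere, so the
   correlation equals the integral of [f] over [B] for every [t]. *)
apply: cvg_lim => //; apply: cvg_near_cst; apply: nearW => t.
have hB := L2_indic mu mB.
rewrite -(intg t (L2M hf hB)) /corr /Rintegral; congr fine.
have m1 := L1_meas (L2M (L2g t hf) hB).
have m2 := L1_meas (L2M (L2g t hf) (L2g t hB)).
apply: ae_eq_integral => //; [exact/measurable_EFinP|exact/measurable_EFinP|].
have mgB : measurable (g t @^-1` B) by rewrite -[X in measurable X]setTI; exact: mg.
exists (B `+` g t @^-1` B); split => //.
- by apply: measurableU; exact: measurableD.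
- exact: HB.
move=> x /= /not_implyP[_ H]; apply: contrapT => Hx; apply: H.
congr (_%:E); rewrite /= !indicE; congr (_ * (nat_of_bool _)%:R).
apply/idP/idP; rewrite !inE => h.
  by apply: contrapT => h'; apply: Hx; left.
by apply: contrapT => h'; apply: Hx; right.
Unshelve. all: by end_near. Qed.

End shear.

(** * Second countable locally compact spaces *)

(** Second countability and local compactness in one object: the interiors form a countable base, as
    product sigma-algebras require, and the compact sets exhaust open sets from inside, as
    continuity of translations requires. *)
Definition compact_base (X : topologicalType) (K : nat -> set X) :=
  (forall i, compact (K i)) /\
  forall x O, open O -> O x -> exists i, K i `<=` O /\ (K i)° x.

Definition cbox (R : realType) n (a b : 'rV[R]_n) :=
  [set x : 'rV[R]_n | forall i, a 0 i <= x 0 i <= b 0 i].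

Lemma cbox_compact (R : realType) n (a b : 'rV[R]_n) : compact (cbox a b).
Proof.
have := @rV_compact R n (fun i => `[a 0 i, b 0 i]%classic)
  (fun i => @segment_compact _ _ _).
congr compact; apply/seteqP; split => x /= H i; move: (H i) => /=; rewrite ?in_itv//.
Qed.

Lemma rV_compact_base (R : realType) n :
  exists a b : nat -> 'rV[R]_n, compact_base (fun k => cbox (a k) (b k)).
Proof.
(* All boxes with rational corners; integers that encode no pair of corners give the box reduced to
   the origin. *)
pose ab (k : nat) := odflt (0, 0) (unpickle k : option ('rV[rat]_n * 'rV[rat]_n)).
exists (fun k => map_mx ratr (ab k).1), (fun k => map_mx ratr (ab k).2).
split=> [k|x O oO Ox]; first exact: cbox_compact.
have [P Px PO] : nbhs x O by exact: open_nbhs_nbhs.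
have /choice[p Hp] : forall j : 'I_n, exists q : rat * rat,
    [/\ ratr q.1 < x 0 j, x 0 j < ratr q.2 &
     forall y, ratr q.1 <= y <= ratr q.2 -> P 0 j y].
  move=> j; have /nbhs_ballP[e /= e0 eP] := Px 0 j.
  have h1 : x 0 j - e < x 0 j by rewrite ltrBlDr ltrDl.
  have h2 : x 0 j < x 0 j + e by rewrite ltrDl.
  have [q1 /[!in_itv]/= /andP[q11 q12]] := rat_in_itvoo h1.
  have [q2 /[!in_itv]/= /andP[q21 q22]] := rat_in_itvoo h2.
  exists (q1, q2); split => //= y /andP[y1 y2].
  by apply: eP; rewrite -ball_normE /= distrC ltr_distl; apply/andP; split; lra.
exists (pickle (\row_j (p j).1, \row_j (p j).2)); rewrite /ab pickleK /=; split.
  move=> y /= yb; apply: PO => i j; rewrite ord1.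
  by have [_ _] := Hp j; apply; have := yb j; rewrite !mxE.
exists (fun _ j => [set y | ratr (p j).1 <= y <= ratr (p j).2]) => [i j|y /= H j].
  rewrite ord1; have [h1 h2 _] := Hp j.
  exists (Num.min (x 0 j - ratr (p j).1) (ratr (p j).2 - x 0 j)) => /=.
    by rewrite lt_min !subr_gt0 h1.
  move=> y /=; rewrite lt_min => /andP[].
  rewrite !ltr_norml => /andP[a1 a2] /andP[a3 a4]; apply/andP; split; lra.
by rewrite !mxE; exact: H.
Qed.

Lemma open_bigcup_base (X : topologicalType) (K : nat -> set X) (O : set X) :
  compact_base K -> open O ->
  O = \bigcup_(i in [set i | K i `<=` O]) (K i)° /\
  O = \bigcup_(i in [set i | K i `<=` O]) K i.
Proof.
move=> [_ KB] oO; split; apply/seteqP; split => x.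
- by move=> Ox; have [i [h1 h2]] := KB _ _ oO Ox; exists i.
- by move=> [i /= KO /interior_subset/KO].
- by move=> Ox; have [i [h1 h2]] := KB _ _ oO Ox; exists i => //; exact: interior_subset.
- by move=> [i /= KO /KO].
Qed.

(** The sets are the images under [par] of the rational boxes that fit in a chart; the other codes
    give the empty set, which is compact too. *)
Lemma atlas_compact_base (R : realType) (X : topologicalType) n
    (U : nat -> chart X 'rV[R]_n) :
  (forall i, is_chart (U i)) -> (forall x, exists i, dom (U i) x) ->
  exists K : nat -> set X, compact_base K.
Proof.
move=> cU covU; have [a [b [cK KB]]] := rV_compact_base R n.
pose K (m : nat) := let: (i, j) := odflt (0, 0)%N (unpickle m : option (nat * nat)) in
  if pselect (cbox (a j) (b j) `<=` crd (U i) @` dom (U i))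
  then par (U i) @` cbox (a j) (b j) else set0.
exists K; split.
  move=> m; rewrite /K; case: (odflt _ _) => i j.
  case: pselect => [sub|nsub] /=; last exact: compact0.
  apply: continuous_compact; last exact: cK.
  have [_ _ [_ [_ cp]]] := cU i.
  exact: continuous_subspaceW cp.
move=> x O oO Ox; have [i xi] := covU x.
have [odom ocrd [[f1 f2 f3 f4] [c1 c2]]] := cU i.
pose W := (crd (U i) @` dom (U i)) `&` par (U i) @^-1` O.
have oW : open W.
  have h : {in crd (U i) @` dom (U i), continuous (par (U i))}.
    by rewrite -continuous_open_subspace.
  exact: (iffLR (continuous_inP _ ocrd) h _ oO).
have Wx : W (crd (U i) x) by split; [exists x|rewrite /= f3].
have [j [KW xK]] := KB _ _ oW Wx.
have sub : cbox (a j) (b j) `<=` crd (U i) @` dom (U i).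
  by move=> y /KW[].
exists (pickle (i, j)); rewrite /K pickleK /=; case: pselect => [sub'|//] /=; split.
  by move=> _ [y /KW[_ yO] <-].
have oV : open (dom (U i) `&` crd (U i) @^-1` (cbox (a j) (b j))°).
  have : {in dom (U i), continuous (crd (U i))} by rewrite -continuous_open_subspace.
  by move/(continuous_inP _ odom) => /(_ _ (@open_interior _ _)).
apply: (filterS _ (open_nbhs_nbhs (conj oV (conj xi xK)))).
move=> y [yd /interior_subset yK]; exists (crd (U i) y) => //; exact: f3.
Qed.

Lemma lindelof_atlas_seq (R : realType) (X : ptopologicalType) (E : normedModType R)
    (A : set (chart X E)) :
  lindelof X -> (forall c, A c -> is_chart c) -> (forall x, exists2 c, A c & dom c x) ->
  exists U : nat -> chart X E, (forall i, A (U i)) /\ (forall x, exists i, dom (U i) x).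
Proof.
move=> lX chA cov0.
have /choice[ch chP] : forall x, exists c, A c /\ dom c x.
  by move=> x; have [c] := cov0 x; exists c.
have ch1 x := (chP x).1; have ch2 x := (chP x).2.
have oD x : open (dom (ch x)) by have [] := chA _ (ch1 x).
have cov : [set: X] `<=` \bigcup_x dom (ch x) by move=> x _; exists x.
have [J cJ JX] := lX _ _ oD cov.
(* [pfcard_geP] sets apart an empty [J], which cannot cover [X] since [X] has a point. *)
move: cJ => /pfcard_geP[J0|/unsquash f].
  by have [x] := JX point I; rewrite J0.
exists (ch \o f); split => [i|x]; first exact: ch1.
have [y Jy yx] := JX x I.
by have [k _ kE] := @surj _ _ _ _ f y Jy; exists k; rewrite /= kE.
Qed.

Lemma compact_lindelof (X : ptopologicalType) : compact [set: X] -> lindelof X.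
Proof.
move=> cX I D oD cov.
have /choice[s sP] : forall x : X, exists i, D i x.
  by move=> x; have [i _ ix] := cov x Logic.I; exists i.
have : cover_compact [set: X] by rewrite -compact_cover.
move=> /(_ X setT (D \o s)) [|x _|F _ cF].
- by move=> x _; exact: oD.
- by exists x.
have [C [fC cC]] : exists C, finite_set C /\ [set: X] `<=` cover C (D \o s).
  by eexists; split; last exact: cF; exact: finite_fset.
exists (s @` C); last first.
  by move=> x _; have [y /= yF yx] := cC x Logic.I; exists (s y) => //; exists y.
exact/finite_set_countable/finite_image.
Qed.

(** Rectangles of basic open sets form a countable base of the product. Through this lemma,
    continuous maps on a product become measurable for the product of the Borel sigma-algebras. *)
Lemma open_measurable_prod (X Y : ptopologicalType) (K : nat -> set X)
    (L : nat -> set Y) (O : set (X * Y)) :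
  compact_base K -> compact_base L -> open O ->
  measurable (O : set (borel X * borel Y)).
Proof.
move=> [_ KB] [_ LB] oO.
have -> : O = \bigcup_(m in [set m : nat * nat | (K m.1)° `*` (L m.2)° `<=` O])
    ((K m.1)° `*` (L m.2)°).
  apply/seteqP; split => [[x y] Oxy|_ [m /= mO /mO]//].
  have [[P Q] /= [Px Qy] PQO] : nbhs (x, y) O by exact: open_nbhs_nbhs.
  have [i [iP xi]] := KB _ _ (@open_interior _ P) Px.
  have [j [jQ yj]] := LB _ _ (@open_interior _ Q) Qy.
  exists (i, j) => //= -[x' y'] [/= x'i y'j]; apply: PQO; split => /=.
    exact: (interior_subset (iP _ (interior_subset x'i))).
  exact: (interior_subset (jQ _ (interior_subset y'j))).
rewrite bigcup_mkcond; apply: countable_bigcupT_measurable => [|[i j]].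
  exact: countableP.
case: ifP => _ //; apply: measurableX.
  by apply: sub_sigma_algebra; exact: open_interior.
by apply: sub_sigma_algebra; exact: open_interior.
Qed.

(** * Continuity of translations in measure, for an abstract family of maps [a z] *)

Section translation.
Context (R : realType) (X : ptopologicalType) (K : nat -> set X) (Z : Type)
  (F : set_system Z) (a : Z -> X -> X).
Variable (P : {finite_measure set (borel X) -> \bar R}).
Hypotheses (FF : Filter F) (KB : compact_base K) (XT2 : hausdorff_space X).
Hypothesis a_meas : forall z, measurable_fun setT (a z : borel X -> borel X).
Hypothesis a_near : forall y O, open O -> O y -> \forall y' \near y & z \near F, O (a z y').
Hypothesis a_bnd : forall A : set (borel X), measurable A -> forall e : R, 0 < e ->
  \forall z \near F, (P (a z @^-1` A) <= P A + e%:E)%E.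

Let D z (A : set X) := (A `\` a z @^-1` A) `|` (a z @^-1` A `\` A).
Let good (A : set (borel X)) := measurable A /\ forall e : R, 0 < e ->
  \forall z \near F, (P (D z A) <= e%:E)%E.

Let ma z (A : set (borel X)) : measurable A -> measurable (a z @^-1` A : set (borel X)).
Proof. by move=> mA; rewrite -[X in measurable X]setTI; exact: a_meas. Qed.

Let mD z (A : set (borel X)) : measurable A -> measurable (D z A : set (borel X)).
Proof.
by move=> mA; apply: measurableU; apply: measurableD => //; exact: ma.
Qed.

Let Pfin (A : set (borel X)) : measurable A -> P A \is a fin_num.
Proof. by move=> mA; exact: fin_num_measure. Qed.

Let leP (A B : set (borel X)) : measurable A -> measurable B -> A `<=` B -> (P A <= P B)%E.
Proof. by move=> mA mB AB; apply: le_measure; rewrite ?inE. Qed.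

Let small_tail (B : nat -> set (borel X)) (e : R) : 0 < e -> (forall n, measurable (B n)) ->
  nondecreasing_seq B -> exists n, (P (\bigcup_n B n `\` B n) <= e%:E)%E.
Proof.
move=> e0 mB nB.
have mU : measurable (\bigcup_n B n) by exact: bigcupT_measurable.
pose C n := \bigcup_n B n `\` B n.
have mC n : measurable (C n) by exact: measurableD.
have C0 : \bigcap_n C n = set0.
  by apply/seteqP; split => // x xC; have [[n _ nx] _] := xC 0%N I; have [_] := xC n I.
have : P \o C @ \oo --> P (\bigcap_n C n).
  apply: nonincreasing_cvg_mu => //.
  - by rewrite ltey_eq Pfin.
  - by rewrite C0.
  - by move=> m n mn; apply/subsetPset => x [xU xn]; split => // xm; apply: xn;
      move/subsetPset: (nB _ _ mn); exact.
rewrite C0 measure0 => /fine_cvgP[_ /cvgrPdist_le/(_ _ e0)[n _ /(_ n (leqnn n))]].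
rewrite /= sub0r normrN => H; exists n; rewrite -[leLHS]fineK ?Pfin//; last exact: mC.
by rewrite lee_fin (le_trans _ H)// ler_norm.
Qed.

Let goodC A : good A -> good (~` A).
Proof.
move=> [mA HA]; split; first exact: measurableC.
move=> e e0; apply: filterS (HA _ e0) => z; congr (P _ <= _)%E.
rewrite /D; apply/seteqP; split => x [] [/= h1 h2].
- by right; split => //; exact: contrapT.
- by left; split => //; exact: contrapT.
- by right; split => //; exact: contrapT.
- by left; split => //; exact: contrapT.
Qed.

Let goodU A B : good A -> good B -> good (A `|` B).
Proof.
move=> [mA HA] [mB HB]; split; first exact: measurableU.
move=> e e0; have e2 : 0 < e / 2 by rewrite divr_gt0.
near=> z.
apply: (@le_trans _ _ (P (D z A `|` D z B))).
  apply: leP; [by apply: mD; exact: measurableU|by apply: measurableU; exact: mD|].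
  by move=> x []; rewrite /D /=; tauto.
apply: (le_trans (measureU2 _ (mD _ mA) (mD _ mB))).
rewrite [in leRHS](splitr e) EFinD; apply: leeD.
  by near: z; exact: HA.
by near: z; exact: HB.
Unshelve. all: by end_near. Qed.

Let good0 : good set0.
Proof.
split => // e e0; near=> z; rewrite /D preimage_set0 setDv setU0 measure0.
by rewrite lee_fin ltW.
Unshelve. all: by end_near. Qed.

(** A finite union [B n] misses a tail [C] of small measure, and [a_bnd] keeps the preimage of [C]
    small. The four quarters of [e] are the finite union, [C], and the two terms of the bound for
    the preimage of [C]. *)
Let good_bigcup (A : nat -> set (borel X)) : (forall n, good (A n)) -> good (\bigcup_n A n).
Proof.
move=> gA; have mA n : measurable (A n) := (gA n).1.
have mU : measurable (\bigcup_n A n) by exact: bigcupT_measurable.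
split => // e e0.
pose B n : set (borel X) := \big[setU/set0]_(i < n) A i.
have gB n : good (B n).
  rewrite /B; elim: n => [|n IH]; first by rewrite big_ord0.
  by rewrite big_ord_recr /=; exact: goodU.
have mB n : measurable (B n) := (gB n).1.
have BU : \bigcup_n B n = \bigcup_n A n.
  apply/seteqP; split => x [n _].
    by rewrite /B -bigcup_mkord => -[i /= _ xi]; exists i.
  by move=> xn; exists n.+1 => //; rewrite /B -bigcup_mkord; exists n => /=.
have ndB : nondecreasing_seq B.
  move=> m n mn; apply/subsetPset => x; rewrite /B -!bigcup_mkord => -[i /= im xi].
  by exists i => //=; exact: leq_trans mn.
have e4 : 0 < e / 4 by rewrite divr_gt0.
have [n nsmall] := small_tail e4 mB ndB; rewrite BU in nsmall.
set C := (\bigcup_n A n) `\` B n in nsmall.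
have mC : measurable (C : set (borel X)) by exact: measurableD.
near=> z.
have h1 : (P (D z (B n)) <= (e / 4)%:E)%E by near: z; exact: (gB n).2.
have h2 : (P (a z @^-1` C) <= P C + (e / 4)%:E)%E by near: z; exact: a_bnd.
have sub : D z (\bigcup_n A n) `<=` D z (B n) `|` (C `|` a z @^-1` C).
  have Bs : B n `<=` \bigcup_n A n by rewrite -BU => x xn; exists n.
  move=> x [] [/= xA xN].
    have [xB|xB] := pselect (B n x); last by right; left.
    by left; left; split => // /Bs.
  have [xB|xB] := pselect (B n (a z x)); last by right; right.
  by left; right; split => // /Bs.
apply: (le_trans (leP _ _ sub)); first exact: mD.
  by apply: measurableU; [exact: mD|apply: measurableU => //; exact: ma].
apply: (le_trans (measureU2 _ _ _)); [exact: mD|by apply: measurableU => //; exact: ma|].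
have h3 : (P (C `|` a z @^-1` C) <= P C + P (a z @^-1` C))%E.
  by apply: measureU2 => //; exact: ma.
have : (P (D z (B n)) + P (C `|` a z @^-1` C) <= (e / 4)%:E + ((e / 4)%:E + ((e / 4)%:E + (e / 4)%:E)))%E.
  apply: leeD => //; apply: (le_trans h3); apply: leeD => //.
  by apply: (le_trans h2); exact: leeD.
move/le_trans; apply; rewrite -!EFinD lee_fin; lra.
Unshelve. all: by end_near. Qed.

(** A compact part [B n] carries almost all of [O], and by [a_near] and compactness [a z] maps it
    into [O] eventually, so [O] loses little. What is gained is then bounded by comparing total
    masses with [a_bnd]. *)
Let good_open O : open O -> good O.
Proof.
move=> oO; have mO : measurable (O : set (borel X)) by exact: sub_sigma_algebra.
split => // e e0; have e4 : 0 < e / 4 by rewrite divr_gt0.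
pose L i : set X := if pselect (K i `<=` O) then K i else set0.
have cL i : compact (L i).
  by rewrite /L; case: pselect => h /=; [exact: KB.1|exact: compact0].
have LO i : L i `<=` O by rewrite /L; case: pselect => h //=; exact: sub0set.
pose B n : set X := \big[setU/set0]_(i < n) L i.
have cB n : compact (B n).
  by rewrite /B; elim/big_ind : _ => //; [exact: compact0|exact: compactU].
have mB n : measurable (B n : set (borel X)).
  rewrite -[B n]setCK; apply: measurableC; apply: sub_sigma_algebra.
  by apply: closed_openC; exact: compact_closed.
have BO n : B n `<=` O by rewrite /B -bigcup_mkord => x [i _ /LO].
have BU : \bigcup_n B n = O.
  apply/seteqP; split => [x [n _ /BO]//|x Ox].
  have [i [iO xi]] := KB.2 _ _ oO Ox; exists i.+1 => //.
  rewrite /B -bigcup_mkord; exists i => //=; rewrite /L; case: pselect => [h|//] /=.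
  exact: interior_subset.
have ndB : nondecreasing_seq B.
  move=> m n mn; apply/subsetPset => x; rewrite /B -!bigcup_mkord => -[i /= im xi].
  by exists i => //=; exact: leq_trans mn.
have [n nsmall] := small_tail e4 mB ndB; rewrite BU in nsmall.
have : \forall z \near F, B n `<=` a z @^-1` O.
  have /compact_near_coveringP cov := cB n.
  apply: (cov _ F (fun z x => O (a z x))) => x xB.
  by apply: a_near => //; exact: BO xB.
move=> nB; near=> z.
have h0 : B n `<=` a z @^-1` O by near: z.
have h1 : (P (O `\` a z @^-1` O) <= (e / 4)%:E)%E.
  apply: le_trans nsmall; apply: leP.
  - by apply: measurableD => //; exact: ma.
  - exact: measurableD.
  - by move=> x [xO xN]; split => // /h0.
have h2 : (P (a z @^-1` O) <= P O + (e / 4)%:E)%E by near: z; exact: a_bnd.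
have maO := ma z mO.
have h3 : (P (a z @^-1` O `\` O) <= (e / 4)%:E + (e / 4)%:E)%E.
  have fDI (A A' : set (borel X)) : measurable A -> measurable A' ->
      fine (P A) = fine (P (A `\` A')) + fine (P (A `&` A')).
    move=> mA mA'; rewrite -fineD ?Pfin//; [|exact: measurableD|exact: measurableI].
    by congr fine; exact: measureDI.
  have d1 := fDI _ _ maO mO; have d2 := fDI _ _ mO maO.
  rewrite (setIC O) in d2.
  have f1 := fineK (Pfin mO); have f2 := fineK (Pfin maO).
  have f3 := fineK (Pfin (measurableD mO maO)).
  have f4 := fineK (Pfin (measurableD maO mO)).
  rewrite -f3 lee_fin in h1; rewrite -f2 -f1 -EFinD lee_fin in h2.
  rewrite -f4 -EFinD lee_fin; lra.
apply: (le_trans (measureU2 _ _ _)); [by apply: measurableD|by apply: measurableD|].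
have : (P (O `\` a z @^-1` O) + P (a z @^-1` O `\` O) <= (e / 4)%:E + ((e / 4)%:E + (e / 4)%:E))%E.
  exact: leeD.
move/le_trans; apply; rewrite -!EFinD lee_fin; lra.
Unshelve. all: by end_near. Qed.

(** The good sets form a sigma-algebra containing the open sets. The lemma serves twice: for
    Lebesgue measure cut to a cube, invariant up to the error in [a_bnd], and for Haar measure under
    torus translations. *)
Lemma translation_continuity (A : set (borel X)) : measurable A -> forall e : R, 0 < e ->
  \forall z \near F, (P ((A `\` a z @^-1` A) `|` (a z @^-1` A `\` A)) <= e%:E)%E.
Proof.
move=> mA; suff : good A by case.
move: A mA; apply: smallest_sub; last exact: good_open.
split => //; first by move=> A gA; rewrite setTD; exact: goodC.
Qed.

End translation.

(** * The Riemann-Lebesgue lemma *)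

Section oscillation.
Context d (T : measurableType d) (R : realType) (m : {measure set T -> \bar R}).
Variable phi : T -> R.
Hypothesis mphi : measurable_fun setT phi.
Variable al : R.

Definition osc t x : R := cos (t * phi x + al).
Definition oscint t E : R := \int[m]_(x in E) osc t x.

Lemma measurable_osc t : measurable_fun setT (osc t).
Proof.
apply: (@measurableT_comp _ _ _ _ _ _ (@cos R)).
  by apply: continuous_measurable_fun; exact: continuous_cos.
by apply: measurable_funD => //; exact: measurable_funM.
Qed.

Lemma osc_le1 t x : `|osc t x| <= 1. Proof. exact: cos_max. Qed.

Lemma osc_integrable t E : measurable E -> (m E < +oo)%E ->
  m.-integrable E (EFin \o osc t).
Proof.
move=> mE mEoo; apply: measurable_bounded_integrable => //.
  exact: measurable_funTS (measurable_osc t).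
by exists 1; split => // M M1 x _ /=; rewrite (le_trans (osc_le1 _ _))// ltW.
Qed.

Lemma oscint_le t E : measurable E -> (m E < +oo)%E -> `|oscint t E| <= fine (m E).
Proof.
move=> mE mEoo; have h := osc_integrable t mE mEoo.
apply: (le_trans (le_normr_Rintegral mE h)).
rewrite -[leRHS]mul1r -Rintegral_cst//; apply: le_Rintegral => //.
- exact: integrable_norm.
- apply: measurable_bounded_integrable => //.
  by exists 1; split => // M M1 x _ /=; rewrite normr1 ltW.
by move=> x _; exact: osc_le1.
Qed.

Lemma oscintU t E E' : measurable E -> measurable E' -> (m (E `|` E') < +oo)%E ->
  E `&` E' = set0 -> oscint t (E `|` E') = oscint t E + oscint t E'.
Proof.
move=> mE mE' mU /eqP EE'; rewrite /oscint Rintegral_setU//.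
exact: osc_integrable (measurableU _ _ mE mE') mU.
Qed.

(* A translate of the phase by a half period changes the sign of the
   oscillating factor, so that the integral nearly cancels with its translate. *)
Lemma oscint_pair (tau : T -> T) t E (s : R) : measurable E -> (m E < +oo)%E ->
  measurable_fun setT tau -> (forall B, measurable B -> m (tau @^-1` B) = m B) ->
  0 <= s -> (forall x, E x -> E (tau x) -> `|osc t x + osc t (tau x)| <= s) ->
  2 * `|oscint t E| <= s * fine (m E) + 2 * fine (m (E `\` tau @^-1` E)).
Proof.
move=> mE mEoo mtau ptau s0 Hs.
pose k := osc t \_ E.
have ik : m.-integrable setT (EFin \o k).
  by have := iffLR (integrable_mkcond _ mE) (osc_integrable t mE mEoo);
    rewrite /k restrict_EFin.
have ikt := mp_integrable mtau ptau ik.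
have Ek : oscint t E = \int[m]_x k x by rewrite /oscint Rintegral_mkcond.
have mtE : measurable (tau @^-1` E) by rewrite -[X in measurable X]setTI; exact: mtau.
have mtEoo : (m (tau @^-1` E) < +oo)%E by rewrite ptau.
have mD1 := measurableD mE mtE; have mD2 := measurableD mtE mE.
have mI := measurableI _ _ mE mtE.
have lefin (A B : set T) : measurable A -> measurable B -> A `<=` B ->
    (m B < +oo)%E -> (m A < +oo)%E.
  by move=> mA mB AB; apply: le_lt_trans; apply: le_measure; rewrite ?inE.
have f1 : (m (E `\` tau @^-1` E) < +oo)%E by apply: (lefin _ _ mD1 mE) => // x [].
have f2 : (m (tau @^-1` E `\` E) < +oo)%E by apply: (lefin _ _ mD2 mtE) => // x [].
have f3 : (m (E `&` tau @^-1` E) < +oo)%E by apply: (lefin _ _ mI mE) => // x [].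
have iind A : measurable A -> (m A < +oo)%E -> m.-integrable setT (EFin \o (\1_A : T -> R)).
  move=> mA Aoo; apply/integrableP; split.
    by apply/measurable_EFinP; exact: measurable_indic.
  rewrite (eq_integral (fun x => (\1_A x)%:E)); last first.
    by move=> x _ /=; rewrite ger0_norm.
  by rewrite integral_indic// setIT.
(* [tau] preserves [m], so both halves of the symmetric difference have the same measure. *)
have eD : fine (m (tau @^-1` E `\` E)) = fine (m (E `\` tau @^-1` E)).
  have h1 := measureDI m mE mtE; 
  have h2 : (m E = m (tau @^-1` E `\` E) + m (E `&` tau @^-1` E))%E.
    by rewrite (setIC E); exact: (etrans (esym (ptau _ mE)) (measureDI m mtE mE)).
  have h3 : (m (E `\` tau @^-1` E) + m (E `&` tau @^-1` E) =
             m (tau @^-1` E `\` E) + m (E `&` tau @^-1` E))%E := etrans (esym h1) h2.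
  have := congr1 fine h3.
  rewrite !fineD ?ge0_fin_numE ?measure_ge0//.
  by move=> h; exact: (addIr _ (esym h)).
have -> : 2 * `|oscint t E| = `|\int[m]_x (k x + k (tau x))|.
  rewrite RintegralD// (mp_integral mtau ptau ik) -Ek -mulr2n.
  by rewrite normrMn mulr_natl.
have ikk : m.-integrable setT (EFin \o (fun x => k x + k (tau x))).
  exact: (integrableD measurableT ik ikt).
apply: (le_trans (le_normr_Rintegral measurableT ikk)).
(* Where both [x] and [tau x] lie in [E] the two terms nearly cancel; where only one of them does, a
   single term of modulus at most 1 is left. *)
pose G x := s * \1_E x + (\1_(E `\` tau @^-1` E) x + \1_(tau @^-1` E `\` E) x) : R.
have i1 : m.-integrable setT (EFin \o (fun x => s * \1_E x)).
  exact: (integrableZl measurableT s (iind _ mE mEoo)).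
have i2 : m.-integrable setT (EFin \o (fun x => \1_(E `\` tau @^-1` E) x + \1_(tau @^-1` E `\` E) x : R)).
  exact: (integrableD measurableT (iind _ mD1 f1) (iind _ mD2 f2)).
apply: (@le_trans _ _ (\int[m]_x G x)).
  apply: le_Rintegral => //.
  - exact: integrable_norm.
  - exact: (integrableD measurableT i1 i2).
  move=> x _; rewrite /G /k /patch !indicE !in_setD.
  have -> : (x \in tau @^-1` E) = (tau x \in E) by apply/idP/idP; rewrite !inE.
  case: (boolP (x \in E)) => xE; case: (boolP (tau x \in E)) => txE /=.
  - by rewrite mulr1 !addr0; apply: Hs; [move: xE|move: txE]; rewrite inE.
  - rewrite !addr0 mulr1; apply: (le_trans (osc_le1 _ _)); lra.
  - rewrite !add0r mulr0 add0r; exact: osc_le1.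
  - by rewrite !addr0 mulr0 normr0.
rewrite /G RintegralD// RintegralD//; [|exact: iind|exact: iind].
rewrite RintegralZl//; last exact: iind.
have ri A : measurable A -> \int[m]_x (\1_A x : R) = fine (m A).
  by move=> mA; rewrite /Rintegral integral_indic// setIT.
rewrite !ri// eD; lra.
Qed.

End oscillation.

Lemma cos_lip (R : realType) (x y : R) : `|cos x - cos y| <= `|x - y|.
Proof.
wlog xy : x y / x <= y => [H|].
  by case: (leP x y) => [/H//|/ltW/H]; rewrite distrC [leRHS]distrC.
have [c _ E] := @MVT_segment R cos (fun x => - sin x) x y xy
  (fun x _ => is_derive_cos x)
  (continuous_subspaceT (@continuous_cos R)).
by rewrite distrC [leRHS]distrC E normrM normrN ler_piMl// sin_max.
Qed.

(** * Lebesgue measure on row vectors: boxes, cubes and translation invariance *)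

Section lebesgue_rV.
Context (R : realType) (n : nat) (lam : {measure set (borel 'rV[R]_n) -> \bar R}).
Hypothesis hlam : is_lebesgue lam.
Local Notation V := 'rV[R]_n.

Lemma rV_hausdorff : hausdorff_space V.
Proof. exact: norm_hausdorff. Qed.

Lemma measurable_cbox (a b : V) : measurable (cbox a b : set (borel V)).
Proof.
rewrite -[cbox a b]setCK; apply: measurableC; apply: sub_sigma_algebra.
apply: closed_openC; apply: compact_closed; first exact: rV_hausdorff.
exact: cbox_compact.
Qed.

(** The empty set makes the family stable under intersection; the order on the corners is the case
    that [is_lebesgue] covers. *)
Definition boxes : set (set V) := [set A | A = set0 \/ exists a b : V, (forall i, a 0 i <= b 0 i) /\ A = cbox a b].

Lemma cbox_boxes (a b : V) : boxes (cbox a b).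
Proof.
have [ab|/existsNP[i ab]] := pselect (forall i, a 0 i <= b 0 i).
  by right; exists a, b.
left; apply/seteqP; split => // x /(_ i) /andP[h1 h2].
by apply: ab; exact: le_trans h2.
Qed.

Lemma boxes_setI : setI_closed boxes.
Proof.
move=> A B [->|[a [b [ab ->]]]]; first by rewrite set0I; left.
move=> [->|[a' [b' [ab' ->]]]]; first by rewrite setI0; left.
have -> : cbox a b `&` cbox a' b' =
    cbox (\row_i Num.max (a 0 i) (a' 0 i)) (\row_i Num.min (b 0 i) (b' 0 i)).
  apply/seteqP; split => x /=.
    move=> [h1 h2] i; rewrite !mxE ge_max le_min.
    by have /andP[-> ->] := h1 i; have /andP[-> ->] := h2 i.
  move=> h; split => i; have := h i; rewrite !mxE ge_max le_min;
    by move=> /andP[/andP[h1 h2] /andP[h3 h4]]; apply/andP; split.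
exact: cbox_boxes.
Qed.

Lemma measurable_boxes : (measurable : set (set (borel V))) = <<s boxes >>.
Proof.
apply/seteqP; split; last first.
  apply: smallest_sub; first exact: sigma_algebra_measurable.
  by move=> A [->|[a [b [_ ->]]]] //; exact: measurable_cbox.
apply: smallest_sub; first exact: smallest_sigma_algebra.
move=> O oO; have [a [b KB]] := rV_compact_base R n.
have [_ ->] := open_bigcup_base KB oO.
rewrite bigcup_mkcond; apply: sigma_algebra_bigcup => i.
case: ifP => _; last exact: sigma_algebra0.
by apply: sub_sigma_algebra; exact: cbox_boxes.
Qed.

Definition ccube (k : R) : set V := cbox (const_mx (- k)) (const_mx k).

Lemma ccube_cover : \bigcup_(k : nat) ccube k%:R = setT.
Proof.
apply/seteqP; split => // x _.
pose s := \sum_i `|x 0 i|.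
have [k _ /(_ k (leqnn k))/= H] := @nbhs_infty_ger R s.
exists k => // i; rewrite !mxE -ler_norml (le_trans _ H)//.
by rewrite /s (bigD1 i)//= lerDl sumr_ge0.
Qed.

Lemma ccube_fin (k : R) : 0 <= k -> (lam (ccube k) < +oo)%E.
Proof. by move=> k0; rewrite [X in (X < _)%E]hlam ?ltry// => i; rewrite !mxE; lra. Qed.

Lemma measurable_shift (z : V) : measurable_fun setT ((fun x => x + z) : borel V -> borel V).
Proof.
move=> _ B mB; rewrite setTI; move: B mB; apply: smallest_sub.
  split => //.
  - by rewrite preimage_set0.
  - by move=> A mA; rewrite setTD preimage_setC; exact: measurableC.
  - by move=> A mA; rewrite preimage_bigcup; exact: bigcupT_measurable.
move=> O oO; apply: sub_sigma_algebra.
apply: open_comp => // x _; apply: (@continuousD R V V id (cst z)) => //.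
exact: cst_continuous.
Qed.

(** Both measures agree on boxes, a pi-system that generates the Borel sets, and are finite on cubes
    that cover the space. *)
Lemma lam_shift (z : V) (A : set (borel V)) : measurable A ->
  lam ((fun x => x + z) @^-1` A) = lam A.
Proof.
move=> mA.
have ms : measurable_fun setT ((fun x => x + z) : borel V -> borel V).
  exact: measurable_shift.
apply: (@measure_unique _ R (borel V) boxes (fun k => ccube k%:R) measurable_boxes
  boxes_setI _ ccube_cover (pushforward lam ((fun x => x + z) : borel V -> borel V)) lam) => //.
- by move=> i; exact: cbox_boxes.
- move=> _ [->|[a [b [ab ->]]]]; first by rewrite !measure0.
  change (lam ((fun x => x + z) @^-1` cbox a b) = lam (cbox a b)).
  have -> : (fun x => x + z) @^-1` cbox a b = cbox (a - z) (b - z).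
    apply/seteqP; split => x h i; have := h i; rewrite !mxE /= => /andP[h1 h2];
      apply/andP; split; lra.
  rewrite [LHS]hlam; last by move=> i; rewrite !mxE; have := ab i; lra.
  rewrite [RHS]hlam//; congr (_%:E); apply: eq_bigr => i _; rewrite !mxE; ring.
- move=> k; change (lam ((fun x : V => (x + z)%R) @^-1` ccube k%:R) < +oo)%E.
  have -> : (fun x => x + z) @^-1` ccube k%:R = cbox (const_mx (- k%:R) - z) (const_mx k%:R - z).
    apply/seteqP; split => x h i; have := h i; rewrite !mxE /= => /andP[h1 h2];
      apply/andP; split; lra.
  rewrite [X in (X < _)%E]hlam ?ltry// => i; rewrite !mxE.
  have : (0 : R) <= k%:R by []. lra.
Qed.

End lebesgue_rV.

(** Strict differentiability at [x0] along [e], with slope [c != 0]. Uniformity in [x] lets one and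
    the same translation serve a whole neighbourhood of [x0]. *)
Definition strict_dir (R : realType) (V : normedModType R) (phi : V -> R) (x0 : V) :=
  exists (e : V) (c : R), c != 0 /\ forall eta, 0 < eta ->
    \forall x \near x0 & dl \near (0 : R),
      `|phi (x + dl *: e) - phi x - dl * c| <= eta * `|dl|.

Lemma three_quarters_le (R : realFieldType) (x e : R) : x <= e / 4 -> 0 < e ->
  x + e / 4 + e / 4 <= e.
Proof. lra. Qed.

(** * The Riemann-Lebesgue lemma for Lebesgue measure cut to a cube *)

Section riemann_lebesgue.
Context (R : realType) (n : nat) (lam : {measure set (borel 'rV[R]_n) -> \bar R}).
Hypothesis hlam : is_lebesgue lam.
Local Notation V := 'rV[R]_n.
Variable k0 : R.
Hypothesis k00 : 0 <= k0.
Let W : set (borel V) := ccube k0.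
Let mW : measurable W := measurable_cbox _ _.
Let P := mfrestr mW (ccube_fin hlam k00).

Let PE (A : set (borel V)) : P A = lam (A `&` W). Proof. by []. Qed.

Let Pfin (A : set (borel V)) : measurable A -> P A \is a fin_num.
Proof. by move=> mA; exact: fin_num_measure. Qed.

Let fP A := fine (P A).

Let fPD (A B : set (borel V)) : measurable A -> measurable B -> A `&` B = set0 ->
  fP (A `|` B) = fP A + fP B.
Proof.
move=> mA mB AB; rewrite /fP -fineD ?Pfin//; congr fine.
exact: measureU.
Qed.

(** Mass can only enter from outside the cube, that is from the shell [Wk k] once [z] is no longer
    than [k.+1%:R^-1], and these shells shrink to the empty set. *)
Let Pshift (A : set (borel V)) : measurable A -> forall e : R, 0 < e ->
  \forall z \near nbhs (0 : V), (P ((fun x => (x + z)%R) @^-1` A) <= P A + e%:E)%E.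
Proof.
move=> mA e e0.
pose Wk (k : nat) : set (borel V) := ccube (k0 + k.+1%:R^-1) `\` W.
have mWk k : measurable (Wk k) by apply: measurableD => //; exact: measurable_cbox.
have kp (k : nat) : 0 <= k0 + k.+1%:R^-1 by apply: addr_ge0.
have Wk0 : \bigcap_k Wk k = set0.
  apply/seteqP; split => // x xW; have [_ xN] := xW 0%N I; apply: xN => i.
  rewrite !mxE -ler_norml; apply/ler_addgt0Pl => d d0.
  have [k _ /(_ k (leqnn k))/= H] := near_infty_natSinv_lt (PosNum d0).
  have [/(_ i)] := xW k I; rewrite !mxE -ler_norml => h _.
  by apply: (le_trans h); rewrite addrC lerD2r ltW.
have : lam \o Wk @ \oo --> lam (\bigcap_k Wk k).
  apply: nonincreasing_cvg_mu => //.
  - apply: le_lt_trans (ccube_fin hlam (kp 0%N)).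
    by apply: le_measure; rewrite ?inE//; [exact: measurable_cbox|move=> x []].
  - by rewrite Wk0.
  - move=> i j ij; apply/subsetPset => x [xj xN]; split => // l.
    have := xj l; rewrite !mxE -!ler_norml => h; apply: (le_trans h).
    by rewrite lerD2l lef_pV2 ?posrE// ler_nat.
rewrite Wk0 measure0 => /fine_cvgP[_ /cvgrPdist_le/(_ _ e0)[k _ /(_ k (leqnn k))]].
rewrite /= sub0r normrN => H.
have Wkfin : lam (Wk k) \is a fin_num.
  rewrite ge0_fin_numE ?measure_ge0//; apply: le_lt_trans (ccube_fin hlam (kp k)).
  by apply: le_measure; rewrite ?inE//; [exact: measurable_cbox|move=> x []].
have Hk : (lam (Wk k) <= e%:E)%E.
  by rewrite -(fineK Wkfin) lee_fin (le_trans _ H)// ler_norm.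
near=> z.
have zk i : `|z 0 i| <= k.+1%:R^-1.
  have : `|z| <= k.+1%:R^-1.
    near: z; apply/nbhs_ballP; exists (k.+1%:R^-1) => //= y.
    by rewrite -ball_normE /= sub0r normrN => /ltW.
  apply: le_trans; rewrite [leRHS]mx_normrE.
  exact: (@le_bigmax _ _ _ 0 (fun ij : 'I_1 * 'I_n => `|z ij.1 ij.2|) (0, i)).
rewrite !PE.
have -> : (fun x => x + z) @^-1` A `&` W =
    (fun x => x + z) @^-1` (A `&` (fun x => x - z) @^-1` W).
  by rewrite preimage_setI; congr setI; apply/seteqP; split => x /=; rewrite addrK.
have mzW : measurable ((fun x => x - z) @^-1` W : set (borel V)).
  have := @measurable_shift R n (- z) measurableT _ mW.
  by rewrite setTI.
rewrite lam_shift//; last exact: measurableI.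
apply: (@le_trans _ _ (lam ((A `&` W) `|` Wk k))).
  apply: le_measure; rewrite ?inE; [exact: measurableI|by apply: measurableU => //; exact: measurableI|].
  move=> x [xA xW]; have [xW0|xW0] := pselect (W x); first by left.
  right; split => // i; have := xW i; rewrite !mxE -!ler_norml => h.
  have -> : x 0 i = (x 0 i - z 0 i) + z 0 i by ring.
  by apply: (le_trans (ler_normD _ _)); apply: lerD.
apply: (le_trans (measureU2 _ (measurableI _ _ mA mW) (mWk k))).
by apply: leeD.
Unshelve. all: by end_near. Qed.

Let P_translation (A : set (borel V)) : measurable A -> forall e : R, 0 < e ->
  \forall z \near nbhs (0 : V),
    (P ((A `\` (fun x => (x + z)%R) @^-1` A) `|` ((fun x => (x + z)%R) @^-1` A `\` A)) <= e%:E)%E.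
Proof.
have [a [b KB]] := rV_compact_base R n.
apply: (@translation_continuity R V _ V (nbhs (0 : V)) (fun z x => x + z) P _ KB
  (@rV_hausdorff R n)) => //.
- by move=> z; exact: measurable_shift.
move=> y O oO Oy.
have : (fun p : V * V => p.1 + p.2) @ nbhs (y, (0 : V)) --> y + 0 by apply: cvgD; [exact: cvg_fst|exact: cvg_snd].
by rewrite addr0 => /(_ O (open_nbhs_nbhs (conj oO Oy))).
Qed.

Variable phi : borel V -> R.
Hypothesis mphi : measurable_fun setT phi.
Variable al : R.
Let J t E := oscint P phi al t E.

Let Poo (A : set (borel V)) : measurable A -> (P A < +oo)%E.
Proof. by move=> mA; rewrite ltey_eq Pfin. Qed.

(* limsup |J t E| <= eta * P E for all Borel subsets E of S. *)
Let negl (eta : R) (S : set (borel V)) := forall E : set (borel V), measurable E -> E `<=` S ->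
  forall e : R, 0 < e -> \forall t \near +oo, `|J t E| <= eta * fP E + e.

(** Near [x0], translating by [dl t *: d] adds almost exactly [pi] to [t * phi], while [dl t] tends
    to 0, so that [E] is almost unchanged: [oscint_pair] applies. *)
Let negl_local (eta : R) x0 : 0 < eta -> strict_dir (phi : V -> R) x0 ->
  exists S : set V, [/\ open S, S x0 & negl eta S].
Proof.
move=> eta0 [d [c [c0 Hd]]].
(* Chosen so that [t * s * |dl t| = eta] for [dl t = pi / (t * c)] and [t > 0]. *)
pose s := eta / (pi : R) * `|c|.
have s0 : 0 < s by rewrite mulr_gt0 ?divr_gt0 ?pi_gt0 ?normr_gt0.
have [[A B] /= [Ax0 B0] AB] := Hd _ s0.
exists A°; split; [exact: open_interior|exact: Ax0|].
move=> E mE ES e e0.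
have c0n : `|c| != 0 by rewrite normr_eq0.
pose dl (t : R) := pi / (t * c).
have dl0 : dl t @[t --> +oo] --> (0 : R).
  have -> : dl = (fun t => (pi / c) * t^-1).
    by apply/funext => t; rewrite /dl invfM mulrA [pi / t]mulrC mulrC; ring.
  rewrite -[X in _ --> X](mulr0 (pi / c)); apply: cvgMr.
  by apply/gtr0_cvgV0 => //; near=> t; near: t; exact: nbhs_pinfty_gt.
have dle0 : dl t *: d @[t --> +oo] --> (0 : V).
  rewrite -[X in _ --> X](scale0r d); apply: cvgZr_tmp => //.
have e2 : 0 < e / 2 by rewrite divr_gt0.
pose E' : set (borel V) := E `&` W.
have mE' : measurable E' by exact: measurableI.
have mEW : measurable (E `\` W : set (borel V)) by exact: measurableD.
have PEW : P (E `\` W) = 0%E.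
  by rewrite PE (_ : _ `&` W = set0) ?measure0//; apply/seteqP; split => // x [[]].
have E'oo : (lam E' < +oo)%E by rewrite -PE; exact: Poo.
(* [oscint_pair] asks for an invariant measure, which [lam] is and [P] is not; inside the cube both
   give the same integral. *)
have JE t : J t E = oscint lam phi al t E'.
  have EE : E = E' `|` (E `\` W) by rewrite setUIDK.
  rewrite /J EE oscintU//; last 2 first.
  - by apply: Poo; exact: measurableU.
  - by apply/seteqP; split => // x [[_ xW] [_]].
  have -> : oscint P phi al t (E `\` W) = 0.
    apply/eqP; rewrite -normr_le0; apply: (le_trans (oscint_le _ _ _ _ _)) => //.
      exact: Poo.
    by rewrite [X in fine X]PEW.
  rewrite addr0 /oscint /Rintegral; congr fine.
  apply: eq_measure_integral => A0 mA0 AE'; suff : lam (A0 `&` W) = lam A0 by [].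
  by congr (lam _); apply/setIidPl => x /AE'[].
near=> t.
have t0 : 0 < t by near: t; exact: nbhs_pinfty_gt.
have Bt : B (dl t) by near: t; exact: dl0 B0.
have := @oscint_pair _ (borel V) R lam phi mphi al (fun x => x + dl t *: d) t E' eta mE'.
have ms : measurable_fun setT ((fun x => x + dl t *: d) : borel V -> borel V).
  exact: measurable_shift.
have ps (A0 : set (borel V)) : measurable A0 -> lam ((fun x => x + dl t *: d) @^-1` A0) = lam A0.
  by move=> mA0; exact: lam_shift.
have tc : t * dl t * c = pi.
  by rewrite /dl; field; rewrite ?c0 ?(gt_eqF t0).
have Hosc x : E' x -> E' (x + dl t *: d) ->
    `|osc phi al t x + osc phi al t (x + dl t *: d)| <= eta.
  move=> [xE _] _; rewrite /osc -[cos (t * phi x + al)]opprK -cosDpi addrC.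
  apply: (le_trans (cos_lip _ _)).
  have -> : t * phi (x + dl t *: d) + al - (t * phi x + al + pi) =
      t * (phi (x + dl t *: d) - phi x - dl t * c) by rewrite -tc; ring.
  rewrite normrM (gtr0_norm t0).
  have Ax : A x by apply: interior_subset; exact: ES.
  have := AB (x, dl t) (conj Ax Bt) => /= h.
  apply: (le_trans (ler_wpM2l (ltW t0) h)).
  rewrite /s /dl normrM normfV normrM (gtr0_norm (pi_gt0 R)) (gtr0_norm t0).
  rewrite [leLHS](_ : _ = eta)//.
  have := pi_gt0 R; generalize (pi : R) => p p0; field.
  by rewrite c0n (gt_eqF t0) (gt_eqF p0).
move=> /(_ E'oo ms ps (ltW eta0) Hosc) H.
have Ht : (P ((E' `\` (fun x => (x + dl t *: d)%R) @^-1` E') `|`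
    ((fun x => (x + dl t *: d)%R) @^-1` E' `\` E')) <= e%:E)%E.
  by near: t; exact: (dle0 _ (P_translation mE' e0)).
have mt : measurable ((fun x => x + dl t *: d) @^-1` E' : set (borel V)).
  by rewrite -[X in measurable X]setTI; exact: ms.
have h1 : fine (lam (E' `\` (fun x => x + dl t *: d) @^-1` E')) <= e.
  rewrite -lee_fin fineK.
    apply: le_trans Ht.
    rewrite [X in lam X](_ : _ = (E' `\` (fun x => x + dl t *: d) @^-1` E') `&` W).
      2: by apply/esym/setIidPl => x [[]].
    rewrite -PE; apply: le_measure; rewrite ?inE.
    - exact: measurableD.
    - exact: (measurableU _ _ (measurableD mE' mt) (measurableD mt mE')).
    - by move=> x; left.
  rewrite ge0_fin_numE ?measure_ge0//; apply: le_lt_trans E'oo.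
  by apply: le_measure; rewrite ?inE//; exact: measurableD.
have h2 : fine (lam E') = fP E by [].
rewrite JE -h2.
have h3 : 0 <= eta * fine (lam E') by apply: mulr_ge0; [exact: ltW|exact: fine_ge0].
lra.
Unshelve. all: by end_near. Qed.

(** Countably many basic open sets satisfying [negl] cover [E]. The estimate adds up over disjoint
    parts because its main term is proportional to [P]. *)
Lemma oscint_cube_cvg0 (E : set (borel V)) : measurable E ->
  (forall x, E x -> strict_dir (phi : V -> R) x) ->
  oscint P phi al t E @[t --> +oo] --> (0 : R).
Proof.
move=> mE Est.
apply/cvgrPdist_le => e e0.
(* Three quarters of [e] are spent: on [eta * fP (B m)], on the error term in [nB], and on the part
   of [E] outside [B m]. *)
pose eta := e / 4 / (fP W + 1).
have fW0 : 0 <= fP W by apply: fine_ge0; exact: measure_ge0.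
have eta0 : 0 < eta by rewrite !divr_gt0// ltr_wpDl.
have [a [b KB]] := rV_compact_base R n.
pose K i := (cbox (a i) (b i))°.
have mK i : measurable (K i : set (borel V)).
  by apply: sub_sigma_algebra; exact: open_interior.
pose C (i : nat) : set (borel V) := if pselect (negl eta (K i)) then E `&` K i else set0.
have mC i : measurable (C i).
  by rewrite /C; case: pselect => h //=; exact: measurableI.
have nC i : negl eta (C i).
  rewrite /C; case: pselect => h /= E0 mE0 E0C.
    by apply: h => // x /E0C[].
  move=> e' e'0; have -> : E0 = set0 by apply/seteqP; split.
  near=> t; rewrite /J /oscint Rintegral_set0 normr0; apply: addr_ge0; last exact: ltW.
    by apply: mulr_ge0; [exact: ltW|apply: fine_ge0; exact: measure_ge0].
have CU : \bigcup_i C i = E.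
  apply/seteqP; split => x.
    by move=> [i _]; rewrite /C; case: pselect => h //= -[].
  move=> xE; have [S [oS Sx nS]] := negl_local eta0 (Est _ xE).
  have [i [KS xK]] := KB.2 _ _ oS Sx; exists i => //; rewrite /C.
  case: pselect => [h|] //=; case=> E0 mE0 E0K.
  by apply: nS => // y /E0K/interior_subset/KS.
pose B m : set (borel V) := \bigcup_(i < m) C i.
have mB m : measurable (B m).
  by rewrite /B bigcup_mkord; apply: bigsetU_measurable.
have BE m : B m `<=` E by rewrite -CU => x [i _ xi]; exists i.
have BS m : B m.+1 = B m `|` (C m `\` B m).
  apply/seteqP; split => x.
    move=> [i /=]; rewrite ltnS leq_eqVlt => /predU1P[->|im] xi.
      by have [|xB] := pselect (B m x); [left|right].
    by left; exists i.
  by move=> [[i /= im xi]|[xi _]]; [exists i => //=; exact: ltnW|exists m => /=].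
have nB m : forall e' : R, 0 < e' -> \forall t \near +oo, `|J t (B m)| <= eta * fP (B m) + e'.
  elim: m => [|m IH] e' e'0.
    have -> : B 0%N = set0 by rewrite /B bigcup_mkord big_ord0.
    near=> t; rewrite /J /oscint Rintegral_set0 normr0; apply: addr_ge0; last exact: ltW.
    by apply: mulr_ge0; [exact: ltW|apply: fine_ge0; exact: measure_ge0].
  have e'2 : 0 < e' / 2 by rewrite divr_gt0.
  have mCB : measurable (C m `\` B m) by exact: measurableD.
  have dis : B m `&` (C m `\` B m) = set0.
    by apply/seteqP; split => // x [xB [_ /(_ xB)]].
  near=> t; rewrite BS /J oscintU//; last by apply: Poo; exact: measurableU.
  rewrite fPD//.
  apply: (le_trans (ler_normD _ _)).
  have h1 : `|oscint P phi al t (B m)| <= eta * fP (B m) + e' / 2 by near: t; exact: IH.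
  have h2 : `|oscint P phi al t (C m `\` B m)| <= eta * fP (C m `\` B m) + e' / 2.
    by near: t; apply: nC => // x [].
  by rewrite [e']splitr; lra.
have e4 : 0 < e / 4 by rewrite divr_gt0.
have [m Hm] : exists m, fP (E `\` B m) <= e / 4.
  pose D m := E `\` B m.
  have mD m : measurable (D m) by exact: measurableD.
  have D0 : \bigcap_m D m = set0.
    apply/seteqP; split => // x xD; have [xE _] := xD 0%N I.
    move: xE; rewrite -CU => -[i _ xi]; have [_] := xD i.+1 I; apply.
    by exists i => /=.
  have : P \o D @ \oo --> (0%:E : \bar R).
    have <- : P (\bigcap_m D m) = 0%:E by rewrite D0; exact: measure0.
    apply: nonincreasing_cvg_mu => //.
    - exact: Poo.
    - by rewrite D0.
    - move=> i j ij; apply/subsetPset => x [xE xN]; split => // -[l /= li xl]; apply: xN.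
      by exists l => //=; exact: leq_trans ij.
  move=> /fine_cvgP[_ /cvgrPdist_le/(_ _ e4)[m _ /(_ m (leqnn m))]].
  by rewrite /= sub0r normrN => H; exists m; apply: (le_trans _ H); exact: ler_norm.
have EB : E = B m `|` (E `\` B m).
  apply/seteqP; split => x; last by move=> [/BE|[]].
  by have [|h] := pselect (B m x); [left|right].
have mEB : measurable (E `\` B m) by exact: measurableD.
near=> t; rewrite sub0r normrN EB oscintU//; last 2 first.
- by apply: Poo; exact: measurableU.
- by apply/seteqP; split => // x [xB [_ /(_ xB)]].
have h1 : `|oscint P phi al t (B m)| <= eta * fP (B m) + e / 4 by near: t; exact: nB.
have h2 : `|oscint P phi al t (E `\` B m)| <= e / 4.
  by apply: (le_trans (oscint_le _ _ _ _ _)) => //; exact: Poo.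
have h3 : eta * fP (B m) <= e / 4.
  have : fP (B m) <= fP W.
    apply: fine_le; [exact: Pfin|exact: Pfin|].
    change (lam (B m `&` W) <= lam (W `&` W))%E; rewrite setIid.
    by apply: le_measure; rewrite ?inE; [exact: measurableI|exact: mW|exact: subIsetr].
  move=> h; rewrite /eta mulrAC ler_pdivrMr ?ltr_wpDl// ler_pM2l//; lra.
apply: (le_trans (ler_normD _ _)); apply: (le_trans (lerD h1 h2)).
exact: three_quarters_le.
Unshelve. all: by end_near. Qed.

End riemann_lebesgue.

(** * From a finite measure to the measures it dominates *)

Section density.
Import HBSimple.
Context d (T : measurableType d) (R : realType).
Variables (P nu : {finite_measure set T -> \bar R}) (phi : T -> R) (al : R).
Hypothesis mphi : measurable_fun setT phi.
Hypothesis nuP : forall A, measurable A -> P A = 0%E -> nu A = 0%E.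
Variable E : set T.
Hypothesis mE : measurable E.
Hypothesis PE0 : forall B, measurable B -> B `<=` E ->
  oscint P phi al t B @[t --> +oo] --> (0 : R).

Let Poo B : measurable B -> (P B < +oo)%E.
Proof. by move=> mB; rewrite ltey_eq fin_num_measure. Qed.

Let nuoo B : measurable B -> (nu B < +oo)%E.
Proof. by move=> mB; rewrite ltey_eq fin_num_measure. Qed.

Let u := osc phi al.
Let mu t : measurable_fun setT (u t) := measurable_osc mphi al t.

Let int_uM t (h : T -> R) : P.-integrable setT (EFin \o h) ->
  P.-integrable E (EFin \o (fun x => u t x * h x)).
Proof.
move=> ih; have mh := iffLR (measurable_EFinP _ _) (measurable_int _ ih).
apply: (integrableS measurableT mE (@subsetT _ _)).
apply: (le_integrable _ _ _ ih) => //.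
  by apply/measurable_EFinP; exact: measurable_funM.
move=> x _ /=; rewrite lee_fin normrM ler_piMl//; exact: osc_le1.
Qed.

Let int1 (A : set T) : measurable A -> P.-integrable setT (EFin \o (\1_A : T -> R)).
Proof.
move=> mA; apply: measurable_bounded_integrable => //; [exact: Poo|].
exists 1; split => // M M1 x _ /=; rewrite indicE.
by case: (_ \in _); rewrite ?normr1 ?normr0 ltW//; apply: lt_trans M1.
Qed.

Let step_int (g : T -> R) (mg : measurable_fun setT g) (s : seq R) :
  P.-integrable setT (EFin \o (fun x => \sum_(y <- s) y * \1_(g @^-1` [set y]) x)) /\
  (\int[P]_(x in E) (u t x * \sum_(y <- s) y * \1_(g @^-1` [set y]) x)) @[t --> +oo] --> (0 : R).
Proof.
elim: s => [|y s [IH1 IH2]].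
  have -> : (fun x => \sum_(y <- [::]) y * \1_(g @^-1` [set y]) x) = (fun x : T => 0 : R).
    by apply/funext => x; rewrite big_nil.
  split; first exact: integrable0.
  under eq_fun do under eq_Rintegral do rewrite big_nil mulr0.
  by apply: cvg_near_cst; near=> t; rewrite /Rintegral integral0.
have mA : measurable (g @^-1` [set y]) by rewrite -[X in measurable X]setTI; exact: mg.
have i1 : P.-integrable setT (EFin \o (fun x => y * \1_(g @^-1` [set y]) x)).
  have h : P.-integrable setT (EFin \o (\1_(g @^-1` [set y]) : T -> R)) by exact: int1.
  exact: (integrableZl measurableT y h).
have -> : (fun x => \sum_(z <- y :: s) z * \1_(g @^-1` [set z]) x) =
    (fun x => y * \1_(g @^-1` [set y]) x + \sum_(z <- s) z * \1_(g @^-1` [set z]) x).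
  by apply/funext => x; rewrite big_cons.
split; first exact: (integrableD measurableT i1 IH1).
have -> : (fun t => \int[P]_(x in E) (u t x * \sum_(z <- y :: s) z * \1_(g @^-1` [set z]) x)) =
   (fun t => y * oscint P phi al t (E `&` g @^-1` [set y]) +
     \int[P]_(x in E) (u t x * \sum_(z <- s) z * \1_(g @^-1` [set z]) x)).
  apply/funext => t.
  have -> : \int[P]_(x in E) (u t x * \sum_(z <- y :: s) z * \1_(g @^-1` [set z]) x) =
    \int[P]_(x in E) (u t x * (y * \1_(g @^-1` [set y]) x) +
      u t x * \sum_(z <- s) z * \1_(g @^-1` [set z]) x).
    by apply: eq_Rintegral => x _; rewrite big_cons mulrDr.
  rewrite RintegralD//; [|exact: int_uM|exact: int_uM].
  congr (_ + _).
  have -> : oscint P phi al t (E `&` g @^-1` [set y]) =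
      \int[P]_(x in E) (u t x * \1_(g @^-1` [set y]) x).
    rewrite /oscint Rintegral_mkcondr; apply: eq_Rintegral => x _.
    by rewrite patchE indicE; case: (_ \in _); rewrite ?mulr1 ?mulr0.
  rewrite -RintegralZl//; last exact/int_uM/int1.
  by apply: eq_Rintegral => x _; ring.
rewrite -[X in _ --> X](addr0 0); apply: cvgD => //.
rewrite -[X in _ --> X](mulr0 y); apply: cvgMr; apply: PE0.
  exact: measurableI.
by move=> x [].
Unshelve. all: by end_near. Qed.

(** The density of [nu] is approximated in [L^1] by simple functions, whose level sets cut [E] into
    subsets: this is why [PE0] speaks of every [B] inside [E]. Since [osc] is bounded by 1, the
    error is uniform in [t]. *)
Lemma oscint_dominated : oscint nu phi al t E @[t --> +oo] --> (0 : R).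
Proof.
have nuP' : nu `<< P by apply/null_content_dominatesP => A mA; exact: nuP.
pose f0 := Radon_Nikodym (charge_of_finite_measure nu) P.
pose F x := fine (f0 x).
have f0E : f0 = EFin \o F.
  by apply/funext => x /=; rewrite fineK//; exact: Radon_Nikodym_fin_num.
have F1 : P.-integrable setT (EFin \o F).
  by have := @Radon_Nikodym_integrable _ _ _ (charge_of_finite_measure nu) P nuP'; rewrite -/f0 f0E.
have oE t : oscint nu phi al t E = \int[P]_(x in E) (u t x * F x).
  rewrite /oscint /Rintegral; congr fine.
  have iu := osc_integrable (m:=nu) mphi al t mE (nuoo mE).
  have := Radon_Nikodym_change_of_variables nuP' mE iu.
  by move=> <-; apply: eq_integral => x _; rewrite -/f0 f0E.
apply/cvgrPdist_le => e e0.
have [g [ig _ Hg]] := approximation_sfun_integrable measurableT F1.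
have e2 : 0 < e / 2 by rewrite divr_gt0.
have /fine_cvgP[Hf /cvgrPdist_le/(_ _ e2) He] := Hg.
near \oo => N.
have fN : (\int[P]_z `|(F z)%:E - (g N z)%:E|)%E \is a fin_num by near: N.
have eN : `|0 - fine (\int[P]_z `|(F z)%:E - (g N z)%:E|)%E| <= e / 2 by near: N.
have mg : measurable_fun setT (g N) by [].
have [s sE] : exists s : seq R, forall x, g N x = \sum_(y <- s) y * \1_(g N @^-1` [set y]) x.
  by eexists => x; rewrite {1}fimfunE fsbig_finite.
have gE : (g N : T -> R) = (fun x => \sum_(y <- s) y * \1_(g N @^-1` [set y]) x).
  exact/funext.
have [i1 c1] := step_int mg s.
rewrite -gE in i1.
near=> t.
rewrite sub0r normrN oE.
have iF := int_uM t F1; have iG := int_uM t i1.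
have -> : \int[P]_(x in E) (u t x * F x) = \int[P]_(x in E) (u t x * F x - u t x * g N x) +
    \int[P]_(x in E) (u t x * g N x).
  by rewrite RintegralB// subrK.
rewrite [e]splitr; apply: (le_trans (ler_normD _ _)); apply: lerD; last first.
  have : `|0 - \int[P]_(x in E) (u t x * g N x)| <= e / 2.
    rewrite gE; near: t; move/cvgrPdist_le : c1; exact.
  by rewrite sub0r normrN.
have iFG := integrableB measurableT F1 i1.
apply: (le_trans (le_normr_Rintegral mE (integrableB mE iF iG))).
rewrite sub0r normrN in eN.
apply: le_trans (le_trans (ler_norm _) eN).
apply: (@le_trans _ _ (\int[P]_(x in E) `|F x - g N x|)).
  apply: le_Rintegral => //.
  - by apply: integrable_norm => //; exact: (integrableB mE iF iG).
  - apply: integrable_norm => //.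
    exact: (integrableS measurableT mE (@subsetT _ _) iFG).
  move=> x _; rewrite -mulrBr normrM ler_piMl//; exact: osc_le1.
rewrite /Rintegral; apply: fine_le => //.
  apply: integrable_fin_num => //; apply: integrable_norm => //.
  exact: (integrableS measurableT mE (@subsetT _ _) iFG).
apply: ge0_subset_integral => //.
have iN : P.-integrable setT (EFin \o (fun x => `|F x - g N x|)).
  exact: (integrable_norm (f := fun x => F x - g N x)).
exact: measurable_int iN.
Unshelve. all: by end_near. Qed.

End density.

Section riemann_lebesgue_dominated.
Context (R : realType) (n : nat) (lam : {measure set (borel 'rV[R]_n) -> \bar R}).
Hypothesis hlam : is_lebesgue lam.
Local Notation V := 'rV[R]_n.
Variables (nu : {finite_measure set (borel V) -> \bar R}).
Hypothesis nulam : forall A : set (borel V), measurable A -> lam A = 0%E -> nu A = 0%E.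

Lemma riemann_lebesgue (phi : borel V -> R) (al : R) (E : set (borel V)) :
  measurable_fun setT phi -> measurable E ->
  (forall x, E x -> strict_dir (phi : V -> R) x) ->
  oscint nu phi al t E @[t --> +oo] --> (0 : R).
Proof.
move=> mphi mE Est.
have nuoo (B : set (borel V)) : measurable B -> (nu B < +oo)%E.
  by move=> mB; rewrite ltey_eq fin_num_measure.
apply/cvgrPdist_le => e e0; have e2 : 0 < e / 2 by rewrite divr_gt0.
have mc (k : nat) : measurable (ccube k%:R : set (borel V)) by exact: measurable_cbox.
(* [nu] is finite, so a large cube carries all but [e / 2] of the mass of [E]; inside it [nu] is
   dominated by the cut [lam]. *)
have [k Hk] : exists k : nat, fine (nu (E `\` ccube k%:R)) <= e / 2.
  pose D (k : nat) : set (borel V) := E `\` ccube k%:R.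
  have mD k : measurable (D k) by exact: measurableD.
  have D0 : \bigcap_k D k = set0.
    apply/seteqP; split => // x xD.
    have : setT x by []. rewrite -(@ccube_cover R n) => -[k _ xk].
    by have [_] := xD k I.
  have : nu \o D @ \oo --> (0%:E : \bar R).
    have <- : nu (\bigcap_k D k) = 0%:E by rewrite D0; exact: measure0.
    apply: nonincreasing_cvg_mu => //.
    - exact: nuoo.
    - by rewrite D0.
    - move=> i j ij; apply/subsetPset => x [xE xN]; split => // xc; apply: xN => l.
      have := xc l; rewrite !mxE -!ler_norml => h; apply: (le_trans h).
      by rewrite ler_nat.
  move=> /fine_cvgP[_ /cvgrPdist_le/(_ _ e2)[k _ /(_ k (leqnn k))]].
  by rewrite /= sub0r normrN => H; exists k; apply: (le_trans _ H); exact: ler_norm.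
pose W : set (borel V) := ccube k%:R.
have mW : measurable W := mc k.
pose nu' : {finite_measure set (borel V) -> \bar R} := mfrestr mW (nuoo W mW).
have k0 : (0 : R) <= k%:R by [].
pose P : {finite_measure set (borel V) -> \bar R} :=
  mfrestr (measurable_cbox (const_mx (- k%:R)) (const_mx k%:R)) (ccube_fin hlam k0).
have mEW : measurable (E `&` W) by exact: measurableI.
have mED : measurable (E `\` W) by exact: measurableD.
have H : oscint nu' phi al t (E `&` W) @[t --> +oo] --> (0 : R).
  apply: (@oscint_dominated _ _ _ P) => //.
  - by move=> A mA PA; apply: nulam; [exact: measurableI|exact: PA].
  - move=> B mB BE; apply: (@oscint_cube_cvg0 R n lam hlam k%:R k0) => //.
    by move=> x /BE[/Est].
have EE : E = (E `&` W) `|` (E `\` W) by rewrite setUIDK.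
near=> t.
rewrite sub0r normrN EE oscintU//; last 2 first.
- exact (nuoo _ (measurableU _ _ mEW mED)).
- by apply/seteqP; split => // x [[_ xW] [_]].
apply: (le_trans (ler_normD _ _)); rewrite [e]splitr; apply: lerD; last first.
  by apply: (le_trans (oscint_le _ _ _ _ _)) => //; exact (nuoo _ mED).
have -> : oscint nu phi al t (E `&` W) = oscint nu' phi al t (E `&` W).
  rewrite /oscint /Rintegral; congr fine.
  apply: eq_measure_integral => A mA AE; suff : nu A = nu (A `&` W) by [].
  by congr (nu _); apply/esym/setIidPl => x /AE[].
have : `|0 - oscint nu' phi al t (E `&` W)| <= e / 2.
  by near: t; move/cvgrPdist_le : H; exact.
by rewrite sub0r normrN.
Unshelve. all: by end_near. Qed.

End riemann_lebesgue_dominated.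

(** Mean value theorem on the segment from [x] to [x + dl *: y], the derivative along [y] being
    continuous at [x0]. The second function [psi] allows for a phase extended by zero outside
    [O]. *)
Lemma C1_strict_dir (R : realType) (V : normedModType R) (O : set V) (phi psi : V -> R) x0 y :
  open O -> O x0 -> Cdiff 1 O phi -> (forall x, O x -> psi x = phi x) ->
  'd phi x0 y != 0 -> strict_dir psi x0.
Proof.
move=> oO Ox0 [dphi cphi] psiphi dy; exists y, ('d phi x0 y); split => // eta eta0.
have := cphi y x0 Ox0 => /cvgrPdist_le/(_ _ eta0) H1.
have H2 : \forall x \near x0, O x by exact: open_nbhs_nbhs.
have [r /= r0 Hr] := iffLR (nbhs_ballP _ _) (filterI H1 H2).
have y1 : 0 < `|y| + 1 by rewrite ltr_wpDl.
have r2 : 0 < r / 2 by rewrite divr_gt0.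
(* With these radii the whole segment stays in the ball of radius [r] around [x0]. *)
exists (ball x0 (r / 2), ball (0 : R) (r / 2 / (`|y| + 1))).
  split => /=; first exact: nbhsx_ballx.
  by apply: nbhsx_ballx; rewrite divr_gt0.
move=> [x dl] /= [xB]; rewrite -ball_normE /= sub0r normrN => dlB.
have inB (s : R) : `|s| <= `|dl| -> ball x0 r (x + s *: y).
  move=> sdl; move: xB; rewrite -!ball_normE /= => xB.
  have -> : x0 - (x + s *: y) = (x0 - x) - s *: y by rewrite opprD addrA.
  apply: (le_lt_trans (ler_normB _ _)); rewrite [ltRHS]splitr.
  apply: ltr_leD => //; rewrite normrZ.
  have : `|s| * `|y| <= (r / 2 / (`|y| + 1)) * (`|y| + 1).
    by apply: ler_pM => //; [apply: (le_trans sdl); exact: ltW|rewrite lerDl].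
  by rewrite divfK// gt_eqF.
have OB (s : R) : `|s| <= `|dl| -> O (x + s *: y) by move=> /inB/Hr[].
have x_in : O x by have := OB 0; rewrite normr0 scale0r addr0; apply.
rewrite !psiphi//; last exact: OB.
pose f (s : R) := phi (x + s *: y).
have fd (s : R) : `|s| <= `|dl| -> is_derive s (1 : R) f ('d phi (x + s *: y) y).
  move=> hs.
  have dp : differentiable phi (x + s *: y) by exact/dphi/OB.
  have E : (fun h : R => h^-1 *: ((f \o shift s) (h *: (1 : R)) - f s)) =
      (fun h : R => h^-1 *: ((phi \o shift (x + s *: y)) (h *: y) - phi (x + s *: y))).
    apply/funext => h /=; congr (_ *: (phi _ - _)).
    by rewrite /shift /= [h *: 1]mulr1 scalerDl addrCA.
  split; first by rewrite /derivable E; exact: diff_derivable.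
  by rewrite /derive E -[LHS]/('D_y phi (x + s *: y)) deriveE.
have [c cdl fE] : exists2 c, `|c| <= `|dl| & f dl - f 0 = 'd phi (x + c *: y) y * dl.
  have [dl0|dl0] := leP 0 dl.
    have fd' (s : R) : s \in `[0, dl] -> is_derive s (1 : R) f ('d phi (x + s *: y) y).
      rewrite in_itv/= => /andP[s1 s2]; apply: fd.
      by rewrite !ger0_norm.
    have [|c] := MVT_segment dl0 (fun s hs => fd' s (subset_itv_oo_cc hs)).
      by apply: derivable_within_continuous => s /fd'[].
    rewrite in_itv/= subr0 => /andP[c1 c2] E; exists c => //.
    by rewrite !ger0_norm.
  have fd' (s : R) : s \in `[dl, 0] -> is_derive s (1 : R) f ('d phi (x + s *: y) y).
    rewrite in_itv/= => /andP[s1 s2]; apply: fd.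
    by rewrite !ler0_norm ?lerN2// ltW.
  have [|c] := MVT_segment (ltW dl0) (fun s hs => fd' s (subset_itv_oo_cc hs)).
    by apply: derivable_within_continuous => s /fd'[].
  rewrite in_itv/= => /andP[c1 c2] E; exists c.
    by rewrite !ler0_norm ?lerN2// ltW.
  by rewrite -opprB E sub0r mulrN opprK.
have -> : phi (x + dl *: y) - phi x = f dl - f 0 by rewrite /f scale0r addr0.
rewrite fE [dl * _]mulrC -mulrBl normrM ler_wpM2r//.
by have [h _] := Hr _ (inB _ cdl); rewrite distrC.
Qed.

(** * Trigonometric approximation *)

Section kernel.
Context (R : realType).
Local Notation tp := ((pi : R) *+ 2).

Lemma cosDtp (x : R) (j : nat) : cos (x + tp * j%:R) = cos x.
Proof. by rewrite mulr_natr; exact: (periodicn (@cosD2pi R)). Qed.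

Lemma sinDtp (x : R) (j : nat) : sin (x + tp * j%:R) = sin x.
Proof. by rewrite mulr_natr; exact: (periodicn (@sinD2pi R)). Qed.

Lemma cosDtpz (x : R) (k : int) : cos (x + tp * k%:~R) = cos x.
Proof.
case: k => j; first exact: cosDtp.
by rewrite -(cosDtp _ j.+1) NegzE mulrNz mulrN -pmulrn subrK.
Qed.

(** Multiplied by [2 * sin b], with [b] half the angular step, the sum telescopes, and over the
    whole grid the argument turns by [j] full periods. The bounds on [j] give [sin b > 0]. *)
Lemma sum_cos_grid (m j : nat) (x : R) : (0 < j)%N -> (j < m)%N ->
  \sum_(k < m) cos (tp * j%:R * (x - k%:R / m%:R)) = 0.
Proof.
move=> j0 jm; have m0 : (0 < m)%N by exact: leq_trans jm.
have mR : (0 : R) < m%:R by rewrite ltr0n.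
pose b : R := pi * j%:R / m%:R.
have b0 : 0 < b by rewrite divr_gt0// mulr_gt0 ?pi_gt0 ?ltr0n.
have bpi : b < pi.
  by rewrite /b ltr_pdivrMr// ltr_pM2l ?pi_gt0// ltr_nat.
have sb : 0 < sin b by apply: sin_gt0_pi; rewrite b0.
pose y : R := tp * j%:R * x.
have E (k : nat) : cos (tp * j%:R * (x - k%:R / m%:R)) = cos (y - b *+ 2 * k%:R).
  by congr cos; rewrite /y /b !mulr2n; ring.
under eq_bigr => k _ do rewrite E.
have tele (l : nat) : 2 * sin b * \sum_(k < l) cos (y - b *+ 2 * k%:R) =
    sin (y + b) - sin (y + b - b *+ 2 * l%:R).
  elim: l => [|l IH]; first by rewrite big_ord0 !mulr0 subr0 subrr.
  rewrite big_ord_recr /= mulrDr IH.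
  have -> : y + b - b *+ 2 * l%:R = (y - b *+ 2 * l%:R) + b by ring.
  have -> : y + b - b *+ 2 * l.+1%:R = (y - b *+ 2 * l%:R) - b.
    by rewrite -natr1 !mulr2n; ring.
  by set z := y - _; rewrite (sinD z) sinB; ring.
apply/eqP; rewrite -(mulrI_eq0 _ (mulfI (_ : 2 * sin b != 0))); last first.
  by rewrite gt_eqF// mulr_gt0.
rewrite tele -[sin (y + b - _)](sinDtp _ j).
have -> : y + b - b *+ 2 * m%:R + tp * j%:R = y + b.
  rewrite /b !mulr2n; field; exact: lt0r_neq0.
by rewrite subrr.
Qed.

Definition bump (x : R) := (1 + cos (tp * x)) / 2.

Lemma bump_ge0 x : 0 <= bump x.
Proof. by rewrite divr_ge0//; have := cos_geN1 (tp * x); lra. Qed.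

Lemma bump_int x (k : int) : bump (x + k%:~R) = bump x.
Proof. by rewrite /bump mulrDr cosDtpz. Qed.

(* The harmonic [j] is there for the induction on [N]. *)
Lemma sum_bump_const (m N j : nat) : (j + N < m)%N ->
  exists C : R, forall x, \sum_(k < m) bump (x - k%:R / m%:R) ^+ N *
    cos (tp * j%:R * (x - k%:R / m%:R)) = C.
Proof.
elim: N j => [|N IH] j jNm.
  case: j jNm => [_|j jm].
    by exists m%:R => x; under eq_bigr do rewrite expr0 mulr0 mul0r cos0 mulr1;
      rewrite sumr_const card_ord.
  exists 0 => x; under eq_bigr do rewrite expr0 mul1r.
  by apply: sum_cos_grid => //; rewrite addn0 in jm.
rewrite addnS in jNm.
have [C1 H1] := IH j (ltnW jNm).
have [C2 H2] : exists C2 : R, forall x, \sum_(k < m) bump (x - k%:R / m%:R) ^+ N *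
    cos (tp * j.+1%:R * (x - k%:R / m%:R)) = C2 by apply: IH; rewrite addSn.
(* For [j = 0] the harmonic [j - 1] is [-1], which is the harmonic 1 by evenness of [cos]; hence the
   real coefficient [j%:R - 1]. *)
have [C3 H3] : exists C3 : R, forall x, \sum_(k < m) bump (x - k%:R / m%:R) ^+ N *
    cos (tp * (j%:R - 1) * (x - k%:R / m%:R)) = C3.
  case: j {C1 H1 C2 H2} jNm => [|j] jNm.
    have [C H] : exists C : R, forall x, \sum_(k < m) bump (x - k%:R / m%:R) ^+ N *
      cos (tp * 1%:R * (x - k%:R / m%:R)) = C by apply: IH; rewrite add1n; rewrite add0n in jNm.
    exists C => x; rewrite -(H x); apply: eq_bigr => k _; congr (_ * _).
    by rewrite -cosN; congr cos; ring.
  have [C H] : exists C : R, forall x, \sum_(k < m) bump (x - k%:R / m%:R) ^+ N *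
      cos (tp * j%:R * (x - k%:R / m%:R)) = C.
    by apply: IH; rewrite addSn in jNm; exact: ltnW (ltnW _).
  exists C => x; rewrite -(H x); apply: eq_bigr => k _; congr (_ * _).
  by congr cos; rewrite -natr1 addrK.
(* [bump] times the harmonic [j] is half of that harmonic plus a quarter of each of its two
   neighbours. *)
exists (C1 / 2 + (C2 + C3) / 4) => x.
rewrite -(H1 x) -(H2 x) -(H3 x) -big_split /= !mulr_suml -big_split /=.
apply: eq_bigr => k _; set z := x - _.
have -> : tp * j.+1%:R * z = tp * j%:R * z + tp * z by rewrite -natr1; ring.
have -> : tp * (j%:R - 1) * z = tp * j%:R * z - tp * z by ring.
by rewrite cosD cosB exprS /bump; field.
Qed.

(** [bump] is even, has period 1 and decreases on [[0, 1/2]], so only the distance to the nearest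
    integer counts. *)
Lemma bump_far (dl x : R) : 0 < dl -> dl <= 1 / 2 ->
  (forall k : int, dl <= `|x - k%:~R|) -> bump x <= bump dl.
Proof.
move=> dl0 dl2 far.
pose k := Num.floor (x + 1 / 2); pose y := x - k%:~R.
have /andP[k1 k2] : k%:~R <= x + 1 / 2 < (k + 1)%:~R by exact: floor_itv.
rewrite intrD in k2.
have yd : dl <= `|y| by exact: far.
have y2 : `|y| <= 1 / 2 by rewrite ler_norml /y; apply/andP; split; lra.
have -> : bump x = bump `|y|.
  rewrite -[x](subrK k%:~R) bump_int -/y /bump.
  by have [_|_] := ger0P y; rewrite // mulrN cosN.
rewrite /bump ler_pM2r ?invr_gt0// lerD2l.
move: yd; rewrite le_eqVlt => /predU1P[->//|yd]; apply: ltW.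
have tp0 : 0 < tp by rewrite mulrn_wgt0// pi_gt0.
have h1 : tp * (1 / 2) = pi by rewrite mulr2n; field.
have h2 : tp * `|y| <= pi by rewrite -[leRHS]h1 ler_pM2l.
have h3 : tp * dl <= pi by rewrite -[leRHS]h1 ler_pM2l.
by rewrite ltr_cos ?in_itv/= ?h2 ?h3 ?andbT ?ltr_pM2l// mulr_ge0// ltW.
Qed.

Lemma bump_lt1 (dl : R) : 0 < dl -> dl <= 1 / 2 -> bump dl < 1.
Proof.
move=> dl0 dl2.
have tp0 : 0 < tp by rewrite mulrn_wgt0// pi_gt0.
have h1 : tp * (1 / 2) = pi by rewrite mulr2n; field.
have : cos (tp * dl) < cos 0.
  have h3 : tp * dl <= pi by rewrite -[leRHS]h1 ler_pM2l.
  by rewrite ltr_cos ?in_itv/= ?mulr_gt0// ?lexx ?pi_ge0// h3 andbT mulr_ge0// ltW.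
rewrite cos0 /bump ltr_pdivrMr// mul1r; lra.
Qed.

(** Bernoulli's inequality for [1 / sqrt rho] bounds [N * h * sqrt rho ^ N] by 1. The square of this
    bound beats the factor [N + 1], with one [N] to spare. *)
Lemma succ_mulrX_small (rho e : R) : 0 <= rho -> rho < 1 -> 0 < e ->
  exists N : nat, N.+1%:R * rho ^+ N <= e.
Proof.
move=> rho0 rho1 e0.
have [->|rhon0] := eqVneq rho 0; first by exists 1%N; rewrite expr1 mulr0 ltW.
have {}rho0 : 0 < rho by rewrite lt_neqAle eq_sym rhon0.
pose s := Num.sqrt rho; have s0 : 0 < s by rewrite sqrtr_gt0.
have ss : s ^+ 2 = rho by rewrite sqr_sqrtr// ltW.
have s1 : s < 1 by rewrite -(sqrtr1 R) ltr_sqrt.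
pose h := s^-1 - 1; have h0 : 0 < h by rewrite subr_gt0 invf_gt1.
have bern (N : nat) : 1 + N%:R * h <= s^-1 ^+ N.
  elim: N => [|N IH]; first by rewrite expr0 mul0r addr0.
  rewrite exprS; apply: le_trans (ler_wpM2l (ltW _) IH); last by rewrite invr_gt0.
  have -> : s^-1 = 1 + h by rewrite /h; ring.
  rewrite -natr1; have : (0 : R) <= N%:R by []. nra.
(* The first summand makes [N * (h ^+ 2 * e) >= 2], the second makes [N >= 1]. *)
have [N _ /(_ N (leqnn N))/= HN] := @nbhs_infty_ger R (2 / (h ^+ 2 * e) + 1).
have h2e : 0 < h ^+ 2 * e by rewrite mulr_gt0// exprn_gt0.
have N1 : 1 <= N%:R :> R by apply: le_trans HN; rewrite lerDr divr_ge0// ltW.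
have HN' : 2 <= N%:R * (h ^+ 2 * e).
  rewrite -ler_pdivrMr//; lra.
exists N; rewrite -ss -exprM mulnC exprM.
have sN : s ^+ N * (1 + N%:R * h) <= 1.
  have := bern N; rewrite exprVn -[X in _ -> _ <= X](divff (_ : s ^+ N != 0)).
    by move=> b; rewrite ler_pM2l// exprn_gt0.
  by rewrite gt_eqF// exprn_gt0.
have sN0 : 0 < s ^+ N by rewrite exprn_gt0.
set S := s ^+ N in sN sN0 *; rewrite -natr1.
have SNh : S * (N%:R * h) <= 1.
  by apply: le_trans sN; rewrite ler_pM2l// lerDr.
have SNh0 : 0 <= S * (N%:R * h) by rewrite !mulr_ge0// ltW.
have sq : (S * (N%:R * h)) ^+ 2 <= 1 by rewrite expr_le1.
have N2 : N%:R + 1 <= 2 * N%:R :> R by lra.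
apply: (@le_trans _ _ (2 * N%:R * S ^+ 2)).
  by rewrite ler_wpM2r// exprn_ge0// ltW.
apply: (@le_trans _ _ (N%:R * (h ^+ 2 * e) * N%:R * S ^+ 2)).
  by apply: ler_wpM2r; [rewrite exprn_ge0// ltW|exact: ler_wpM2r].
have -> : N%:R * (h ^+ 2 * e) * N%:R * S ^+ 2 = (S * (N%:R * h)) ^+ 2 * e by ring.
by rewrite ler_piMl// ltW.
Qed.

(** The phase [a] yields sines, and [xi = 0] yields constants. Only linear combinations are
    constructors, as these pass through integrals; products are recovered in [trigM]. *)
Inductive trig r : ('rV[R]_r -> R) -> Prop :=
| trig_cos (xi : 'rV[int]_r) (a : R) : trig (fun s => cos (tp * dotZ xi s + a))
| trig_lin (a : R) p q : trig p -> trig q -> trig (fun s => a * p s + q s).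

Lemma dotZD r (xi1 xi2 : 'rV[int]_r) (s : 'rV[R]_r) : dotZ (xi1 + xi2) s = dotZ xi1 s + dotZ xi2 s.
Proof.
by rewrite /dotZ -big_split; apply: eq_bigr => i _; rewrite mxE intrD mulrDl.
Qed.

Lemma dotZN r (xi : 'rV[int]_r) (s : 'rV[R]_r) : dotZ (- xi) s = - dotZ xi s.
Proof.
by rewrite /dotZ -sumrN; apply: eq_bigr => i _; rewrite mxE mulrNz mulNr.
Qed.

Lemma trig_ext r (p q : 'rV[R]_r -> R) : p =1 q -> trig p -> trig q.
Proof. by move=> /funext ->. Qed.

Lemma trig_cst r (c : R) : trig (fun _ : 'rV[R]_r => c).
Proof.
have h : trig (fun s : 'rV[R]_r => cos (tp * dotZ 0 s + 0)) by exact: trig_cos.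
have E (s : 'rV[R]_r) : cos (tp * dotZ 0 s + 0) = 1.
  by rewrite /dotZ big1 ?mulr0 ?addr0 ?cos0// => i _; rewrite mxE mul0r.
apply: (trig_ext _ (trig_lin (c - 1) h h)) => s /=; rewrite E; ring.
Qed.

Lemma trigD r (p q : 'rV[R]_r -> R) : trig p -> trig q -> trig (fun s => p s + q s).
Proof. by move=> hp hq; apply: (trig_ext _ (trig_lin 1 hp hq)) => s; rewrite mul1r. Qed.

Lemma trigZ r (a : R) (p : 'rV[R]_r -> R) : trig p -> trig (fun s => a * p s).
Proof.
by move=> hp; apply: (trig_ext _ (trig_lin a hp (trig_cst _ 0))) => s; rewrite addr0.
Qed.

Lemma trigM r (p q : 'rV[R]_r -> R) : trig p -> trig q -> trig (fun s => p s * q s).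
Proof.
move=> hp; elim: hp q => [xi a|a p1 p2 _ IH1 _ IH2] q hq.
  elim: hq => [xi' b|b q1 q2 _ IH1 _ IH2].
    have h1 := trigZ (1 / 2) (trig_cos (xi + xi') (a + b)).
    have h2 := trigZ (1 / 2) (trig_cos (xi - xi') (a - b)).
    apply: (trig_ext _ (trigD h1 h2)) => s /=.
    have -> : tp * dotZ (xi + xi') s + (a + b) = (tp * dotZ xi s + a) + (tp * dotZ xi' s + b).
      by rewrite dotZD; ring.
    have -> : tp * dotZ (xi - xi') s + (a - b) = (tp * dotZ xi s + a) - (tp * dotZ xi' s + b).
      by rewrite dotZD dotZN; ring.
    by rewrite cosD cosB; field.
  by apply: (trig_ext _ (trig_lin b IH1 IH2)) => s /=; ring.
by apply: (trig_ext _ (trig_lin a (IH1 _ hq) (IH2 _ hq))) => s /=; ring.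
Qed.

Lemma trig_sum r (I : Type) (l : seq I) (p : I -> 'rV[R]_r -> R) :
  (forall i, trig (p i)) -> trig (fun s => \sum_(i <- l) p i s).
Proof.
move=> hp; elim: l => [|i l IH].
  by apply: (trig_ext _ (trig_cst _ 0)) => s; rewrite big_nil.
by apply: (trig_ext _ (trigD (hp i) IH)) => s; rewrite big_cons.
Qed.

Lemma trig_prod r (I : Type) (l : seq I) (p : I -> 'rV[R]_r -> R) :
  (forall i, trig (p i)) -> trig (fun s => \prod_(i <- l) p i s).
Proof.
move=> hp; elim: l => [|i l IH].
  by apply: (trig_ext _ (trig_cst _ 1)) => s; rewrite big_nil.
by apply: (trig_ext _ (trigM (hp i) IH)) => s; rewrite big_cons.
Qed.

Lemma trigX r (p : 'rV[R]_r -> R) N : trig p -> trig (fun s => p s ^+ N).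
Proof.
move=> hp; elim: N => [|N IH].
  by apply: (trig_ext _ (trig_cst _ 1)) => s; rewrite expr0.
by apply: (trig_ext _ (trigM hp IH)) => s; rewrite exprS.
Qed.

Lemma trig_bump r (j : 'I_r) (b : R) : trig (fun s => bump (s 0 j - b)).
Proof.
have h := trig_lin (1 / 2) (trig_cos (delta_mx 0 j) (- (tp * b))) (trig_cst r (1 / 2)).
apply: (trig_ext _ h) => s /=; rewrite /bump mulrBr.
have -> : dotZ (delta_mx 0 j) s = s 0 j.
  rewrite /dotZ (bigD1 j)//= !mxE !eqxx mul1r big1 ?addr0// => i ij.
  by rewrite !mxE (negbTE ij) andbF mul0r.
by field.
Qed.

(* The kernel is a product of powers [bump ^+ N], i.e. of [cos(pi x)^(2N)], over a
   grid of mesh [1/(N+1)]: on such a grid the sum of the translates of [bump ^+ N]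
   is constant, so that finite sums replace the usual convolution. *)
Lemma trig_dense r (Q : 'rV[R]_r -> R) (C : R) : (forall s, `|Q s| <= C) ->
  (forall e, 0 < e -> exists2 dl : R, 0 < dl & forall s u : 'rV[R]_r,
     (forall j, exists k : int, `|s 0 j - u 0 j - k%:~R| < dl) -> `|Q s - Q u| <= e) ->
  forall e, 0 < e -> exists p, trig p /\ forall s, `|Q s - p s| <= e.
Proof.
move=> QC Qmod e e0; have e2 : 0 < e / 2 by rewrite divr_gt0.
have C0 : 0 <= C by apply: le_trans (QC 0).
have [dl' dl'0 Hdl'] := Qmod _ e2.
pose dl := Num.min dl' (1 / 2).
have dl0 : 0 < dl by rewrite lt_min dl'0 divr_gt0.
have dl2 : dl <= 1 / 2 by rewrite ge_min lexx orbT.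
have Hdl (s u : 'rV[R]_r) : (forall j, exists k : int, `|s 0 j - u 0 j - k%:~R| < dl) -> `|Q s - Q u| <= e / 2.
  by move=> H; apply: Hdl' => j; have [k hk] := H j; exists k; apply: (lt_le_trans hk); rewrite ge_min lexx.
(* Far grid points will cost [2 * C * r] times [m * bump dl ^+ N], which has to stay below
   [e / 2]. *)
have er0 : 0 < e / 2 / (2 * C * r%:R + 1).
  by rewrite divr_gt0// ltr_wpDl// !mulr_ge0.
have [N HN] := succ_mulrX_small (bump_ge0 dl) (bump_lt1 dl0 dl2) er0.
pose m := N.+1.
have mR : (0 : R) < m%:R by [].
pose g (x : R) (k : 'I_m) := bump (x - k%:R / m%:R) ^+ N.
have g0 x k : 0 <= g x k by rewrite exprn_ge0// bump_ge0.
have [D HD] : exists D : R, forall x, \sum_(k < m) g x k = D.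
  have [D HD] := @sum_bump_const m N 0 (leqnn _); exists D => x; rewrite -(HD x).
  by apply: eq_bigr => k _; rewrite mulr0 mul0r cos0 mulr1.
(* At [x = 0] the grid point 0 alone contributes [bump 0 = 1]. This later bounds a product of
   [r - 1] factors [D] by [D ^+ r]. *)
have D1 : 1 <= D.
  rewrite -(HD 0) (bigD1 ord0)//= /g mul0r subrr /bump mulr0 cos0 -[1 + 1]/(2 : R) divff ?expr1n//.
  by rewrite lerDl sumr_ge0// => i _; exact: g0.
have D0 : 0 < D by exact: lt_le_trans D1.
pose K (s : 'rV[R]_r) (f : {ffun 'I_r -> 'I_m}) := \prod_(j < r) g (s 0 j) (f j).
have K0 s f : 0 <= K s f by apply: prodr_ge0 => j _; exact: g0.
have KD s : \sum_f K s f = D ^+ r.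
  rewrite -(bigA_distr_bigA (fun j k => g (s 0 j) k)) /=.
  by under eq_bigr do rewrite HD; rewrite prodr_const card_ord.
pose u (f : {ffun 'I_r -> 'I_m}) : 'rV[R]_r := \row_j ((f j)%:R / m%:R).
exists (fun s => \sum_(f : {ffun 'I_r -> 'I_m}) Q (u f) / D ^+ r * K s f); split.
  apply: trig_sum => f; apply: trigZ; apply: trig_prod => j; apply: trigX.
  exact: trig_bump.
move=> s.
pose far (x : R) (k : 'I_m) := `[< forall l : int, dl <= `|x - k%:R / m%:R - l%:~R| >].
have gfar x k : far x k -> g x k <= bump dl ^+ N.
  move/asboolP => H; rewrite /g lerXn2r ?nnegrE ?bump_ge0//.
  exact: bump_far.
have Dr0 : 0 < D ^+ r by rewrite exprn_gt0.
have -> : Q s - \sum_f Q (u f) / D ^+ r * K s f = \sum_f (Q s - Q (u f)) / D ^+ r * K s f.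
  have {1}-> : Q s = \sum_f Q s / D ^+ r * K s f.
    by rewrite -mulr_sumr KD divfK// gt_eqF.
  by rewrite -sumrB; apply: eq_bigr => f _; ring.
apply: (le_trans (ler_norm_sum _ _ _)).
(* Either every coordinate of [s] is close to that of [u f] modulo 1, and [Q] varies by at most
   [e / 2], or some coordinate is far; the second case is charged to the sum over [j]. *)
apply: (@le_trans _ _ (\sum_f (e / 2 / D ^+ r * K s f +
   \sum_(j < r) 2 * C / D ^+ r * (K s f * (far (s 0 j) (f j))%:R)))).
  apply: ler_sum => f _.
  rewrite normrM (ger0_norm (K0 _ _)) normrM [X in _ * X * _]ger0_norm; last by rewrite invr_ge0 ltW.
  have [/existsP[j jfar]|] := boolP [exists j, far (s 0 j) (f j)].
    rewrite (bigD1 j)//= jfar mulr1.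
    have h1 : `|Q s - Q (u f)| <= 2 * C.
      by apply: (le_trans (ler_normB _ _)); have := QC s; have := QC (u f); lra.
    have h2 : `|Q s - Q (u f)| / D ^+ r * K s f <= 2 * C / D ^+ r * K s f.
      by rewrite ler_wpM2r// ler_wpM2r// invr_ge0 ltW.
    have h3 : 0 <= e / 2 / D ^+ r * K s f by rewrite !mulr_ge0// ?invr_ge0 ltW.
    have h4 : 0 <= \sum_(i < r | i != j) 2 * C / D ^+ r * (K s f * (far (s 0 i) (f i))%:R).
      by apply: sumr_ge0 => i _; rewrite !mulr_ge0// invr_ge0 ltW.
    lra.
  rewrite negb_exists => /forallP H.
  have h1 : `|Q s - Q (u f)| <= e / 2.
    apply: Hdl => j; have := H j => /asboolPn/existsNP[k /negP]; rewrite -ltNge => hk.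
    by exists k; rewrite mxE.
  rewrite -[leLHS]addr0; apply: lerD.
    by rewrite ler_wpM2r// ler_wpM2r// invr_ge0 ltW.
  by apply: sumr_ge0 => i _; rewrite !mulr_ge0// invr_ge0 ltW.
rewrite big_split /= -mulr_sumr KD divfK ?gt_eqF// exchange_big /=.
(* The sum over [f] factorizes: coordinate [j] has at most [m] far points, each of weight at most
   [bump dl ^+ N], and every other coordinate contributes [D]. *)
have Kfar (j : 'I_r) : \sum_f K s f * (far (s 0 j) (f j))%:R <= D ^+ r * (m%:R * bump dl ^+ N).
  have E f : K s f * (far (s 0 j) (f j))%:R =
      \prod_(i < r) (g (s 0 i) (f i) * (if i == j then (far (s 0 i) (f i))%:R else 1)).
    rewrite big_split /= -/(K s f); congr (_ * _).
    by rewrite (bigD1 j)//= eqxx big1 ?mulr1// => i /negbTE ->.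
  under eq_bigr do rewrite E.
  rewrite -(bigA_distr_bigA (fun i k => g (s 0 i) k * (if i == j then (far (s 0 i) k)%:R else 1))) /=.
  rewrite (bigD1 j)//= eqxx.
  have h1 : \sum_(k < m) g (s 0 j) k * (far (s 0 j) k)%:R <= m%:R * bump dl ^+ N.
    apply: (@le_trans _ _ (\sum_(k < m) bump dl ^+ N)).
      apply: ler_sum => k _; case: (boolP (far (s 0 j) k)) => hk.
        by rewrite mulr1; exact: gfar.
      by rewrite mulr0 exprn_ge0// bump_ge0.
    by rewrite sumr_const card_ord mulr_natl.
  have h2 : \prod_(i < r | i != j) \sum_(k < m) g (s 0 i) k * (if i == j then (far (s 0 i) k)%:R else 1) <= D ^+ r.
    have -> : \prod_(i < r | i != j) \sum_(k < m) g (s 0 i) k * (if i == j then (far (s 0 i) k)%:R else 1) =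
        \prod_(i < r | i != j) D.
      apply: eq_bigr => i /negbTE ->; rewrite -(HD (s 0 i)).
      by apply: eq_bigr => k _; rewrite mulr1.
    rewrite -[X in _ <= _ ^+ X]card_ord -prodr_const [leRHS](bigD1 j)//=.
    by rewrite ler_peMl// prodr_ge0// => i _; exact: ltW.
  rewrite mulrC; apply: ler_pM => //.
    by apply: prodr_ge0 => i _; apply: sumr_ge0 => k _; rewrite mulr_ge0//; case: ifP.
  by apply: sumr_ge0 => k _; rewrite mulr_ge0.
have hj (j : 'I_r) : \sum_f 2 * C / D ^+ r * (K s f * (far (s 0 j) (f j))%:R) <= 2 * C * (m%:R * bump dl ^+ N).
  rewrite -mulr_sumr.
  have -> : 2 * C * (m%:R * bump dl ^+ N) = 2 * C / D ^+ r * (D ^+ r * (m%:R * bump dl ^+ N)).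
    by rewrite [RHS]mulrA divfK// gt_eqF.
  by apply: ler_wpM2l => //; rewrite !mulr_ge0// invr_ge0 ltW.
rewrite [leRHS]splitr lerD2l.
apply: (@le_trans _ _ (\sum_(j < r) 2 * C * (m%:R * bump dl ^+ N))).
  by apply: ler_sum => j _; exact: hj.
rewrite sumr_const card_ord -[leLHS]mulr_natr.
have h5 : 0 <= 2 * C * r%:R by rewrite !mulr_ge0.
apply: (@le_trans _ _ (2 * C * r%:R * (e / 2 / (2 * C * r%:R + 1)))).
  have -> : 2 * C * (m%:R * bump dl ^+ N) * r%:R = 2 * C * r%:R * (m%:R * bump dl ^+ N) by ring.
  exact: ler_wpM2l.
by rewrite mulrCA ler_piMr ?(ltW e2)// ler_pdivrMr ?mul1r ?lerDl// ltr_wpDl.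
Qed.

End kernel.

(** * The flow on the product *)

Lemma borel_measurable (X Y : ptopologicalType) (f : X -> Y) : continuous f ->
  measurable_fun setT (f : borel X -> borel Y).
Proof.
move=> cf _ B mB; rewrite setTI; move: B mB; apply: smallest_sub.
  split => //.
  - by rewrite preimage_set0.
  - by move=> A mA; rewrite setTD preimage_setC; exact: measurableC.
  - by move=> A mA; rewrite preimage_bigcup; exact: bigcupT_measurable.
by move=> O oO; apply: sub_sigma_algebra; apply: open_comp => // x _; exact: cf.
Qed.

(** * Convergence extended from a pi-system to all measurable sets *)

Section dynkin_cvg.
Context d (T : measurableType d) (R : realType) (P : {measure set T -> \bar R}).
Hypothesis PT : (P setT < +oo)%E.
Variables (G : set (set T)) (q : R -> set T -> R).
Hypotheses (mG : measurable = <<s G >>) (GI : setI_closed G).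
Hypothesis qD : forall t A B, measurable A -> measurable B -> A `&` B = set0 ->
  q t (A `|` B) = q t A + q t B.
Hypothesis q_ge0 : forall t A, measurable A -> 0 <= q t A.
Hypothesis q_le : forall t A, measurable A -> q t A <= fine (P A).
Hypothesis qT : cvg (q t setT @[t --> +oo]).
Hypothesis qG : forall A, G A -> cvg (q t A @[t --> +oo]).

(** Convergence passes to countable disjoint unions because [q t] of a tail is at most its
    [P]-measure, uniformly in [t]. *)
Lemma dynkin_cvg A : measurable A -> cvg (q t A @[t --> +oo]).
Proof.
rewrite [X in X A -> _]mG; move: A.
apply: dynkin_induction => //.
- move=> A mA cA.
  have -> : (fun t => q t (~` A)) = (fun t => q t setT - q t A).
    apply/funext => t; rewrite -(setUv A) qD ?setICr//; last exact: measurableC.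
    by rewrite addrAC subrr add0r.
  exact: is_cvgB.
- move=> F mF tF cF; apply: cvg_approx => e e0.
  have mU : measurable (\bigcup_k F k) by exact: bigcupT_measurable.
  pose B n := \bigcup_(i < n) F i.
  have mB n : measurable (B n) by rewrite /B bigcup_mkord; apply: bigsetU_measurable.
  pose D n := (\bigcup_k F k) `\` B n.
  have mD n : measurable (D n) by exact: measurableD.
  have D0 : \bigcap_n D n = set0.
    apply/seteqP; split => // x xD.
    have [[n _ xn] _] := xD 0%N I.
    by have [_] := xD n.+1 I; apply; exists n => /=.
  have Pfin A : measurable A -> (P A < +oo)%E.
    by move=> mA; apply: le_lt_trans PT; apply: le_measure; rewrite ?inE.
  have : P \o D @ \oo --> (0%:E : \bar R).
    have <- : P (\bigcap_n D n) = 0%:E by rewrite D0 measure0.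
    apply: nonincreasing_cvg_mu => //.
    - exact: Pfin.
    - by rewrite D0.
    - move=> m n mn; apply/subsetPset => x [xU xn]; split => //.
      by move=> [i /= im xi]; apply: xn; exists i => //=; exact: leq_trans im mn.
  move=> /fine_cvgP[_ /cvgrPdist_le/(_ _ e0)[n _ /(_ n (leqnn n))]].
  rewrite /= sub0r normrN => Hn.
  have BS m : B m.+1 = B m `|` F m.
    apply/seteqP; split => x.
      move=> [i /=]; rewrite ltnS leq_eqVlt => /predU1P[->|im] xi; first by right.
      by left; exists i.
    by move=> [[i /= im xi]|xi]; [exists i => //=; exact: ltnW|exists m => /=].
  have Bdis m : B m `&` F m = set0.
    apply/seteqP; split => // x [[i /= im xi] xm].
    move/trivIsetP : tF => /(_ i m I I); rewrite ltn_eqF// => /(_ isT) => E0.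
    by have : (F i `&` F m) x by []; rewrite E0.
  exists (fun t => q t (B n)); split.
    elim: (n) => [|m IH].
      have -> : B 0%N = set0 by rewrite /B bigcup_mkord big_ord0.
      have -> : (fun t => q t set0) = (fun=> 0).
        apply/funext => t; apply: le_anti.
        by rewrite q_ge0// andbT (le_trans (q_le t _))// measure0.
      exact: is_cvg_cst.
    have -> : (fun t => q t (B m.+1)) = (fun t => q t (B m) + q t (F m)).
      by apply/funext => t; rewrite BS qD.
    exact: is_cvgD.
  apply: nearW => t.
  have -> : \bigcup_k F k = B n `|` D n.
    apply/seteqP; split => x.
      by move=> xU; have [|xB] := pselect (B n x); [left|right].
    by move=> [[i _ xi]|[]//]; exists i.
  rewrite qD//; last by apply/seteqP; split => // x [xB [_ /(_ xB)]].
  rewrite addrAC subrr add0r ger0_norm ?q_ge0//.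
  by apply: (le_trans (q_le t (mD n))); apply: le_trans Hn; exact: ler_norm.
Qed.

End dynkin_cvg.

Section mixing_dynkin.
Context d (T : measurableType d) (R : realType) (P : {measure set T -> \bar R}).
Hypothesis PT : (P setT < +oo)%E.
Variables (G : set (set T)) (Phi : R -> T -> T).
Hypotheses (mG : measurable = <<s G >>) (GI : setI_closed G).
Hypothesis mPhi : forall t, measurable_fun setT (Phi t).
Hypothesis pPhi : forall t A, measurable A -> P (Phi t @^-1` A) = P A.
Hypothesis corrG : forall A B, G A -> G B ->
  cvg (fine (P (Phi t @^-1` A `&` B)) @[t --> +oo]).

Let mP t A : measurable A -> measurable (Phi t @^-1` A).
Proof. by move=> mA; rewrite -[X in measurable X]setTI; exact: mPhi. Qed.

Let Pfin A : measurable A -> P A \is a fin_num.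
Proof.
move=> mA; rewrite ge0_fin_numE//; apply: le_lt_trans PT.
by apply: le_measure; rewrite ?inE.
Qed.

Let fPU A B : measurable A -> measurable B -> A `&` B = set0 ->
  fine (P (A `|` B)) = fine (P A) + fine (P B).
Proof. by move=> mA mB AB; rewrite measureU// fineD// Pfin. Qed.

Let fPle A B : measurable A -> measurable B -> A `<=` B -> fine (P A) <= fine (P B).
Proof. by move=> mA mB AB; rewrite fine_le ?Pfin// le_measure// ?inE. Qed.

(** [dynkin_cvg] is used twice: in [A] against a generator, where invariance of [P] provides the
    bound by [P A], then in [B]. *)
Lemma mixing_dynkin A B : measurable A -> measurable B ->
  cvg (fine (P (Phi t @^-1` A `&` B)) @[t --> +oo]).
Proof.
have Gm C : G C -> measurable C by move=> GC; rewrite mG; exact: sub_sigma_algebra.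
have H1 C : G C -> forall A, measurable A -> cvg (fine (P (Phi t @^-1` A `&` C)) @[t --> +oo]).
  move=> GC; have mC := Gm _ GC.
  apply: (@dynkin_cvg _ _ _ P PT G (fun t A => fine (P (Phi t @^-1` A `&` C)))) => //.
  - move=> t A1 A2 mA1 mA2 A12; rewrite preimage_setU setIUl fPU//.
    + by apply: measurableI => //; exact: mP.
    + by apply: measurableI => //; exact: mP.
    + by rewrite setIACA -preimage_setI A12 preimage_set0 set0I.
  - move=> t A1 mA1; rewrite -[X in _ <= fine X](pPhi t mA1).
    by apply: fPle; [apply: measurableI => //|..]; [exact: mP|exact: mP|exact: subIsetl].
  - by under eq_fun do rewrite preimage_setT setTI; exact: is_cvg_cst.
  - by move=> A1 GA1; exact: corrG.
move=> mA; move: B.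
apply: (@dynkin_cvg _ _ _ P PT G (fun t B => fine (P (Phi t @^-1` A `&` B)))) => //.
- move=> t A1 A2 mA1 mA2 A12; rewrite setIUr fPU//.
  + by apply: measurableI => //; exact: mP.
  + by apply: measurableI => //; exact: mP.
  + by rewrite setIACA A12 setI0.
- by move=> t A1 mA1; apply: fPle; [apply: measurableI => //; exact: mP|by []|exact: subIsetr].
- by under eq_fun do rewrite setIT pPhi//; exact: is_cvg_cst.
- by move=> A1 GA1; exact: H1.
Qed.

End mixing_dynkin.

(** * Correlations of Borel subsets of [G] under torus translations *)

Section torus_translation.
Context (R : realType) (r : nat) (G : pTopGroupType) (H : probability (borel G) R).
Hypothesis hH : normalized_haar H.
Variable K : nat -> set G.
Hypotheses (KB : compact_base K) (GT2 : hausdorff_space G).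
Hypothesis mulc : continuous (fun p : G * G => (p.1 * p.2)%g).
Variable th : 'rV[R]_r -> G.
Hypothesis thD : forall s u, th (s + u) = (th s * th u)%g.
Hypothesis thc : continuous th.
Hypothesis thZ : forall s : 'rV[R]_r, (forall j, exists k : int, s 0 j = k%:~R) -> th s = 1%g.

Lemma mulg_continuous (g : G) : continuous (fun y : G => (g * y)%g).
Proof.
move=> y; apply: (@continuous_comp _ _ _ (fun y => (g, y)) (fun p : G * G => (p.1 * p.2)%g)).
  by apply: cvg_pair => //=; exact: cvg_cst.
exact: mulc.
Qed.

Lemma haar_preimage (g : G) (A : set (borel G)) : measurable A ->
  H ((fun y => (g * y)%g) @^-1` A) = H A.
Proof.
move=> mA; rewrite -(hH g^-1%g mA); congr (H _); apply/seteqP; split => y /=.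
  by move=> gy; exists (g * y)%g => //; rewrite mulKg.
by move=> [x Ax <-]; rewrite mulgA mulgV mul1g.
Qed.

Let mtr (g : G) (A : set (borel G)) : measurable A ->
  measurable ((fun y => (g * y)%g) @^-1` A : set (borel G)).
Proof.
by move=> mA; rewrite -[X in measurable X]setTI; exact: (borel_measurable (@mulg_continuous g)).
Qed.

Definition haar_corr (D D' : set (borel G)) (s : 'rV[R]_r) : R :=
  fine (H (D' `&` (fun y => (th s * y)%g) @^-1` D)).

Lemma haar_corr_le1 D D' s : measurable D -> measurable D' -> `|haar_corr D D' s| <= 1.
Proof.
move=> mD mD'; have mI : measurable (D' `&` (fun y => (th s * y)%g) @^-1` D : set (borel G)).
  by apply: measurableI => //; exact: mtr.
rewrite ger0_norm; last exact: fine_ge0.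
by rewrite -lee_fin fineK ?fin_num_measure// probability_le1.
Qed.

Let dist_le (A B D' : set (borel G)) (e : R) : measurable A -> measurable B -> measurable D' ->
  (H ((A `\` B) `|` (B `\` A)) <= e%:E)%E ->
  `|fine (H (D' `&` A)) - fine (H (D' `&` B))| <= e.
Proof.
move=> mA mB mD' He.
have half (A1 A2 : set (borel G)) : measurable A1 -> measurable A2 ->
   (H ((A1 `\` A2) `|` (A2 `\` A1)) <= e%:E)%E ->
   fine (H (D' `&` A1)) <= fine (H (D' `&` A2)) + e.
  move=> m1 m2 h; rewrite -lee_fin EFinD !fineK; [|exact/fin_num_measure/measurableI..].
  apply: (@le_trans _ _ (H ((D' `&` A2) `|` ((A1 `\` A2) `|` (A2 `\` A1))))).
    apply: le_measure; rewrite ?inE.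
    - exact: measurableI.
    - by apply: measurableU; [exact: measurableI|apply: measurableU; exact: measurableD].
    - by move=> x [xD xA]; have [xB|xB] := pselect (A2 x); [left|right; left].
  apply: le_trans (measureU2 _ _ _) _; first exact: measurableI.
    by apply: measurableU; exact: measurableD.
  exact: leeD.
have h1 := half _ _ mA mB He.
have h2 := half _ _ mB mA ltac:(by rewrite setUC).
by rewrite ler_norml; apply/andP; split; lra.
Qed.

(** By invariance of [H] the variation is at most the measure of the symmetric difference of [D] and
    its preimage under [th (s - u - k)], where [k] is an integer vector, hence killed by [th].
    Closeness modulo integers is thus closeness on the torus. *)
Lemma haar_corr_mod (D D' : set (borel G)) : measurable D -> measurable D' ->
  forall e, 0 < e -> exists2 dl : R, 0 < dl & forall s u : 'rV[R]_r,
     (forall j, exists k : int, `|s 0 j - u 0 j - k%:~R| < dl) ->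
     `|haar_corr D D' s - haar_corr D D' u| <= e.
Proof.
move=> mD mD' e e0.
have th0 : th 0 = 1%g by apply: thZ => j; exists 0; rewrite mxE.
have Fth : Filter (nbhs (0 : 'rV[R]_r)) by exact: nbhs_filter.
have a_meas z : measurable_fun setT ((fun y => (th z * y)%g) : borel G -> borel G).
  exact: borel_measurable (@mulg_continuous _).
have a_near (y : G) O : open O -> O y ->
    \forall y' \near y & z \near nbhs (0 : 'rV[R]_r), O (th z * y')%g.
  move=> oO Oy.
  have cz : (fun p : G * 'rV[R]_r => (th p.2, p.1)) @ (nbhs y, nbhs (0 : 'rV[R]_r)) --> (1%g, y).
    apply: cvg_pair => /=; last exact: cvg_fst.
    by rewrite -th0; apply: (cvg_comp _ _ cvg_snd); exact: thc.
  have := cvg_comp _ _ cz (@mulc (1%g, y)) => /= /(_ O); rewrite mul1g => /(_ _).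
  by apply; exact: open_nbhs_nbhs.
have a_bnd (A : set (borel G)) : measurable A -> forall e : R, 0 < e ->
    \forall z \near nbhs (0 : 'rV[R]_r), (H ((fun y => (th z * y)%g) @^-1` A) <= H A + e%:E)%E.
  move=> mA e' e'0; near=> z; rewrite haar_preimage//.
  by rewrite leeDl// lee_fin ltW.
have := @translation_continuity R G K _ _ (fun z y => (th z * y)%g) H Fth KB GT2 a_meas
  a_near a_bnd D mD e e0.
move=> /nbhs_ballP[dl /= dl0 Hdl]; exists dl => // s u /choice[k Hk].
pose kap : 'rV[R]_r := \row_j (k j)%:~R.
pose z := s - u - kap.
have zB : ball 0 dl z.
  by split => // i j; rewrite ord1 /ball /= !mxE sub0r normrN; exact: Hk.
have thk : th kap = 1%g by apply: thZ => j; exists (k j); rewrite mxE.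
have thE : th s = (th z * th u)%g.
  have -> : s = z + u + kap by rewrite /z; apply/rowP => j; rewrite !mxE; ring.
  by rewrite !thD thk mulg1.
pose A : set (borel G) := (fun y => (th z * y)%g) @^-1` D.
have mA : measurable A by exact: mtr.
rewrite /haar_corr.
have -> : (fun y => (th s * y)%g) @^-1` D = (fun y => (th u * y)%g) @^-1` A.
  by apply/seteqP; split => y; rewrite /A /preimage /= thE mulgA.
apply: dist_le => //; [exact: mtr|exact: mtr|].
have -> : ((fun y => (th u * y)%g) @^-1` A `\` (fun y => (th u * y)%g) @^-1` D `|`
   ((fun y => (th u * y)%g) @^-1` D `\` (fun y => (th u * y)%g) @^-1` A)) =
   (fun y => (th u * y)%g) @^-1` ((A `\` D) `|` (D `\` A)) by [].
rewrite haar_preimage; last by apply: measurableU; exact: measurableD.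
by rewrite setUC; exact: Hdl.
Unshelve. all: by end_near. Qed.

End torus_translation.

Lemma borel_measurable_real (R : realType) (X : ptopologicalType) (f : X -> R) :
  continuous f -> measurable_fun setT (f : borel X -> R).
Proof.
move=> cf; apply: (measurability _ (RGenOInfty.measurableE R)).
move=> _ [_ [x ->] <-]; rewrite setTI; apply: sub_sigma_algebra.
by apply: open_comp => [y _|]; [exact: cf|exact: interval_open].
Qed.

Section measurable_mul.
Context (G : pTopGroupType) (K : nat -> set G).
Hypotheses (KB : compact_base K) (mulc : continuous (fun p : G * G => (p.1 * p.2)%g)).

Lemma measurable_mulg :
  measurable_fun setT ((fun p => (p.1 * p.2)%g) : borel G * borel G -> borel G).
Proof.
move=> _ B mB; rewrite setTI; move: B mB; apply: smallest_sub.
  split => //.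
  - by rewrite preimage_set0.
  - by move=> A mA; rewrite setTD preimage_setC; exact: measurableC.
  - by move=> A mA; rewrite preimage_bigcup; exact: bigcupT_measurable.
move=> O oO; apply: (open_measurable_prod KB KB).
by apply: open_comp => // x _; exact: mulc.
Qed.

Lemma measurable_funMg d (T : measurableType d) (f g : T -> G) :
  measurable_fun setT (f : T -> borel G) -> measurable_fun setT (g : T -> borel G) ->
  measurable_fun setT ((fun x => (f x * g x)%g) : T -> borel G).
Proof.
move=> mf mg; have mfg : measurable_fun setT ((fun x => (f x, g x)) : T -> borel G * borel G).
  exact/measurable_fun_pairP.
exact: (measurableT_comp measurable_mulg mfg).
Qed.

End measurable_mul.

(** * The fibrewise translation flow on [X * G] *)

Section torus_system.
Context (R : realType) (r : nat) (G : pTopGroupType) (H : probability (borel G) R).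
Hypothesis hH : normalized_haar H.
Variable K : nat -> set G.
Hypotheses (KB : compact_base K) (GT2 : hausdorff_space G).
Hypothesis mulc : continuous (fun p : G * G => (p.1 * p.2)%g).
Variable th : 'rV[R]_r -> G.
Hypothesis thD : forall s u, th (s + u) = (th s * th u)%g.
Hypothesis thc : continuous th.
Hypothesis thZ : forall s : 'rV[R]_r, (forall j, exists k : int, s 0 j = k%:~R) -> th s = 1%g.
Context d (X : measurableType d) (m : probability X R) (w : X -> 'rV[R]_r).
Hypothesis mw : measurable_fun setT (w : X -> borel 'rV[R]_r).
Hypothesis mix : forall (xi : 'rV[int]_r) (al : R) (B : set X), measurable B ->
  cvg (oscint m (fun x => dotZ xi (w x)) al t B @[t --> +oo]).
Local Notation tp := ((pi : R) *+ 2).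

Definition torus_flow (t : R) (p : X * borel G) : X * borel G :=
  (p.1, (th (t *: w p.1) * p.2)%g).

Lemma measurable_torus_flow t : measurable_fun setT (torus_flow t).
Proof.
apply/measurable_fun_pairP; split; first exact: measurable_fst.
have m1 : measurable_fun setT ((fun p => w p.1) : X * borel G -> borel 'rV[R]_r).
  exact: (measurableT_comp mw).
have m2 : measurable_fun setT ((fun p => th (t *: w p.1)) : X * borel G -> borel G).
  have c : continuous (fun s : 'rV[R]_r => th (t *: s)).
    move=> s; exact: (cvg_comp _ _ (@scaler_continuous R _ t s) (@thc _)).
  exact: (measurableT_comp (borel_measurable c) m1).
exact: (measurable_funMg KB mulc m2).
Qed.

Lemma torus_flow_pres t (A : set (X * borel G)) : measurable A ->
  (m \x H)%E (torus_flow t @^-1` A) = (m \x H)%E A.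
Proof.
move=> mA; apply: eq_integral => x _ /=.
rewrite -[RHS](haar_preimage hH (th (t *: w x))); last exact: measurable_xsection.
by congr (H _); apply/seteqP; split => y; rewrite /xsection /= !inE.
Qed.

Let mdotZ xi : measurable_fun setT (fun x => dotZ xi (w x)).
Proof.
apply: measurable_sum => i; apply: measurable_funM => //.
have c : continuous (fun s : 'rV[R]_r => s 0 i : R) by exact: coord_continuous.
exact: (measurableT_comp (borel_measurable_real c) mw).
Qed.

Let trig_cvg (p : 'rV[R]_r -> R) : trig p ->
  [/\ forall t, measurable_fun setT (fun x => p (t *: w x)),
      exists C : R, forall s, `|p s| <= C &
      forall B, measurable B -> cvg (\int[m]_(x in B) p (t *: w x) @[t --> +oo])].
Proof.
elim => [xi a|a p1 p2 _ [m1 [C1 H1] c1] _ [m2 [C2 H2] c2]].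
  (* Trigonometric polynomials carry a factor [2 pi] that is absent from [mix]; it is absorbed in
     the time. *)
  have E t x : cos (tp * dotZ xi (t *: w x) + a) = osc (fun x => dotZ xi (w x)) a (tp * t) x.
    rewrite /osc; congr (cos (_ + _)); rewrite /dotZ !mulr_sumr; apply: eq_bigr => i _.
    by rewrite !mxE; ring.
  split.
  - by move=> t; under eq_fun do rewrite E; exact: (measurable_osc (mdotZ xi)).
  - by exists 1 => s; exact: cos_max.
  move=> B mB; under eq_fun do under eq_Rintegral do rewrite E.
  have /cvg_ex[l Hl] := @mix xi a B mB.
  apply/cvg_ex; exists l; apply: (cvg_comp _ _ _ Hl).
  have tp0 : 0 < tp by rewrite mulrn_wgt0// pi_gt0.
  apply/cvgryPge => A; near=> t; rewrite mulrC -(ler_pdivrMr _ _ tp0).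
  by near: t; apply: nbhs_pinfty_ge; rewrite num_real.
have bi (q : 'rV[R]_r -> R) (C : R) (B : set X) t : measurable B -> measurable_fun setT (fun x => q (t *: w x)) ->
    (forall s, `|q s| <= C) -> m.-integrable B (EFin \o (fun x => q (t *: w x))).
  move=> mB mq qC; apply: (integrableS measurableT mB (@subsetT _ _)).
  by apply: (@L1_bnd _ _ _ _ _ C).
split.
- by move=> t; apply: measurable_funD => //; exact: measurable_funM.
- exists (`|a| * C1 + C2) => s; apply: (le_trans (ler_normD _ _)).
  by rewrite normrM lerD// ler_wpM2l.
move=> B mB.
have -> : (fun t => \int[m]_(x in B) (a * p1 (t *: w x) + p2 (t *: w x))) =
  (fun t => a * \int[m]_(x in B) p1 (t *: w x) + \int[m]_(x in B) p2 (t *: w x)).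
  apply/funext => t; have i1 := bi p1 _ B t mB (m1 t) H1; have i2 := bi p2 _ B t mB (m2 t) H2.
  rewrite RintegralD// ?RintegralZl//.
  exact: (integrableZl mB a i1).
apply: is_cvgD; last exact: c2.
by apply: is_cvgMr; exact: c1.
Unshelve. all: by end_near. Qed.

Lemma torus_flow_rect (C C' : set X) (D D' : set (borel G)) t :
  measurable C -> measurable C' -> measurable D -> measurable D' ->
  measurable_fun setT (fun x => haar_corr H th D D' (t *: w x)) /\
  fine ((m \x H)%E (torus_flow t @^-1` (C `*` D) `&` (C' `*` D'))) =
  \int[m]_(x in C `&` C') haar_corr H th D D' (t *: w x).
Proof.
move=> mC mC' mD mD'.
pose A (B B' : set X) : set (X * borel G) := torus_flow t @^-1` (B `*` D) `&` (B' `*` D').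
have mA B B' : measurable B -> measurable B' -> measurable (A B B').
  move=> mB mB'; apply: measurableI; last exact: measurableX.
  rewrite -[X in measurable X]setTI; apply: measurable_torus_flow => //.
  exact: measurableX.
have secE B B' x : xsection (A B B') x =
    if x \in B `&` B' then D' `&` (fun y => (th (t *: w x) * y)%g) @^-1` D else set0.
  apply/seteqP; split => y; rewrite /xsection /= inE /A /torus_flow /=.
    by move=> [[xB yD] [xB' yD']]; rewrite mem_set.
  by case: ifPn => //; rewrite inE => -[xB xB'] [yD' yD].
split.
  (* With full base sets, the section over every [x] is the set measured by [haar_corr], so
     measurability in [x] is that of the measure of sections. *)
  have := measurable_fun_xsection H (mA setT setT measurableT measurableT).
  move=> /(measurableT_comp (@fine_measurable R setT measurableT)).
  congr measurable_fun; apply/funext => x /=.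
  by rewrite secE mem_set// setTI.
rewrite /Rintegral; congr fine.
rewrite [RHS]integral_mkcond; apply: eq_integral => x _ /=.
rewrite -/(A C C') secE patchE; case: ifP => _; last by rewrite measure0.
rewrite /haar_corr fineK// fin_num_measure//; apply: measurableI => //.
by rewrite -[X in measurable X]setTI; exact: (borel_measurable (@mulg_continuous _ mulc _)).
Qed.

Lemma torus_flow_mixing (A B : set (X * borel G)) : measurable A -> measurable B ->
  cvg (fine ((m \x H)%E (torus_flow t @^-1` A `&` B)) @[t --> +oo]).
Proof.
apply: (@mixing_dynkin _ _ R (m \x H)%E _
  [set A1 `*` A2 | A1 in measurable & A2 in measurable]) => //.
- have PE : (m \x H)%E setT = 1%E.
    rewrite -setXTT; etransitivity; first exact: product_measure1E.
    transitivity (1 * 1 : \bar R)%E; last by rewrite mule1.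
    by congr (_ * _)%E; exact: probability_setT.
  by rewrite [X in (X < _)%E]PE ltry.
- exact: measurable_prod_measurableType.
- move=> _ _ [A1 mA1 [A2 mA2 <-]] [B1 mB1 [B2 mB2 <-]].
  exists (A1 `&` B1); first exact: measurableI.
  exists (A2 `&` B2); first exact: measurableI.
  by rewrite setXI.
- exact: measurable_torus_flow.
- exact: torus_flow_pres.
move=> _ _ [C mC [D mD <-]] [C' mC' [D' mD' <-]].
under eq_fun do rewrite (torus_flow_rect _ mC mC' mD mD').2.
apply: cvg_approx => e e0.
have Q1 s := haar_corr_le1 H mulc th s mD mD'.
have Qm := haar_corr_mod hH KB GT2 mulc thD thc thZ mD mD'.
(* A single polynomial serves all [x] and [t], since [haar_corr] only sees [t *: w x]. *)
have [p [tpp pQ]] := trig_dense Q1 Qm e0.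
have [mp [Cp Hp] cp] := trig_cvg tpp.
have mCC := measurableI _ _ mC mC'.
exists (fun t => \int[m]_(x in C `&` C') p (t *: w x)); split; first exact: cp.
apply: nearW => t.
have mQ := (torus_flow_rect t mC mC' mD mD').1.
have iQ : m.-integrable (C `&` C') (EFin \o (fun x => haar_corr H th D D' (t *: w x))).
  apply: (integrableS measurableT mCC (@subsetT _ _)).
  by apply: (@L1_bnd _ _ _ _ _ 1).
have ip : m.-integrable (C `&` C') (EFin \o (fun x => p (t *: w x))).
  apply: (integrableS measurableT mCC (@subsetT _ _)).
  by apply: (@L1_bnd _ _ _ _ _ Cp).
rewrite -RintegralB//; have iB := integrableB mCC iQ ip.
apply: (le_trans (le_normr_Rintegral mCC iB)).
apply: (@le_trans _ _ (\int[m]_(x in C `&` C') e)).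
  apply: le_Rintegral => //.
  - exact: integrable_norm.
  - exact: (integrableS measurableT mCC (@subsetT _ _) (L1_cst m e)).
rewrite Rintegral_cst//; apply: ler_piMr; first exact: ltW.
by rewrite -lee_fin fineK ?fin_num_measure// probability_le1.
Qed.

End torus_system.

(** * One-parameter subgroups *)

Section near_diff.
Context (R : realType) (V W : normedModType R).
Implicit Types f g : V -> W.

Lemma near_diff f g x : (\forall y \near x, f y = g y) -> differentiable f x ->
  differentiable g x /\ 'd g x = 'd f x :> (V -> W).
Proof.
move=> fg /diff_locallyP[cdf /eqaddoP Hf].
have Hg : g \o shift x = cst (g x) + 'd f x +o_ (nbhs (0 : V)) id.
  apply/eqaddoP => e e0; have := Hf e e0; rewrite !near_simpl /=.
  have sfg : \forall y \near (0 : V), f (y + x) = g (y + x).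
    have : (fun y : V => y + x) @ nbhs (0 : V) --> nbhs x.
      have : (fun y : V => y + x) @ nbhs (0 : V) --> (0 : V) + x by apply: cvgD; [exact: cvg_id|exact: cvg_cst].
      by rewrite add0r.
    by move=> H; exact: (H _ fg).
  have fgx := nbhs_singleton fg.
  move: sfg; apply: filterS2 => y /= E.
  by rewrite /shift /= /cst /= !fctE /= E fgx.
have dE := diff_unique cdf Hg.
by split => //; apply/diff_locallyP; rewrite dE.
Qed.

(** [Cdiff] speaks of total functions, meaningful in charts on [U] only. As [U] is open, equality on
    it holds near each point and so passes to the differentials, at every order. *)
Lemma Cdiff_ext k (U : set V) f g : open U -> (forall x, U x -> f x = g x) ->
  Cdiff k U f -> Cdiff k U g.
Proof.
move=> oU; have nU x : U x -> nbhs x U by move=> Ux; exact: open_nbhs_nbhs.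
elim: k f g => [|k IH] f g fg /=.
  move=> cf x Ux; rewrite /prop_for /continuous_at -fg//; apply: cvg_trans (cf x Ux).
  by apply: near_eq_cvg; near=> y; apply: fg; near: y; exact: nU.
move=> [df cf]; have H x (Ux : U x) : differentiable g x /\ 'd g x = 'd f x :> (V -> W).
  by apply: near_diff (df x Ux); near=> y; apply: fg; near: y; exact: nU.
split=> [x Ux|v]; first exact: (H x Ux).1.
by apply: IH (cf v) => x Ux; rewrite (H x Ux).2.
Unshelve. all: by end_near. Qed.

(** The derivative of [f (t *: x)] along [v] is ['d f (t *: x) (t *: v)], again a rescaled function,
    so the induction hypothesis applies to [x |-> 'd f x (t *: v)]. *)
Lemma Cdiff_scale k (U : set V) f (t : R) : open U -> Cdiff k U f ->
  Cdiff k ((fun x => t *: x) @^-1` U) (fun x => f (t *: x)).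
Proof.
move=> oU; have ct : continuous (fun x : V => t *: x) by exact: scaler_continuous.
have oU' : open ((fun x => t *: x) @^-1` U) by apply: open_comp => // x _; exact: ct.
elim: k f => [|k IH] f /=.
  by move=> cf x Ux; apply: (continuous_comp (ct x)); exact: cf.
move=> [df cf].
have H x : U (t *: x) -> is_diff x (fun x => f (t *: x)) (fun v => 'd f (t *: x) (t *: v)).
  move=> Ux; have h : is_diff (t *: x) f ('d f (t *: x)) by apply: differentiableP; exact: df.
  exact: (is_diff_comp (f := fun x : V => t *: x) (g := f)).
split=> [x Ux|v]; first by have := H _ Ux; case.
apply: (@Cdiff_ext _ _ (fun x => 'd f (t *: x) (t *: v))) => //.
  by move=> x Ux; case: (H _ Ux) => _ ->.
exact: (IH (fun x => 'd f x (t *: v)) (cf (t *: v))).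
Qed.

Lemma Cdiff_cst k (U : set V) (a : W) : Cdiff k U (fun=> a).
Proof.
elim: k a => [|k IH] a /=; first by move=> x _; exact: cvg_cst.
split=> [x _|v]; first exact: differentiable_cst.
have -> : (fun x : V => 'd (fun=> a) x v) = (fun=> 0); last exact: IH.
by apply/funext => x; rewrite -[fun=> a]/(cst a) diff_cst.
Qed.

End near_diff.

(** * The torus as a quotient of [R^r], and its chart around 0 *)

Section circle.
Context (R : realType).

Lemma circle_projD (x y : R) : circle_proj (x + y) = circle_proj x + circle_proj y.
Proof. exact: (@Quotient.pi_add R (@Zsubgroup R)). Qed.

Lemma circle_proj_eq (x y : R) : circle_proj x = circle_proj y <-> exists k : int, x - y = k%:~R.
Proof.
have E : (x - y \in @Zsubgroup R) <-> circle_proj x = circle_proj y.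
  rewrite (@Quotient.idealrBE R (@Zsubgroup R)); split => [/eqP//|H]; exact/eqP.
rewrite -E; split; first by move=> /(@Num.int_num_subproof R).
by move=> H; apply/(@Num.int_num_subproof R).
Qed.

Lemma circle_proj0 : circle_proj (0 : R) = 0.
Proof.
apply: (addrI (circle_proj (0 : R))); rewrite addr0 -circle_projD addr0 //.
Qed.

Lemma circle_proj_continuous : continuous (@circle_proj R).
Proof. exact: (@pi_continuous R (@Quotient.quot R (@Zsubgroup R))). Qed.

(** The saturation of [O] is the union of its integer translates. *)
Lemma circle_proj_open (O : set R) : open O -> open (@circle_proj R @` O).
Proof.
move=> oO.
have E : @circle_proj R @^-1` (@circle_proj R @` O) =
    \bigcup_(k : int) ((fun x => x + k%:~R) @^-1` O).
  apply/seteqP; split => x /=.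
    move=> [y Oy /circle_proj_eq[k E]]; exists k => //=.
    by rewrite -E addrC subrK.
  move=> [k _ /= Ok]; exists (x + k%:~R) => //; apply/circle_proj_eq; exists k.
  by rewrite addrC addKr.
have oE : open (\bigcup_(k : int) ((fun x : R => x + k%:~R) @^-1` O)).
  apply: bigcup_open => k _; apply: open_comp => // x _.
  by apply: cvgD; [exact: cvg_id|exact: cvg_cst].
by rewrite -E in oE; exact: oE.
Qed.

Context (r : nat).
Local Notation tproj := (@torus_proj R r).

Lemma torus_projD (x y : 'rV[R]_r) : tproj (x + y) = tproj x + tproj y.
Proof. by apply/rowP => j; rewrite !mxE circle_projD. Qed.

Lemma torus_proj0 : tproj 0 = 0.
Proof. by apply/rowP => j; rewrite !mxE circle_proj0. Qed.

Lemma torus_proj_eq (x y : 'rV[R]_r) :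
  tproj x = tproj y <-> forall j, exists k : int, x 0 j - y 0 j = k%:~R.
Proof.
split => [E j|H].
  by apply/circle_proj_eq; have := congr1 (fun M : 'rV[circle R]_r => M 0 j) E; rewrite !mxE.
by apply/rowP => j; rewrite !mxE; apply/circle_proj_eq.
Qed.

Lemma torus_proj_continuous : continuous tproj.
Proof.
move=> x A [P Px PA]; exists (fun i j => @circle_proj R @^-1` P i j) => [i j|y /= Hy].
  by have := Px i j; rewrite mxE => H; exact: (circle_proj_continuous H).
by apply: PA => i j; rewrite mxE; exact: Hy.
Qed.

Lemma torus_proj_open (O : set 'rV[R]_r) : open O -> open (tproj @` O).
Proof.
move=> oO; rewrite openE => _ [x Ox <-].
have [P Px PO] : nbhs x O by exact: open_nbhs_nbhs.
exists (fun i j => @circle_proj R @` (P i j)°) => [i j|y /= Hy].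
  rewrite mxE; apply: open_nbhs_nbhs; split; first exact/circle_proj_open/open_interior.
  by exists (x i j) => //; exact: Px.
have /choice[z Hz] : forall j, exists z : R, P 0 j z /\ circle_proj z = y 0 j.
  by move=> j; have [z /interior_subset Pz zy] := Hy 0 j; exists z.
exists (\row_j z j).
  by apply: PO => i j; rewrite ord1 mxE; exact: (Hz j).1.
by apply/rowP => j; rewrite !mxE; exact: (Hz j).2.
Qed.

(** The bound [1 / 2] makes two points differ by less than 1 in each coordinate, so the projection
    is injective here. *)
Definition torus_cell : set 'rV[R]_r := [set x | forall j, `|x 0 j| < 1 / 2].

Lemma torus_cell_open : open torus_cell.
Proof.
rewrite openE => x Hx; exists (fun _ j => [set y | `|y| < 1 / 2]) => [i j|y Hy j]; last exact: Hy.
rewrite ord1; apply: open_nbhs_nbhs; split; last exact: Hx.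
have -> : [set y : R | `|y| < 1 / 2] = `](- (1 / 2)), (1 / 2)[%classic.
  by apply/seteqP; split => y /=; rewrite in_itv/= ltr_norml.
exact: interval_open.
Qed.

Lemma torus_cell_inj x y : torus_cell x -> torus_cell y -> tproj x = tproj y -> x = y.
Proof.
move=> Hx Hy /torus_proj_eq H; apply/rowP => j; have [k Hk] := H j.
have : `|k%:~R : R| < 1.
  rewrite -Hk; apply: (le_lt_trans (ler_normB _ _)).
  by have := Hx j; have := Hy j; lra.
rewrite -intr_norm -[1]/(1%:~R) ltr_int => k1.
have k0 : k = 0 by case: k k1 {Hk} => -[].
by apply/eqP; rewrite -subr_eq0 Hk k0.
Qed.

Definition torus_chart0 : chart 'rV[circle R]_r 'rV[R]_r :=
  Chart (tproj @` torus_cell) (fun p => xget 0 [set x | torus_cell x /\ tproj x = p]) tproj.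

Lemma torus_chart0_crd x : torus_cell x -> crd torus_chart0 (tproj x) = x.
Proof.
move=> Hx; have [h1 h2] := @xgetPex _ 0 [set y | torus_cell y /\ tproj y = tproj x]
  (ex_intro _ x (conj Hx erefl)).
exact: torus_cell_inj h1 Hx h2.
Qed.

Lemma torus_chart0_is_chart : is_chart torus_chart0.
Proof.
have oD : open (dom torus_chart0) by exact/torus_proj_open/torus_cell_open.
have E : crd torus_chart0 @` dom torus_chart0 = torus_cell.
  apply/seteqP; split => x.
    by move=> [_ [y Hy <-] <-]; rewrite torus_chart0_crd.
  by move=> Hx; exists (tproj x); [exists x|exact: torus_chart0_crd].
split => //; first by rewrite E; exact: torus_cell_open.
rewrite E; split; [split|split].
- by move=> _ [x Hx <-]; rewrite torus_chart0_crd.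
- by move=> x Hx; exists x.
- by move=> _ [x Hx <-]; rewrite torus_chart0_crd.
- by move=> x Hx; rewrite torus_chart0_crd.
- rewrite continuous_open_subspace//; apply/(continuous_inP _ oD) => X oX.
  have -> : dom torus_chart0 `&` crd torus_chart0 @^-1` X = tproj @` (torus_cell `&` X).
    apply/seteqP; split => p.
      by case=> -[x Hx <-]; rewrite /preimage /mkset torus_chart0_crd// => Xx; exists x.
    move=> [x [Hx Xx] <-]; split; first by exists x.
    by rewrite /preimage /mkset torus_chart0_crd.
  by apply: torus_proj_open; apply: openI => //; exact: torus_cell_open.
- exact/continuous_subspaceT/torus_proj_continuous.
Qed.

Lemma torus_chart0_atlas : @torus_atlas R r torus_chart0.
Proof. by split; first exact: torus_chart0_is_chart. Qed.

Lemma torus_chart0_0 : dom torus_chart0 0.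
Proof.
by exists 0; [move=> j; rewrite mxE normr0 divr_gt0|exact: torus_proj0].
Qed.

End circle.

(** * Calculus of velocities of curves *)

Section velocity.
Context (R : realType).

(** Turns derivatives of curves into differentials, to which the chain rule applies. *)
Lemma is_derive_diff (W : normedModType R) (t : R) (f : R -> W) (u : W) :
  is_derive t 1 f u <-> is_diff t f (fun x : R => x *: u).
Proof.
split=> [[/derivable1_diffP df E]|[df E]].
  apply: DiffDef => //; apply/funext => x.
  by rewrite -[X in 'd f t X](mulr1 x) -[x * 1]/(x *: (1 : R^o)) linearZ /= -deriveE// E.
apply: DeriveDef; first exact/derivable1_diffP.
by rewrite deriveE// E scale1r.
Qed.

Lemma is_derive_shift0 (W : normedModType R) (t : R) (f : R -> W) (u : W) :
  is_derive (0 : R) 1 (fun s : R => f (t + s)) u -> is_derive t 1 f u.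
Proof.
move=> /is_derive_diff H; apply/is_derive_diff.
have h1 : is_diff t (fun x : R => x - t) (fun x : R => x).
  have -> : (fun x : R => x) = id - (0 : R -> R) by apply/funext => x; rewrite !fctE subr0.
  have -> : (fun x : R => x - t) = id - cst t by apply/funext => x; rewrite !fctE.
  exact: is_diffB.
have H' : is_diff (t - t) (fun s : R => f (t + s)) (fun x : R => x *: u) by rewrite subrr.
have := @is_diff_comp R R R W (fun x : R => x - t) (fun x : R => x) _ _ t h1 H'.
have E : f = (fun s : R => f (t + s)) \o (fun x : R => x - t).
  by apply/funext => x /=; rewrite addrC subrK.
by move: h1 H' => _ _; rewrite -E.
Qed.

Lemma is_derive_scale0 (W : normedModType R) (t : R) (f : R -> W) (u : W) :
  is_derive (0 : R) 1 f u -> is_derive (0 : R) 1 (fun s => f (t * s)) (t *: u).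
Proof.
move=> /is_derive_diff H; apply/is_derive_diff.
have h1 : is_diff (0 : R) (fun x : R => t * x) (fun x : R => t * x) by exact: is_diff_scaler.
have H' : is_diff (t * 0) f (fun x : R => x *: u) by rewrite mulr0.
have := @is_diff_comp R R R W _ _ _ _ 0 h1 H'.
have -> // : (fun x : R => x *: (t *: u)) = (fun x : R => x *: u) \o (fun x : R => t * x).
by apply/funext => x /=; rewrite scalerA mulrC.
Qed.

Lemma is_derive_row_cst d (f : R -> 'rV[R]_d) (e : R) :
  (forall t : R, `|t| < e -> is_derive t 1 f 0) -> forall t : R, `|t| < e -> f t = f 0.
Proof.
move=> H t te; apply/rowP => j.
have Hj (s : R) : `|s| < e -> is_derive s 1 (fun x : R => f x 0 j) 0.
  move=> /H[df E]; have dj := (iffLR (derivable_mxP _ _ _) df) 0 j.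
  by apply: DeriveDef => //; have := derive_mx df; rewrite E => /matrixP/(_ 0 j); rewrite !mxE.
have K (s u : R) : s <= u -> `|s| < e -> `|u| < e -> f s 0 j = f u 0 j.
  move=> su se ue.
  have inI (x : R) : s <= x <= u -> `|x| < e.
    move=> /andP[sx xu]; move: (se) (ue); rewrite !ltr_norml => /andP[s1 _] /andP[_ u1].
    by apply/andP; split; [exact: lt_le_trans sx|exact: le_lt_trans u1].
  apply/eqP; rewrite eq_sym -subr_eq0.
  have [| |c _ ->] := @MVT_segment _ (fun x => f x 0 j) (fun=> 0) s u su; last by rewrite mul0r.
    by move=> x; rewrite in_itv/= => /andP[sx xu]; apply: Hj; apply: inI; rewrite !ltW.
  apply: derivable_within_continuous => x; rewrite in_itv/= => xI.
  by case: (Hj x (inI _ xI)).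
have e0 : `|0 : R| < e by rewrite normr0; exact: le_lt_trans te.
by have [t0|t0] := leP t 0; [exact: K|apply/esym/K => //; exact: ltW].
Qed.


Lemma velocity_uniq (X : topologicalType) (E : normedModType R) (a : chart X E)
    (gamma : R -> X) (u v : E) : velocity a gamma u -> velocity a gamma v -> u = v.
Proof. by move=> [_ _ [_ <-]] [_ _ [_ <-]]. Qed.

Lemma velocity_near (X : topologicalType) (E : normedModType R) (a : chart X E)
    (gamma eta : R -> X) (u : E) : (\forall t \near (0 : R), gamma t = eta t) ->
  velocity a gamma u -> velocity a eta u.
Proof.
move=> ge [ad gc gd]; have g0 := nbhs_singleton ge; split; first by rewrite -g0.
  rewrite /prop_for /continuous_at -g0; apply: cvg_trans gc.
  by apply: near_eq_cvg; apply: filterS ge => t ->.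
apply: near_eq_is_derive gd.
by apply: filterS ge => t /= ->.
Qed.

Lemma velocity_cst (X : topologicalType) (E : normedModType R) (a : chart X E)
    (x : X) : dom a x -> velocity a (fun=> x) 0.
Proof.
move=> ax; split => //; first exact: cvg_cst.
exact: is_derive_cst.
Qed.

Lemma velocity_scale (X : topologicalType) (E : normedModType R) (a : chart X E)
    (gamma : R -> X) (u : E) (t : R) : velocity a gamma u ->
  velocity a (fun s => gamma (t * s)) (t *: u).
Proof.
move=> [ad gc gd]; split; first by rewrite mulr0.
  apply: (@continuous_comp _ _ _ (fun s : R => t * s) gamma 0); first exact: mulrl_continuous.
  by rewrite mulr0.
exact: is_derive_scale0 gd.
Qed.

Lemma velocity_map (X Y : topologicalType) (E F : normedModType R) (a : chart X E)
    (b : chart Y F) (f : X -> Y) (gamma : R -> X) (u : E) :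
  is_chart a -> velocity a gamma u -> {for gamma 0, continuous f} ->
  dom b (f (gamma 0)) -> differentiable (crd b \o f \o par a) (crd a (gamma 0)) ->
  velocity b (f \o gamma) ('d (crd b \o f \o par a) (crd a (gamma 0)) u).
Proof.
move=> [oa _ [[_ _ pc _] _]] [ag gc gd] fc bf df; split => //.
  exact: continuous_comp.
have na : \forall t \near (0 : R), dom a (gamma t).
  by apply: gc; apply: open_nbhs_nbhs; split.
apply: (@near_eq_is_derive _ _ _ ((crd b \o f \o par a) \o (crd a \o gamma))).
  by apply: filterS na => t /= /pc ->.
apply/is_derive_diff.
have := @is_diff_comp R R E F _ _ _ _ 0 (iffLR (is_derive_diff _ _ _) gd) (differentiableP df).
have -> // : (fun x : R => x *: 'd (crd b \o f \o par a) (crd a (gamma 0)) u) =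
  'd (crd b \o f \o par a) ((crd a \o gamma) 0) \o *:%R^~ u.
by apply/funext => x /=; rewrite linearZ.
Qed.

Lemma velocity_Cmap (X Y : topologicalType) (E F : normedModType R)
    (A : set (chart X E)) (B : set (chart Y F)) (D : set X) (a : chart X E)
    (b : chart Y F) (f : X -> Y) (gamma : R -> X) (u : E) :
  A a -> B b -> Cmap 1 A B D f ->
  is_chart a -> velocity a gamma u -> D (gamma 0) -> dom b (f (gamma 0)) ->
  velocity b (f \o gamma) ('d (crd b \o f \o par a) (crd a (gamma 0)) u).
Proof.
move=> Aa Bb [fc fd] ca vg Dg bf.
apply: velocity_map => //; first exact: fc.
have [+ _] := fd a b Aa Bb; apply; exists (gamma 0) => //.
by case: vg.
Qed.

Lemma velocity_pair (X Y : topologicalType) (E F : normedModType R) (a : chart X E)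
    (b : chart Y F) (gamma : R -> X) (eta : R -> Y) (u : E) (v : F) :
  velocity a gamma u -> velocity b eta v ->
  velocity (prod_chart a b) (fun t => (gamma t, eta t)) (u, v).
Proof.
move=> [ag gc gd] [bh hc hd]; split => //.
  exact: (cvg_pair gc hc).
apply/is_derive_diff; move/is_derive_diff in gd; move/is_derive_diff in hd.
exact: (@is_diff_pair R R E F _ _ _ _ 0 gd hd).
Qed.

Lemma open_setX (X Y : topologicalType) (A : set X) (B : set Y) :
  open A -> open B -> open (A `*` B).
Proof.
move=> oA oB; rewrite openE => -[x y] [/= Ax By].
by exists (A, B) => //; split; exact: open_nbhs_nbhs.
Qed.

Lemma prod_is_chart (X Y : topologicalType) (E F : normedModType R) (a : chart X E)
    (b : chart Y F) : is_chart a -> is_chart b -> is_chart (prod_chart a b).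
Proof.
move=> [oa oca [[a1 a2 a3 a4] [a5 a6]]] [ob ocb [[b1 b2 b3 b4] [b5 b6]]].
have oab : open (dom a `*` dom b) by exact: open_setX.
have E1 : crd (prod_chart a b) @` dom (prod_chart a b) = (crd a @` dom a) `*` (crd b @` dom b).
  apply/seteqP; split => -[x y].
    by move=> [[p q] [/= ap bq] [<- <-]]; split; [exists p|exists q].
  by move=> [[p ap /= <-] [q bq /= <-]]; exists (p, q).
have oE : open (crd (prod_chart a b) @` dom (prod_chart a b)) by rewrite E1; exact: open_setX.
split => //; split; [split|split].
- by move=> p Hp; exists p.
- by rewrite E1 => -[x y] [xa yb]; split; [exact: a2|exact: b2].
- by move=> [p q] [/= ap bq]; rewrite a3// b3.
- by rewrite E1 => -[x y] [xa yb] /=; rewrite a4// b4.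
- rewrite continuous_open_subspace// => -[p q] /[!inE] -[ap bq].
  rewrite continuous_open_subspace// in a5; rewrite continuous_open_subspace// in b5.
  apply: cvg_pair; [apply: (@continuous_comp _ _ _ fst (crd a) (p, q))|apply: (@continuous_comp _ _ _ snd (crd b) (p, q))].
  + exact: cvg_fst.
  + by apply: a5; rewrite inE.
  + exact: cvg_snd.
  + by apply: b5; rewrite inE.
- rewrite continuous_open_subspace// => -[p q] /[!inE]; rewrite E1 => -[ap bq].
  rewrite continuous_open_subspace// in a6; rewrite continuous_open_subspace// in b6.
  apply: cvg_pair; [apply: (@continuous_comp _ _ _ fst (par a) (p, q))|apply: (@continuous_comp _ _ _ snd (par b) (p, q))].
  + exact: cvg_fst.
  + by apply: a6; rewrite inE.
  + exact: cvg_snd.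
  + by apply: b6; rewrite inE.
Qed.

End velocity.

(** * Exponential curves and their torus coordinates *)

Section lie.
Context (R : realType) (d : nat) (G : pTopGroupType) (AG : set (chart G 'rV[R]_d)).
Hypothesis hG : is_lie_group AG.
Context (c0 : chart G 'rV[R]_d).
Hypotheses (hc0 : AG c0) (hc0e : dom c0 1%g).
Local Open Scope group_scope.

Lemma lie_chart c : AG c -> is_chart c.
Proof. by case: hG => _ /(_ 0%N)[H _ _] _ _; exact: H. Qed.

Lemma lie_cover x : exists2 c, AG c & dom c x.
Proof. by case: hG => _ /(_ 0%N)[_ H _] _ _; exact: H. Qed.

Lemma lie_mul_continuous : continuous (fun p : G * G => p.1 * p.2).
Proof. by case: hG => _ _ /(_ 0%N)[H _] _ p; exact: H. Qed.

(** [L] is the differential of multiplication at [(x, y)]. It is fixed before the curves, so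
    products of curves with equal velocities can be compared. *)
Lemma velocity_mul a b c (x y : G) : AG a -> AG b -> AG c -> dom c (x * y) ->
  exists L : {linear ('rV[R]_d * 'rV[R]_d)%type -> 'rV[R]_d},
  forall (gamma eta : R -> G) u v, gamma 0 = x -> eta 0 = y ->
    velocity a gamma u -> velocity b eta v ->
    velocity c (fun t => gamma t * eta t) (L (u, v)).
Proof.
move=> Aa Ab Ac cxy.
exists ('d (crd c \o (fun p : G * G => p.1 * p.2) \o par (prod_chart a b)) (crd (prod_chart a b) (x, y))).
move=> gamma eta u v gx ey vg ve.
have [_ _ H _] := hG.
have := @velocity_Cmap R _ _ _ _ _ _ _ (prod_chart a b) c _ (fun t => (gamma t, eta t)) (u, v)
  _ Ac (H 1%N) _ (velocity_pair vg ve).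
rewrite gx ey; apply => //; first by exists a, b.
by apply: prod_is_chart; exact: lie_chart.
Qed.

Lemma velocity_translate a c (x p y : G) : AG a -> AG c -> dom c (x * p * y) ->
  exists2 L : 'rV[R]_d -> 'rV[R]_d, L 0%R = 0%R &
  forall (gamma : R -> G) u, gamma 0 = p -> velocity a gamma u ->
    velocity c (fun t => x * gamma t * y) (L u).
Proof.
move=> Aa Ac cxpy.
have [b Ab bx] := lie_cover x; have [b' Ab' bxp] := lie_cover (x * p).
have [b'' Ab'' by_] := lie_cover y.
have [L1 H1] := velocity_mul Ab Aa Ab' bxp.
have [L2 H2] := velocity_mul Ab' Ab'' Ac cxpy.
have z : (0%R, 0%R) = 0%R :> ('rV[R]_d * 'rV[R]_d)%type by [].
exists (fun u => L2 (L1 (0%R, u), 0%R)); first by rewrite z linear0 z linear0.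
move=> gamma u gp vg; apply: H2; rewrite ?gp//; last exact: velocity_cst.
by apply: H1 => //; exact: velocity_cst.
Qed.

Section hom.
Context (gamma : R -> G).
Hypothesis gD : forall s t, gamma (s + t)%R = gamma s * gamma t.

Lemma hom0 : gamma 0%R = 1.
Proof. by apply: (@mulgI _ (gamma 0%R)); rewrite -gD addr0 mulg1. Qed.

Lemma homN t : gamma (- t)%R = (gamma t)^-1.
Proof. by apply: (@mulgI _ (gamma t)); rewrite -gD subrr hom0 mulgV. Qed.

Lemma homX t n : gamma (t *+ n)%R = gamma t ^+ n.
Proof. by elim: n => [|n IH]; rewrite ?hom0 ?expg0// mulrS gD IH expgS. Qed.

End hom.

(* [gamma * eta^-1] has velocity zero at time [0], because so has the constant
   curve [gamma * gamma^-1]; by translation its velocity then vanishes at all times. *)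
Lemma ops_uniq (gamma eta : R -> G) u :
  continuous gamma -> continuous eta ->
  (forall s t, gamma (s + t)%R = gamma s * gamma t) ->
  (forall s t, eta (s + t)%R = eta s * eta t) ->
  velocity c0 gamma u -> velocity c0 eta u -> gamma = eta.
Proof.
move=> gc ec gD eD vg ve.
(* Written [-1 * t] so that [velocity_scale] applies as it stands. *)
pose de t := gamma t * eta (-1 * t)%R.
have dec : continuous de.
  move=> t; apply: (@continuous_comp _ _ _ (fun t : R => (gamma t, eta (-1 * t)%R)) (fun p : G * G => p.1 * p.2)).
    apply: cvg_pair; first exact: gc.
    apply: (@continuous_comp _ _ _ (fun t : R => -1 * t)%R eta); last exact: ec.
    exact: mulrl_continuous.
  exact: lie_mul_continuous.
have v0 : velocity c0 de 0%R.
  have c11 : dom c0 (1 * 1) by rewrite mulg1.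
  have [L H] := velocity_mul hc0 hc0 hc0 c11.
  have V1 := H _ _ _ _ (hom0 gD) _ vg (velocity_scale (-1) ve).
  have V2 := H _ _ _ _ (hom0 gD) _ vg (velocity_scale (-1) vg).
  have := velocity_uniq (V2 _) _; rewrite !mulr0 (hom0 gD) => /(_ _ erefl) E.
  suff <- : L (u, (-1 *: u)%R) = 0%R by apply: V1; rewrite mulr0 (hom0 eD).
  apply: E; apply: velocity_near (velocity_cst hc0e); near=> t.
  by rewrite mulN1r (homN gD) mulgV.
have de0 : de 0%R = 1 by rewrite /de mulr0 (hom0 gD) (hom0 eD) mulg1.
have deD t s : de (t + s)%R = gamma t * de s * eta (-1 * t)%R.
  by rewrite /de gD mulrDr addrC eD !mulgA.
have dd (t : R) : dom c0 (de t) -> is_derive t (1 : R)%R (crd c0 \o de) 0%R.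
  move=> dt; have c1 : dom c0 (gamma t * 1 * eta (-1 * t)%R) by rewrite -de0 -deD addr0.
  have [L L0 H] := velocity_translate hc0 hc0 c1.
  have [_ _] := H _ _ de0 v0; rewrite L0 => D; apply: is_derive_shift0.
  by apply: near_eq_is_derive D; near=> s => /=; rewrite deD.
have [oc _ [[_ _ pc _] _]] := lie_chart hc0.
have : \forall t \near (0 : R)%R, dom c0 (de t).
  by apply: dec; rewrite de0; apply: open_nbhs_nbhs; split.
move=> /nbhs_ballP[e /= e0 He].
have small (t : R) : (`|t| < e)%R -> gamma t = eta t.
  move=> te.
  have inD (s : R) : (`|s| < e)%R -> dom c0 (de s) by move=> se; apply: He; rewrite /ball/= sub0r normrN.
  have := is_derive_row_cst (fun s se => dd s (inD s se)) te => /= E.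
  have : de t = de 0%R by rewrite -(pc _ (inD t te)) E pc// de0.
  rewrite de0 /de mulN1r (homN eD) => /(congr1 (fun x => x * eta t)).
  by rewrite -mulgA mulVg mulg1 mul1g.
apply/funext => t.
(* The two curves agree near 0, and every [t] is a multiple of a time that small. *)
set k := Num.bound (`|t| / e)%R.
have tk : (`|t / k.+1%:R| < e)%R.
  rewrite normrM normfV (ger0_norm (ler0n _ _)) ltr_pdivrMr ?ltr0Sn// mulrC -ltr_pdivrMr//.
  have := archi_boundP (_ : 0 <= `|t| / e)%R; rewrite -/k => H.
  apply: (lt_trans (H _)); first by rewrite divr_ge0// ltW.
  by rewrite ltr_nat.
have tE : t = (t / k.+1%:R *+ k.+1)%R by rewrite -mulr_natr mulfVK// pnatr_eq0.
by rewrite tE (homX gD) (homX eD) small.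
Unshelve. all: by end_near. Qed.

Lemma ops_continuous gamma : one_parameter_subgroup AG gamma -> continuous gamma.
Proof. by move=> [/(_ 0%N)[H _] _] x; exact: H. Qed.

Lemma ops_scale gamma (s : R) : one_parameter_subgroup AG gamma ->
  one_parameter_subgroup AG (fun t => gamma (s * t)%R).
Proof.
move=> og; have gc := ops_continuous og; case: og => gs gD; split; last first.
  by move=> t u; rewrite mulrDr gD.
have sc : continuous (fun t : R => s * t)%R by exact: mulrl_continuous.
move=> k; split=> [x _|a b]; first exact: (continuous_comp (sc x) (gc _)).
move=> -> Ab /=.
have [_ /(_ (Chart setT id id) b erefl Ab) /=] := gs k.
rewrite !image_id !setTI => H.
have := @Cdiff_scale _ _ _ k (gamma @^-1` dom b) _ s _ H; apply.
by apply: open_comp => [x _|]; [exact: gc|case: (lie_chart Ab)].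
Qed.

Lemma ops_cst : one_parameter_subgroup AG (fun=> 1).
Proof.
split=> [k|s t]; last by rewrite mulg1.
split=> [x _|a b -> Ab]; first exact: cvg_cst.
exact: Cdiff_cst.
Qed.

Lemma lie_expE gamma u : one_parameter_subgroup AG gamma -> velocity c0 gamma u ->
  lie_exp AG c0 u = gamma 1%R.
Proof.
move=> og vg; rewrite /lie_exp; set P := [set x | _].
have [eta [oe ve ->]] : P (xget 1 P) by apply: xgetPex; exists (gamma 1%R), gamma.
by rewrite (ops_uniq (ops_continuous og) (ops_continuous oe) og.2 oe.2 vg ve).
Qed.

(* Existence of one-parameter subgroups is not needed: when none has velocity [u],
   [lie_exp (t *: u)] is the default value [1] for all [t != 0], and is [1] at
   [t = 0] too, so that the constant curve will do. *)
Lemma lie_exp_curve u : exists gamma u',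
  [/\ one_parameter_subgroup AG gamma, velocity c0 gamma u' &
      forall t : R, lie_exp AG c0 (t *: u) = gamma t].
Proof.
have [[gamma [og vg]]|H] := pselect (exists gamma, one_parameter_subgroup AG gamma /\ velocity c0 gamma u).
  exists gamma, u; split => // t.
  by rewrite (lie_expE (ops_scale t og) (velocity_scale t vg)) mulr1.
exists (fun=> 1), 0%R; split; [exact: ops_cst|exact: velocity_cst|] => t.
have [->|t0] := eqVneq t 0%R.
  by rewrite scale0r (lie_expE ops_cst (velocity_cst hc0e)).
rewrite /lie_exp xgetPN// => x [gamma [og vg _]]; apply: H.
exists (fun s => gamma (t^-1 * s)%R); split; first exact: ops_scale.
by have := velocity_scale t^-1 vg; rewrite scalerA mulVf// scale1r.
Qed.

Section torus.
Context (T : set G) (r : nat) (chi : G -> 'rV[circle R]_r).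
Hypothesis hT : is_subgroup T.
Hypothesis chiD : forall x y, T x -> T y -> chi (x * y) = (chi x + chi y)%R.
Hypothesis chiS : smooth_on_subset AG (@torus_atlas R r) T chi.

Lemma chi1 : chi 1 = 0%R.
Proof.
have [T1 _ _] := hT.
by apply: (@addrI _ (chi 1)); rewrite -chiD// mulg1 addr0.
Qed.

(* Two charts of the torus differ locally by an integer vector. *)
Lemma torus_charts_agree b (p : R -> 'rV[circle R]_r) (u : 'rV[R]_r) :
  torus_atlas b -> dom b (p 0%R) -> p 0%R = 0%R -> velocity (@torus_chart0 R r) p u -> velocity b p u.
Proof.
move=> [[ob _ [[_ _ pcb _] [cb _]]] pb] bp p0 [dp cp vp]; split => //.
have b0 := @torus_chart0_is_chart R r.
move: b0 => [od _ [[_ _ pc0 _] [c0' _]]].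
set c := @torus_chart0 R r in od pc0 c0' dp vp *.
have cb0 : {for p 0%R, continuous (crd b)}.
  by rewrite continuous_open_subspace// in cb; apply: cb; rewrite inE.
have c00 : {for p 0%R, continuous (crd c)}.
  by rewrite continuous_open_subspace// in c0'; apply: c0'; rewrite inE.
pose D t := (crd b (p t) - crd c (p t))%R.
have Dc : {for 0%R, continuous D}.
  by apply: cvgB; [exact: (continuous_comp cp cb0)|exact: (continuous_comp cp c00)].
have nD : \forall t \near (0 : R)%R, forall j, (`|(D 0 - D t)%R 0%R j| < 1)%R.
  have := Dc; move/cvgrPdist_lt => /(_ 1%R ltr01); apply: filterS => t Ht j.
  apply: le_lt_trans Ht; rewrite [leRHS]/Num.Def.normr/= mx_normrE.
  exact: (@le_bigmax _ _ _ _ (fun ij : 'I_1 * 'I_r => `|(D 0 - D t)%R ij.1 ij.2|%R) (0%R, j)).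
have nb : \forall t \near (0 : R)%R, dom b (p t).
  by apply: cp; apply: open_nbhs_nbhs; split.
have nc : \forall t \near (0 : R)%R, dom c (p t).
  by apply: cp; apply: open_nbhs_nbhs; split.
have Dint t : dom b (p t) -> dom c (p t) -> forall j, exists k : int, D t 0%R j = k%:~R%R.
  move=> bt ct; have := pc0 _ ct; rewrite -{2}(pcb _ bt) pb => /esym/torus_proj_eq H j.
  by have [k Hk] := H j; exists k; rewrite /D !mxE.
have D0 : is_derive (0 : R)%R (1 : R)%R ((crd c \o p) + (cst (D 0%R) : R -> 'rV[R]_r))%R (u + 0)%R.
  exact: is_deriveD.
rewrite addr0 in D0.
apply: near_eq_is_derive D0.
  near=> t; rewrite fctE /=.
  have bt : dom b (p t) by near: t.
  have ct : dom c (p t) by near: t.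
  have Dt : D t = D 0%R.
    apply/rowP => j; have [k Hk] := Dint t bt ct j; have [l Hl] := Dint _ bp dp j.
    have : (`|(D 0 - D t)%R 0%R j| < 1)%R by move: j {k Hk l Hl}; near: t.
    rewrite mxE [X in (_ + X)%R]mxE Hk Hl -intrB -intr_norm -[1%R]/(1%:~R)%R ltr_int => kl.
    have : (l - k)%R = 0%R by case: (l - k)%R kl => -[].
    by move/eqP; rewrite subr_eq0 => /eqP ->.
  by rewrite -Dt /D addrC subrK.
Unshelve. all: by end_near. Qed.

(** [Dchi] is chosen by [xget], so a vector valid for all curves and all charts must be exhibited:
    the differential of a smooth extension of [chi] near 1, read in [torus_chart0] and carried to
    the other charts by [torus_charts_agree]. *)
Lemma Dchi_velocity (beta : R -> G) (u : 'rV[R]_d) :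
  (forall t, T (beta t)) -> beta 0%R = 1 -> velocity c0 beta u ->
  velocity (@torus_chart0 R r) (chi \o beta) (Dchi c0 T chi u).
Proof.
move=> bT b0 vb; have [T1 _ _] := hT.
rewrite /Dchi /tangent_map; set P := [set w | _].
suff : exists w, P w.
  move=> /(@xgetPex _ 0%R _) H; apply: H => //; first exact: torus_chart0_atlas.
  by rewrite chi1; exact: torus_chart0_0.
have [N [F [oN N1 sF NF]]] := chiS T1.
exists ('d (crd (@torus_chart0 R r) \o F \o par c0) (crd c0 1) u).
move=> gamma gT g0 vg b Ab bc.
have ggF : \forall t \near (0 : R)%R, (F \o gamma) t = (chi \o gamma) t.
  have : \forall t \near (0 : R)%R, N (gamma t).
    by case: vg => _ + _; apply; rewrite g0; apply: open_nbhs_nbhs; split.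
  by apply: filterS => t Nt /=; exact: NF.
apply: torus_charts_agree => //; rewrite /= ?g0 ?chi1//; first by rewrite -chi1.
apply: velocity_near ggF _.
have := @velocity_Cmap R _ _ _ _ _ _ _ c0 (@torus_chart0 R r) _ gamma u hc0
  (@torus_chart0_atlas R r) (sF 1%N) (lie_chart hc0) vg.
rewrite g0; apply => //.
by rewrite NF// chi1; exact: torus_chart0_0.
Qed.

Context (theta : 'rV[circle R]_r -> G).
Hypothesis thetaK : forall x, T x -> theta (chi x) = x.
Hypothesis thetaC : continuous theta.

(** For large [n] the homomorphism property gives [beta t = theta (torus_proj (n.+1%:R *: f (t /
    n.+1%:R)))], where [f] reads [beta] in the chart around 0; by definition of the derivative the
    argument tends to [t *: w]. *)
Lemma torus_curve (beta : R -> G) (w : 'rV[R]_r) :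
  (forall s t, beta (s + t)%R = beta s * beta t) -> (forall t, T (beta t)) ->
  velocity (@torus_chart0 R r) (chi \o beta) w ->
  forall t, beta t = theta (torus_proj (t *: w)%R).
Proof.
move=> bD bT [dp cp vp] t.
have [od _ [[_ _ pc _] _]] := @torus_chart0_is_chart R r.
have [GT2 _ _ _] := hG.
set c := @torus_chart0 R r in dp vp od pc.
pose f (s : R) := crd c (chi (beta s)).
have f0 : f 0%R = 0%R.
  rewrite /f (hom0 bD) chi1 -torus_proj0 torus_chart0_crd//.
  by move=> j; rewrite mxE normr0 divr_gt0.
have q0 : (t / n.+1%:R)%R @[n --> \oo] --> (0 : R)%R.
  by rewrite -(mulr0 t); apply: cvgM; [exact: cvg_cst|exact: cvg_harmonic].
have H1 : (n.+1%:R *: f (t / n.+1%:R))%R @[n --> \oo] --> (t *: w)%R.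
  (* The difference quotient converges along nonzero times, so [t = 0] is treated apart. *)
  have [-> |t0] := eqVneq t 0%R.
    rewrite scale0r; have -> : (fun n : nat => n.+1%:R *: f (0 / n.+1%:R))%R = (fun=> 0%R).
      by apply/funext => n; rewrite mul0r f0 scaler0.
    exact: cvg_cst.
  have [df E] := vp.
  have D : (fun h : R => h^-1 *: ((crd c \o (chi \o beta)) (h *: (1 : R) + 0) - f 0))%R @ (0 : R)^'%R --> w.
    by rewrite -E; exact: df.
  have q1 : (t / n.+1%:R)%R @[n --> \oo] --> (0 : R)^'%R.
    move=> B HB.
    have HB' : \forall n \near \oo, (fun y : R => y != 0%R -> B y) (t / n.+1%:R)%R := q0 _ HB.
    apply: filterS HB' => n; apply.
    by rewrite mulf_neq0// invr_eq0 pnatr_eq0.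
  pose z (n : nat) := (t *: ((t / n.+1%:R)^-1 *: ((crd c \o (chi \o beta)) ((t / n.+1%:R) *: (1 : R) + 0) - f 0)))%R.
  have Z : z @ \oo --> (t *: w)%R := cvgZ (cvg_cst t) (cvg_comp _ _ q1 D).
  suff -> : (fun n : nat => n.+1%:R *: f (t / n.+1%:R))%R = z by exact: Z.
  apply/funext => n; rewrite /z /=.
  by rewrite f0 subr0 addr0 -[(_ *: 1)%R]/(_ * 1)%R mulr1 scalerA invf_div mulrCA mulfV// mulr1.
have bX x n : chi (beta (x *+ n)%R) = (chi (beta x) *+ n)%R.
  elim: n => [|n IH]; first by rewrite (hom0 bD) chi1.
  by rewrite !mulrS bD chiD// IH.
have pX (x : 'rV[R]_r) n : torus_proj (x *+ n)%R = (torus_proj x *+ n)%R.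
  by elim: n => [|n IH]; rewrite ?torus_proj0// !mulrS torus_projD IH.
have H2 : \forall n \near \oo, beta t = theta (torus_proj (n.+1%:R *: f (t / n.+1%:R))%R).
  have : \forall x \near (0 : R)%R, dom c (chi (beta x)).
    by apply: cp; apply: open_nbhs_nbhs; split.
  move=> K; have K' : \forall n \near \oo, dom c (chi (beta (t / n.+1%:R)%R)) := q0 _ K.
  apply: filterS K' => n Hn.
  rewrite -[_%:R *: _]/(_%:R *: _)%R scaler_nat pX.
  have -> : torus_proj (f (t / n.+1%:R)%R) = chi (beta (t / n.+1%:R)%R) by exact: pc.
  by rewrite -bX thetaK// -[(_ / _ *+ _)%R]mulr_natr mulfVK// pnatr_eq0.
have H3 : theta (torus_proj (n.+1%:R *: f (t / n.+1%:R))%R) @[n --> \oo] --> theta (torus_proj (t *: w)%R).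
  have C : {for (t *: w)%R, continuous (fun x => theta (torus_proj x))}.
    apply: (@continuous_comp _ _ _ (@torus_proj R r) theta); last exact: thetaC.
    exact: torus_proj_continuous.
  exact: (cvg_comp _ _ H1 C).
have H4 : theta (torus_proj (n.+1%:R *: f (t / n.+1%:R))%R) @[n --> \oo] --> beta t.
  by apply: cvg_near_cst; apply: filterS H2 => n <-.
exact: (@cvg_unique _ GT2 _ _ _ _ H4 H3).
Unshelve. all: by end_near. Qed.

(** The conjugated curve [beta] is a homomorphism with values in [T], so [torus_curve] applies to
    it. *)
Lemma lie_exp_conj (k : G) (u : 'rV[R]_d) :
  lie_orbit_closure AG c0 u `<=` [set k * x * k^-1 | x in T] ->
  forall t : R, lie_exp AG c0 (t *: u)%R =
    k * theta (torus_proj (t *: Dchi c0 T chi (Ad AG c0 k^-1%g u))%R) * k^-1.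
Proof.
move=> Hk; have [gamma [u' [og vg E]]] := lie_exp_curve u.
have gD := og.2.
pose beta t := k^-1 * gamma t * k.
have bT t : T (beta t).
  have [|x Tx xE] := Hk (gamma t); first by apply: subset_closure; exists t.
  by rewrite /beta -xE !mulgA mulVg mul1g -mulgA mulVg mulg1.
have bD s t : beta (s + t)%R = beta s * beta t.
  by rewrite /beta gD !mulgA -[_ * k * k^-1]mulgA mulgV mulg1.
have c1 : dom c0 (k^-1 * 1 * k) by rewrite mulg1 mulVg.
have [L _ /(_ gamma u' (hom0 gD) vg) vb] := velocity_translate hc0 hc0 c1.
(* [Ad] differentiates [k^-1 * lie_exp (t *: u) * k], which is [beta t]; it therefore gives the
   velocity of [beta] whether or not [u'] equals [u]. *)
have AdE : Ad AG c0 k^-1 u = L u'.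
  case: vb => _ _ [_ <-]; rewrite /Ad; apply: (congr1 (fun f : R -> 'rV[R]_d => 'D_(1 : R)%R f (0 : R)%R)).
  by apply/funext => t /=; rewrite invgK E.
move=> t; rewrite AdE -(torus_curve bD bT (Dchi_velocity bT (hom0 bD) vb)) E.
by rewrite /beta !mulgA mulgV mul1g -mulgA mulgV mulg1.
Qed.

End torus.

End lie.

(** * Transfer to the bundle *)

Lemma borel_measurable_fun d (T : measurableType d) (Y : ptopologicalType) (D : set T)
    (f : T -> Y) : measurable D -> (forall O, open O -> measurable (D `&` f @^-1` O)) ->
  measurable_fun D (f : T -> borel Y).
Proof.
move=> mD H _ B mB; move: B mB; apply: smallest_sub => //.
split => //.
- by rewrite preimage_set0 setI0.
- move=> A mA; rewrite setTD preimage_setC -setDE.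
  suff -> : D `\` f @^-1` A = D `\` (D `&` f @^-1` A) by exact: measurableD.
  by apply/seteqP; split => x [Dx nA]; split => //; [by move=> [_ /nA]|by move=> fx; apply: nA].
- move=> A mA; rewrite preimage_bigcup setI_bigcupr.
  exact: bigcupT_measurable.
Qed.

Lemma borel_measurable_on (X Y : ptopologicalType) (D : set X) (f : X -> Y) : open D ->
  {within D, continuous f} ->
  measurable_fun (D : set (borel X)) (f : borel X -> borel Y).
Proof.
move=> oD; rewrite continuous_open_subspace// => /(continuous_inP _ oD) cf.
apply: borel_measurable_fun => [|O oO]; first exact: sub_sigma_algebra.
by apply: sub_sigma_algebra; exact: cf.
Qed.

Lemma borel_measurable_on_prod (X Y Z : ptopologicalType) (K : nat -> set X)
    (L : nat -> set Y) (D : set (X * Y)) (f : X * Y -> Z) :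
  compact_base K -> compact_base L -> open D -> {within D, continuous f} ->
  measurable_fun (D : set (borel X * borel Y)) (f : borel X * borel Y -> borel Z).
Proof.
move=> KB LB oD; rewrite continuous_open_subspace// => /(continuous_inP _ oD) cf.
apply: borel_measurable_fun => [|O oO]; first exact: (open_measurable_prod KB LB).
by apply: (open_measurable_prod KB LB); exact: cf.
Qed.

Lemma measurable_glue d d' (X : measurableType d) (Y : measurableType d')
    (B : nat -> set X) (idx : X -> nat) (f : nat -> X -> Y) :
  (forall i, measurable (B i)) -> (forall x, B (idx x) x) ->
  (forall i x, B i x -> idx x = i) -> (forall i, measurable_fun (B i) (f i)) ->
  measurable_fun setT (fun x => f (idx x) x).
Proof.
move=> mB Bi iB mf.
have -> : setT = \bigcup_i B i by apply/seteqP; split => // x _; exists (idx x).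
apply/measurable_fun_bigcup => // i; apply: eq_measurable_fun (mf i) => x.
by rewrite inE => /iB ->.
Qed.

Lemma measurable_fun_pair_on d d1 d2 (T : measurableType d) (T1 : measurableType d1)
    (T2 : measurableType d2) (D : set T) (f : T -> T1) (g : T -> T2) : measurable D ->
  measurable_fun D f -> measurable_fun D g -> measurable_fun D (fun x => (f x, g x)).
Proof.
move=> mD mf mg.
have mf' : measurable_fun setT (f \_ D).
  by apply/measurable_restrict => //; rewrite setTI.
have mg' : measurable_fun setT (g \_ D).
  by apply/measurable_restrict => //; rewrite setTI.
apply: (@eq_measurable_fun _ _ _ _ _ (fun x => ((f \_ D) x, (g \_ D) x))).
  by move=> x xD; rewrite /= !patchE xD.
by apply: measurable_funTS; exact: measurable_fun_pair.
Qed.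

(** * Gluing the trivializations along disjoint Borel pieces *)

Section bundle_transfer.
Context (R : realType) (r : nat) (M Omega : ptopologicalType) (G : pTopGroupType).
Context (H : probability (borel G) R) (hH : normalized_haar H).
Context (KM : nat -> set M) (KG : nat -> set G).
Hypotheses (KMB : compact_base KM) (KGB : compact_base KG) (GT2 : hausdorff_space G).
Hypothesis mulc : continuous (fun p : G * G => (p.1 * p.2)%g).
Hypothesis invc : continuous (fun x : G => x^-1%g).
Variable th : 'rV[R]_r -> G.
Hypothesis thD : forall s u, th (s + u) = (th s * th u)%g.
Hypothesis thc : continuous th.
Hypothesis thZ : forall s : 'rV[R]_r, (forall j, exists k : int, s 0 j = k%:~R) -> th s = 1%g.
Context (mu : probability (borel Omega) R) (pi : Omega -> M) (pic : continuous pi).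
Context (D : nat -> set M) (oD : forall i, open (D i)) (covD : forall x, exists i, D i x).
Context (psi : nat -> Omega -> M * G) (psiV : nat -> M * G -> Omega).
Hypothesis hpsi : forall i, homeo_between (pi @^-1` D i) (D i `*` [set: G]) (psi i) (psiV i).
Hypothesis psi1 : forall i o, D i (pi o) -> (psi i o).1 = pi o.
Local Notation bpi := (pi : borel Omega -> borel M).
Hypothesis hmu : forall i (B : set (borel M * borel G)), measurable B ->
  mu (psi i @^-1` B `&` pi @^-1` D i) =
    ((fun C : set (borel M) => pushforward mu bpi (C `&` D i)) \x H)%E B.
Context (k : nat -> M -> G) (w : nat -> M -> 'rV[R]_r).
Hypothesis mk : forall i, measurable_fun (D i : set (borel M)) (k i : borel M -> borel G).
Hypothesis mw : forall i, measurable_fun (D i : set (borel M)) (w i : borel M -> borel 'rV[R]_r).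
Variable g : R -> Omega -> Omega.
Hypothesis gE : forall i t x y, D i x -> D i (pi (g t (psiV i (x, y)))) /\
  psi i (g t (psiV i (x, y))) = (x, (k i x * th (t *: w i x) * (k i x)^-1 * y)%g).

Let mD i : measurable (D i : set (borel M)). Proof. exact: sub_sigma_algebra. Qed.

(** Each point of [M] gets one chart, so that the data [k i] and [w i] of different charts glue to
    measurable maps. *)
Definition piece i : set (borel M) := seqDU (D : nat -> set (borel M)) i.

Lemma measurable_piece i : measurable (piece i).
Proof. by apply: measurableD => //; exact: bigsetU_measurable. Qed.

Lemma piece_sub i : piece i `<=` D i. Proof. by move=> x []. Qed.

Lemma piece_cover x : exists i, piece i x.
Proof.
have : (\bigcup_i (D i : set (borel M))) x by have [i Dx] := covD x; exists i.
by rewrite seqDU_bigcup_eq => -[i _ Hi]; exists i.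
Qed.

Definition piece_index x : nat := projT1 (cid (piece_cover x)).

Lemma piece_indexP x : piece (piece_index x) x.
Proof. exact: projT2 (cid (piece_cover x)). Qed.

Lemma piece_indexE i x : piece i x -> piece_index x = i.
Proof.
move=> ix; apply: (@trivIset_seqDU _ (D : nat -> set (borel M))) => //.
by exists x; split => //; exact: piece_indexP.
Qed.

Let idxD x : D (piece_index x) x. Proof. by apply: piece_sub; exact: piece_indexP. Qed.

Definition fiber_angle (x : borel M) : 'rV[R]_r := w (piece_index x) x.

Lemma measurable_fiber_angle : measurable_fun setT (fiber_angle : borel M -> borel 'rV[R]_r).
Proof.
apply: (@measurable_glue _ _ _ _ piece piece_index (fun i => w i : borel M -> borel 'rV[R]_r)).
- exact: measurable_piece.
- exact: piece_indexP.
- exact: piece_indexE.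
- by move=> i; apply: measurable_funS; [exact: (mD i)|exact: piece_sub|exact: mw].
Qed.

(** The factor [k] turns the translation by [k th k^-1] into the one by [th]; being a left
    translation, it preserves Haar measure in each fibre. *)
Definition to_bundle (p : borel M * borel G) : borel Omega :=
  psiV (piece_index p.1) (p.1, (k (piece_index p.1) p.1 * p.2)%g).

Definition from_bundle (o : borel Omega) : borel M * borel G :=
  (pi o, ((k (piece_index (pi o)) (pi o))^-1 * (psi (piece_index (pi o)) o).2)%g).

Lemma from_bundleK : cancel from_bundle to_bundle.
Proof.
move=> o; rewrite /to_bundle /from_bundle /=.
have Di := idxD (pi o).
have [[_ _ h3 _] _] := hpsi (piece_index (pi o)).
by have := surjective_pairing (psi (piece_index (pi o)) o); rewrite psi1// mulgA mulgV mul1g => <-; rewrite h3.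
Qed.

Lemma to_bundle_flow t p : g t (to_bundle p) = to_bundle (torus_flow th fiber_angle t p).
Proof.
case: p => x y; rewrite /to_bundle /torus_flow /= /fiber_angle.
have [[_ _ h3 _] _] := hpsi (piece_index x).
have [h1 h2] := gE t (k (piece_index x) x * y)%g (idxD x).
by rewrite -(h3 _ h1) h2 -!mulgA mulKg.
Qed.

Lemma measurable_from_bundle : measurable_fun setT from_bundle.
Proof.
have mpi := borel_measurable pic.
apply/measurable_fun_pairP; split => //.
pose B i : set (borel Omega) := bpi @^-1` (piece i).
have mB i : measurable (B i) by rewrite -[X in measurable X]setTI; apply: mpi => //; exact: measurable_piece.
apply: (@measurable_glue _ _ _ _ B (fun o => piece_index (pi o))
  (fun i o => ((k i (pi o))^-1 * (psi i o).2)%g : borel G)) => //.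
- by move=> o; exact: piece_indexP.
- by move=> i o; exact: piece_indexE.
move=> i; have m1 : measurable_fun (B i) ((fun o => (k i (pi o))^-1%g) : borel Omega -> borel G).
  apply: (measurableT_comp (borel_measurable invc)).
  apply: (@measurable_comp _ _ _ _ _ _ (D i : set (borel M)) (k i : borel M -> borel G) (B i) bpi (mD i) _ (@mk i)).
    by move=> _ [z /piece_sub Dz <-].
  exact: measurable_funTS.
have m2 : measurable_fun (B i) ((fun o => (psi i o).2) : borel Omega -> borel G).
  have [_ [cpsi _]] := hpsi i.
  have oP : open (pi @^-1` D i) by apply: open_comp => // o _; exact: pic.
  apply: (@measurable_funS _ _ _ _ (pi @^-1` D i : set (borel Omega))).
  - exact: sub_sigma_algebra.
  - by move=> o /piece_sub.
  apply: borel_measurable_on => //.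
  rewrite continuous_open_subspace// in cpsi; rewrite continuous_open_subspace// => o /cpsi co.
  exact: (continuous_comp co cvg_snd).
have m12 : measurable_fun (B i) ((fun o => ((k i (pi o))^-1%g, (psi i o).2)) : borel Omega -> borel G * borel G).
  exact: measurable_fun_pair_on.
exact: (measurableT_comp (measurable_mulg KGB mulc) m12).
Qed.

Let measurable_psiV i :
  measurable_fun (D i `*` setT : set (borel M * borel G)) (psiV i : borel M * borel G -> borel Omega).
Proof.
have [_ [_ cpsi]] := hpsi i.
apply: (borel_measurable_on_prod KMB KGB) => //.
rewrite openE => -[x y] [/= Dx _]; exists (D i, setT) => /=; last by move=> [a b] [].
by split; [apply: open_nbhs_nbhs|exact: filterT].
Qed.

Lemma measurable_to_bundle : measurable_fun setT to_bundle.
Proof.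
pose B i : set (borel M * borel G) := piece i `*` setT.
have mB i : measurable (B i) by apply: measurableX => //; exact: measurable_piece.
apply: (@measurable_glue _ _ _ _ B (fun p => piece_index p.1)
  (fun i p => psiV i (p.1, (k i p.1 * p.2)%g) : borel Omega)) => //.
- by move=> p; split => //; exact: piece_indexP.
- by move=> i p [/piece_indexE].
move=> i.
have m1 : measurable_fun (B i) ((fun p => k i p.1) : borel M * borel G -> borel G).
  apply: (@measurable_comp _ _ _ _ _ _ (D i : set (borel M)) (k i : borel M -> borel G) (B i) fst (mD i) _ (@mk i)).
    by move=> _ [p [/piece_sub Dp _] <-].
  by apply: measurable_funTS; exact: measurable_fst.
have m2 : measurable_fun (B i) ((fun p => (k i p.1, p.2)) : borel M * borel G -> borel G * borel G).
  by apply: measurable_fun_pair_on => //; apply: measurable_funTS; exact: measurable_snd.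
have m3 := measurableT_comp (measurable_mulg KGB mulc) m2.
have m4 : measurable_fun (B i) ((fun p => (p.1, (k i p.1 * p.2)%g)) : borel M * borel G -> borel M * borel G).
  by apply: measurable_fun_pair_on => //; apply: measurable_funTS; exact: measurable_fst.
apply: (@measurable_comp _ _ _ _ _ _ (D i `*` setT : set (borel M * borel G)) (psiV i : borel M * borel G -> borel Omega) (B i) (fun p => (p.1, (k i p.1 * p.2)%g)) _ _ (@measurable_psiV i) m4).
  by apply: measurableX.
by move=> _ [p [/piece_sub Dp _] <-].
Qed.

Context (m : probability (borel M) R).
Hypothesis mE : forall B, m B = mu (pi @^-1` B).

(** Over one piece [hmu] gives a product measure, and [to_bundle] differs from [psiV i] by a left
    translation in each fibre, under which [H] is invariant. The pieces are then summed. *)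
Lemma to_bundle_measure A : measurable A -> mu A = (m \x H)%E (to_bundle @^-1` A).
Proof.
move=> mA; have mpi := borel_measurable pic.
have mLA : measurable (to_bundle @^-1` A).
  by rewrite -[X in measurable X]setTI; exact: measurable_to_bundle.
pose B i : set (borel Omega) := bpi @^-1` (piece i).
have mB i : measurable (B i) by rewrite -[X in measurable X]setTI; apply: mpi => //; exact: measurable_piece.
pose C i : set (borel M * borel G) := piece i `*` setT.
have mC i : measurable (C i) by apply: measurableX => //; exact: measurable_piece.
have AE : A = \bigcup_i (A `&` B i).
  by rewrite -setI_bigcupr; apply/seteqP; split => o // => [Ao|[]//]; split => //; exists (piece_index (pi o)) => //; exact: piece_indexP.
have LE : to_bundle @^-1` A = \bigcup_i (to_bundle @^-1` A `&` C i).
  by rewrite -setI_bigcupr; apply/seteqP; split => p // => [Ap|[]//]; split => //; exists (piece_index p.1) => //; split => //; exact: piece_indexP.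
have tB : trivIset setT (fun i => A `&` B i).
  by apply/trivIsetP => i j _ _ ij; apply/seteqP; split => o // [[_ /piece_indexE h1] [_ /piece_indexE]]; rewrite h1 => /eqP; rewrite (negbTE ij).
have tC : trivIset setT (fun i => to_bundle @^-1` A `&` C i).
  by apply/trivIsetP => i j _ _ ij; apply/seteqP; split => o // [[_ [/piece_indexE h1 _]] [_ [/piece_indexE + _]]]; rewrite h1 => /eqP; rewrite (negbTE ij).
have mAB i : measurable (A `&` B i) by exact: measurableI.
have mLC i : measurable (to_bundle @^-1` A `&` C i) by exact: measurableI.
rewrite {1}AE {1}LE measure_bigcup//.
etransitivity; last first.
  by apply/esym; apply: (@measure_bigcup _ _ _ (m \x H)%E setT (fun i => to_bundle @^-1` A `&` C i)).
apply: eq_eseriesr => i _.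
(* The part of [A] over the piece, read in the trivialization [psi i]. *)
pose Ci : set (borel M * borel G) := C i `&` ((D i `*` setT) `&` psiV i @^-1` A).
have mCi : measurable Ci.
  apply: measurableI => //; apply: (@measurable_psiV i) => //.
  exact: measurableX.
have [[h1 _ h3 h4] _] := hpsi i.
transitivity (mu (psi i @^-1` Ci `&` pi @^-1` D i)).
  congr (mu _); apply/seteqP; split => o.
    move=> [Ao Bo]; have Do : D i (pi o) by exact: piece_sub.
    split => //; split; first by split => //; rewrite /= psi1.
    by split; [exact: h1|rewrite /preimage/= h3].
  move=> [[[+ _] [_ +]] Do]; rewrite /preimage /= psi1// h3//.
rewrite hmu//.
rewrite /product_measure1.
pose mr := mrestr m (mD i).
have -> : (fun C : set (borel M) => pushforward mu bpi (C `&` D i)) = mr.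
  by apply/funext => E; rewrite /mr /mrestr mE.
have loc (S : set (borel M * borel G)) (mm : {measure set (borel M) -> \bar R}) : S `<=` C i ->
   (\int[mm]_x H (xsection S x) = \int[mm]_(x in piece i) H (xsection S x))%E.
  move=> SC; rewrite [RHS]integral_mkcond; apply: eq_integral => x _; rewrite patchE.
  case: ifPn => // xi; suff -> : xsection S x = set0 by rewrite measure0.
  apply/seteqP; split => y //; rewrite /xsection /= inE => /SC[/= xi' _].
  by move: xi; rewrite notin_setE.
transitivity (\int[m]_(x in piece i) H (xsection Ci x))%E.
  rewrite loc; last by move=> p [].
  apply: eq_measure_integral => E mEE Esub; rewrite -[LHS]/(m (E `&` D i)) setIidl//.
  by move=> x /Esub /piece_sub.
transitivity (\int[m]_(x in piece i) H (xsection (to_bundle @^-1` A `&` C i) x))%E; last first.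
  by rewrite -loc//; move=> p [].
apply: eq_integral => x; rewrite inE => xi.
have Dx := piece_sub xi.
rewrite -[LHS](haar_preimage hH (k i x)); last exact: measurable_xsection.
congr (H _); apply/seteqP; split => y; rewrite /xsection /= !inE.
  by move=> [_ [_ HA]]; split => //; rewrite /to_bundle /preimage /= (piece_indexE xi).
by move=> [HA _]; split => //; split => //; move: HA; rewrite /to_bundle /preimage /= (piece_indexE xi).
Qed.

Hypothesis mix : forall (xi : 'rV[int]_r) (al : R) (B : set (borel M)), measurable B ->
  cvg (oscint m (fun x => dotZ xi (fiber_angle x)) al t B @[t --> +oo]).

(** [g t] is [torus_flow] read through [to_bundle], and [mu] is the image of [m \x H], so its
    correlations are those of [torus_flow_mixing]. *)
Lemma bundle_flow_shear : is_flow g -> keplerian_shear mu g.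
Proof.
move=> gf.
have gF t : g t = to_bundle \o torus_flow th fiber_angle t \o from_bundle.
  by apply/funext => o /=; rewrite -to_bundle_flow from_bundleK.
have mtf t := measurable_torus_flow KGB mulc thc measurable_fiber_angle t.
have mL A : measurable A -> measurable (to_bundle @^-1` A).
  by move=> mA; rewrite -[X in measurable X]setTI; exact: measurable_to_bundle.
have mg t : measurable_fun setT (g t : borel Omega -> borel Omega).
  rewrite gF; apply: measurableT_comp; last exact: measurable_from_bundle.
  by apply: measurableT_comp => //; exact: measurable_to_bundle.
have gI t A : to_bundle @^-1` (g t @^-1` A) = torus_flow th fiber_angle t @^-1` (to_bundle @^-1` A).
  by apply/seteqP; split => p /=; rewrite to_bundle_flow.
have mgA t (A : set (borel Omega)) : measurable A -> measurable (g t @^-1` A : set (borel Omega)).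
  by move=> mA; rewrite -[X in measurable X]setTI; exact: mg.
apply: (@cvg_corr_shear _ _ mu g) => // [t B mB|A B mA mB].
  rewrite to_bundle_measure; last exact: mgA.
  by rewrite gI (torus_flow_pres hH)//; [rewrite -to_bundle_measure|exact: mL].
have E t : fine (mu (g t @^-1` A `&` B)) = fine ((m \x H)%E (torus_flow th fiber_angle t @^-1` (to_bundle @^-1` A) `&` (to_bundle @^-1` B))).
  rewrite to_bundle_measure; last by apply: measurableI => //; exact: mgA.
  by rewrite preimage_setI gI.
under eq_fun do rewrite E.
by apply: (torus_flow_mixing hH KGB GT2 mulc thD thc thZ measurable_fiber_angle mix); exact: mL.
Qed.

End bundle_transfer.

(** Finitely many sets carry all but a tail of small measure, and [osc] is bounded by 1. This
    assembles the contributions of the charts. *)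
Lemma oscint_cvg_bigcup d (T : measurableType d) (R : realType)
    (m : {finite_measure set T -> \bar R}) (phi : T -> R) (al : R) (B : nat -> set T) :
  measurable_fun setT phi -> (forall i, measurable (B i)) -> trivIset setT B ->
  (forall i, cvg (oscint m phi al t (B i) @[t --> +oo])) ->
  cvg (oscint m phi al t (\bigcup_i B i) @[t --> +oo]).
Proof.
move=> mphi mB tB cB.
have moo (E : set T) : measurable E -> (m E < +oo)%E.
  by move=> mE; rewrite ltey_eq fin_num_measure.
pose S N := \big[setU/set0]_(i < N) B i.
have mS N : measurable (S N) by exact: bigsetU_measurable.
have mU : measurable (\bigcup_i B i) by exact: bigcupT_measurable.
have cS N : cvg (oscint m phi al t (S N) @[t --> +oo]).
  elim: N => [|N IH].
    have -> : (fun t => oscint m phi al t (S 0%N)) = (fun=> 0).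
      by apply/funext => t; rewrite /oscint /S big_ord0 Rintegral_set0.
    exact: is_cvg_cst.
  have -> : (fun t => oscint m phi al t (S N.+1)) =
            (fun t => oscint m phi al t (S N) + oscint m phi al t (B N)).
    apply/funext => t; have -> : S N.+1 = S N `|` B N by rewrite /S big_ord_recr.
    rewrite (oscintU mphi)//.
    - by apply: moo; exact: measurableU.
    apply/seteqP; split => x // [+ BN]; rewrite /S -bigcup_mkord => -[i /= iN Bi].
    have : i = N by apply: tB => //; exists x.
    by move=> E; move: iN; rewrite E ltnn.
  exact: is_cvgD.
apply: cvg_approx => e e0.
pose D N := \bigcup_i B i `\` S N.
have mD N : measurable (D N) by exact: measurableD.
have cD : m (D N) @[N --> \oo] --> 0%E.
  have -> : 0%E = m (\bigcap_N D N).
    suff -> : \bigcap_N D N = set0 by rewrite measure0.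
    apply/seteqP; split => x // H; have [[i _ Bi] _] := H 0%N I.
    have [_] := H i.+1 I; apply; rewrite /S -bigcup_mkord.
    by exists i => //=.
  apply: nonincreasing_cvg_mu => //.
  - exact: moo.
  - exact: bigcapT_measurable.
  move=> i j ij; apply/subsetPset => x [Ux Sx]; split => // Sx'; apply: Sx.
  move: Sx'; rewrite /S -!bigcup_mkord => -[k /= ki Bk]; exists k => //=.
  exact: leq_trans ij.
have [N HN] : exists N, fine (m (D N)) <= e.
  have fD : fine (m (D N)) @[N --> \oo] --> (0 : R) by exact: (fine_cvg cD).
  move/cvgrPdist_le : fD => /(_ e e0)[N _ HN]; exists N; have := HN N (leqnn N).
  by rewrite sub0r normrN; exact: le_trans (ler_norm _).
exists (fun t => oscint m phi al t (S N)); split => //; apply: nearW => t.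
have UE : \bigcup_i B i = S N `|` D N.
  rewrite /D setDUK// => x; rewrite /S -bigcup_mkord => -[i _ Bi]; by exists i.
have -> : oscint m phi al t (\bigcup_i B i) = oscint m phi al t (S N) + oscint m phi al t (D N).
  rewrite {1}UE (oscintU mphi)//.
  - by apply: moo; exact: measurableU.
  by apply/seteqP; split => x // [Sx [_ /(_ Sx)]].
rewrite addrAC subrr add0r; apply: le_trans HN; apply: (oscint_le mphi) => //; exact: moo.
Qed.

Lemma open_measurable_real (R : realType) (X : ptopologicalType) (D : set X) (f : X -> R) :
  open D -> (forall x, D x -> {for x, continuous f}) ->
  measurable_fun (D : set (borel X)) (f : borel X -> R).
Proof.
move=> oD cf; apply: (measurability _ (RGenOInfty.measurableE R)).
move=> _ [_ [x ->] <-]; apply: sub_sigma_algebra.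
have /(continuous_inP _ oD) : {in D, continuous f} by move=> y /[!inE]; exact: cf.
by apply; exact: interval_open.
Qed.

(** * Oscillating integrals in one chart *)

Section chart_oscint.
Context (R : realType) (n : nat) (lam : {measure set (borel 'rV[R]_n) -> \bar R}).
Hypothesis hlam : is_lebesgue lam.
Context (M : ptopologicalType) (U : chart M 'rV[R]_n) (cU : is_chart U).
Context (m : probability (borel M) R).
Local Notation V := 'rV[R]_n.

Let oD : open (dom U). Proof. by case: cU. Qed.
Let oO : open (crd U @` dom U). Proof. by case: cU. Qed.
Let parK x : dom U x -> par U (crd U x) = x. Proof. by case: cU => _ _ [[_ _ H _] _]; exact: H. Qed.
Let mD : measurable (dom U : set (borel M)). Proof. exact: sub_sigma_algebra. Qed.

Let ccrd x : dom U x -> {for x, continuous (crd U)}.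
Proof.
case: cU => _ _ [_ [+ _]]; rewrite continuous_open_subspace// => H Dx; apply: H.
by rewrite inE.
Qed.

Let measurable_chart_preimage (B : set (borel V)) : measurable B ->
  measurable (crd U @^-1` B `&` dom U : set (borel M)).
Proof.
move=> mB; rewrite setIC; apply: borel_measurable_on => //.
by case: cU => _ _ [_ []].
Qed.

(** Made into a finite measure on [R^n], in order to take the place of [nu] in
    [riemann_lebesgue]. *)
Definition chart_image (B : set (borel V)) : \bar R := m (crd U @^-1` B `&` dom U).

Let chart_image0 : chart_image set0 = 0%E.
Proof. by rewrite /chart_image preimage_set0 set0I measure0. Qed.

Let chart_image_ge0 B : (0 <= chart_image B)%E. Proof. exact: measure_ge0. Qed.

Let chart_image_sigma_additive : semi_sigma_additive chart_image.
Proof.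
move=> F mF tF mUF; rewrite /chart_image preimage_bigcup setI_bigcupl.
apply: measure_semi_sigma_additive.
- by move=> i; exact: measurable_chart_preimage.
- apply/trivIsetP => i j _ _ ij; apply/seteqP; split => x // [[Fi _] [Fj _]].
  by move/trivIsetP : tF => /(_ i j I I ij) /seteqP[/(_ (crd U x)) + _]; apply.
- by apply: bigcupT_measurable => i; exact: measurable_chart_preimage.
Qed.

HB.instance Definition _ := isMeasure.Build _ _ _ chart_image
  chart_image0 chart_image_ge0 chart_image_sigma_additive.

Let chart_image_fin : fin_num_fun chart_image.
Proof. by move=> B mB; apply: fin_num_measure; exact: measurable_chart_preimage. Qed.

HB.instance Definition _ := Measure_isFinite.Build _ _ _ chart_image chart_image_fin.

Hypothesis mU : forall B : set (borel V), measurable B -> lam B = 0%E ->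
  m (crd U @^-1` B `&` dom U) = 0%E.

Context (phi : M -> R) (dphi : Cdiff 1 (crd U @` dom U) (phi \o par U)).

Definition critical : set (borel M) :=
  [set x | dom U x /\ forall y : V, 'd (phi \o par U) (crd U x) y = 0].

(** A differential vanishes when it does so on the standard basis, and its values there depend
    continuously on the point of the chart. *)
Lemma measurable_critical : measurable critical.
Proof.
pose gj (j : 'I_n) (x : M) := 'd (phi \o par U) (crd U x) (delta_mx 0 j).
have mg j : measurable_fun (dom U : set (borel M)) (gj j : borel M -> R).
  apply: open_measurable_real => // x Dx; apply: (@continuous_comp _ _ _ (crd U) (fun z => 'd (phi \o par U) z (delta_mx 0 j)) x (ccrd Dx)).
  by apply: dphi.2; exists x.
have -> : critical = \bigcap_(j in [set: 'I_n]) (dom U `&` gj j @^-1` [set 0]) `&` dom U.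
  apply/seteqP; split => x.
    by move=> [Dx H]; split => // j _; split => //; exact: H.
  move=> [H Dx]; split => // y; rewrite (row_sum_delta y) linear_sum big1// => j _.
  have E : gj j x = 0 by have [] := H j I.
  by rewrite linearZ; change (y 0 j *: gj j x = 0); rewrite E scaler0.
apply: measurableI => //; apply: fin_bigcap_measurable => // j _.
exact: mg.
Qed.

(** The critical part of [B] is null and is dropped. The rest is carried to [R^n], where the phase
    has a strict direction at each remaining point. *)
Lemma chart_oscint_cvg0 (al : R) (B : set (borel M)) : measurable B -> B `<=` dom U ->
  m (B `&` critical) = 0%E -> measurable_fun setT (phi : borel M -> R) ->
  oscint m (phi : borel M -> R) al t B @[t --> +oo] --> (0 : R).
Proof.
move=> mB BU Bc mphi; have mC := measurable_critical.
have moo (E : set (borel M)) : measurable E -> (m E < +oo)%E.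
  by move=> mE; rewrite ltey_eq fin_num_measure.
pose B1 := B `\` critical.
have mB1 : measurable B1 by exact: measurableD.
have mBC : measurable (B `&` critical) by exact: measurableI.
pose O := crd U @` dom U.
have mO : measurable (O : set (borel V)) by exact: sub_sigma_algebra.
have mpar : measurable_fun (O : set (borel V)) (par U : borel V -> borel M).
  by apply: borel_measurable_on => //; case: cU => _ _ [_ []].
pose E' : set (borel V) := O `&` par U @^-1` B1.
have mE' : measurable E' by exact: mpar.
(* Extended by zero outside the open set [O], to be measurable on the whole space. *)
pose phi' : borel V -> R := (phi \o par U) \_ O.
have mphi' : measurable_fun setT phi'.
  apply/measurable_restrict => //; rewrite setTI.
  by apply: (@measurableT_comp _ _ _ _ _ _ (phi : borel M -> R)).
have RL := @riemann_lebesgue R n lam hlam chart_image mU phi' al E' mphi' mE'.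
have st x : E' x -> strict_dir (phi' : V -> R) x.
  move=> [[z Dz <-] [_ nc]].
  have [y Hy] : exists y : V, 'd (phi \o par U) (crd U z) y != 0.
    apply: contrapT => H; apply: nc; rewrite parK//; split => // y.
    by apply: contrapT => /eqP Hy; apply: H; exists y.
  apply: (@C1_strict_dir R V O (phi \o par U) _ _ y) => //; first by exists z.
  by move=> y' Oy'; rewrite /phi' patchE mem_set.
move: (RL st); apply: cvg_trans; apply: near_eq_cvg; apply: nearW => t.
have -> : oscint m (phi : borel M -> R) al t B = oscint m (phi : borel M -> R) al t B1.
  have {1}-> : B = (B `&` critical) `|` B1 by rewrite setUIDK.
  rewrite (oscintU mphi)//.
  - have h0 : fine (m (B `&` critical)) = 0 by rewrite Bc.
    have h : `|oscint m (phi : borel M -> R) al t (B `&` critical)| <= 0.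
      by rewrite -[leRHS]h0; apply: (oscint_le mphi) => //; exact: moo.
    by move: h; rewrite normr_le0 => /eqP ->; rewrite add0r.
  - by apply: moo; exact: measurableU.
  - by apply/seteqP; split => x // [[_ cx] [_ /(_ cx)]].
(* The coordinate map is extended by zero as well; [mr] gives no mass to the complement of
   [dom U]. *)
pose c' : borel M -> borel V := (crd U : borel M -> borel V) \_ (dom U).
have mc' : measurable_fun setT c'.
  apply/measurable_restrict => //; rewrite setTI.
  by apply: borel_measurable_on => //; case: cU => _ _ [_ []].
pose mr := mrestr m mD.
have c'E x : dom U x -> c' x = crd U x by move=> Dx; rewrite /c' patchE mem_set.
have pc' (A : set (borel V)) : measurable A -> mr (c' @^-1` A) = chart_image A.
  move=> mA; rewrite /chart_image -[LHS]/(m (c' @^-1` A `&` dom U)); congr (m _).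
  by apply/seteqP; split => x [Ax Dx]; split => //; move: Ax; rewrite /preimage /= c'E.
pose f : borel V -> R := osc phi' al t \_ E'.
have if_ : (chart_image : {measure set _ -> \bar R}).-integrable setT (EFin \o f).
  have := iffLR (integrable_mkcond _ mE') (@osc_integrable _ _ _ chart_image _ mphi' al t E' mE' _).
  rewrite /f restrict_EFin; apply.
  by rewrite ltey_eq fin_num_measure.
rewrite /oscint [LHS]Rintegral_mkcond -[LHS](@mp_integral _ _ _ _ _ mr chart_image c' mc' pc' f if_).
have ifc := @mp_integrable _ _ _ _ _ mr chart_image c' mc' pc' f if_.
have mDC : measurable (~` dom U : set (borel M)) by exact: measurableC.
rewrite /Rintegral; congr fine.
rewrite (negligible_integral mDC)//; last by rewrite -[LHS]/(m (~` dom U `&` dom U)) setICl measure0.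
rewrite setTD setCK; transitivity (\int[m]_(x in dom U) (f (c' x))%:E)%E.
  apply: eq_measure_integral => A mA AD.
  have E : m (A `&` dom U) = m A by rewrite setIidl.
  exact: E.
rewrite [LHS]integral_mkcond [RHS]integral_mkcond; apply: eq_integral => x _.
rewrite !patchE; have [xD|xD] := boolP (x \in dom U); last first.
  case: ifPn => // xB; move: xD; rewrite notin_setE; case: (set_mem xB) => /BU xD _.
  by [].
have Dx := set_mem xD; rewrite /= /f c'E// patchE.
have -> : (crd U x \in E') = (x \in B1).
  apply/idP/idP => /set_mem; first by move=> [_]; rewrite /preimage /= parK// => /mem_set.
  by move=> Bx; apply/mem_set; split; [exists x|rewrite /preimage /= parK].
have xO : crd U x \in O by apply/mem_set; exists x.
by case: ifP => // _; rewrite /osc /phi' patchE xO /= parK.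
Qed.

End chart_oscint.

Section dotZ.
Context (R : realType) (r : nat) (xi : 'rV[int]_r).

Lemma dotZ_is_linear : linear (@dotZ R r xi).
Proof.
move=> a x y; rewrite /dotZ scaler_sumr -big_split /=; apply: eq_bigr => i _.
by rewrite !mxE mulrDr mulrCA.
Qed.

HB.instance Definition _ := GRing.isLinear.Build R 'rV[R]_r R _ (@dotZ R r xi) dotZ_is_linear.

Lemma dotZ_continuous : continuous (@dotZ R r xi).
Proof.
move=> x; rewrite /dotZ; elim: (index_enum _) => [|i s IH].
  have -> : (fun w : 'rV[R]_r => \sum_(i <- [::]) (xi 0 i)%:~R * w 0 i) = (fun=> 0 : R).
    by apply/funext => y; rewrite big_nil.
  exact: cst_continuous.
have -> : (fun w : 'rV[R]_r => \sum_(j <- i :: s) (xi 0 j)%:~R * w 0 j) =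
    (fun w => (xi 0 i)%:~R * w 0 i + \sum_(j <- s) (xi 0 j)%:~R * w 0 j).
  by apply/funext => y; rewrite big_cons.
have c : {for x, continuous (fun w : 'rV[R]_r => (xi 0 i)%:~R * w 0 i : R)}.
  apply: (@continuous_comp _ _ _ (fun w : 'rV[R]_r => w 0 i : R) (fun u : R => (xi 0 i)%:~R * u)).
    exact: coord_continuous.
  exact: mulrl_continuous.
exact: (continuousD c IH).
Qed.

Lemma Cdiff1_dotZ (V : normedModType R) (O : set V) (f : V -> 'rV[R]_r) : open O ->
  Cdiff 1 O f -> Cdiff 1 O (fun z => dotZ xi (f z)).
Proof.
move=> oO [df cf].
have H z : O z -> is_diff z (fun z => dotZ xi (f z)) (dotZ xi \o 'd f z).
  move=> Oz; apply: is_diff_comp; first exact: differentiableP (df z Oz).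
  apply: DiffDef; first exact/linear_differentiable/dotZ_continuous.
  exact/diff_lin/dotZ_continuous.
split=> [z Oz|y]; first by case: (H z Oz).
apply: (@Cdiff_ext _ _ _ 0 _ (fun z => dotZ xi ('d f z y))) => //.
  by move=> z Oz; case: (H z Oz) => _ ->.
move=> z Oz; apply: (@continuous_comp _ _ _ (fun z => 'd f z y) (dotZ xi)).
  exact: cf.
exact: dotZ_continuous.
Qed.

End dotZ.

Lemma chart_continuous (R : realType) (X : topologicalType) (E : normedModType R) (Y : topologicalType)
    (c : chart X E) (f : X -> Y) : is_chart c ->
  (forall z, (crd c @` dom c) z -> {for z, continuous (f \o par c)}) ->
  forall x, dom c x -> {for x, continuous f}.
Proof.
move=> [oD _ [[_ _ pc _] [cc _]]] cf x Dx.
have ccx : {for x, continuous (crd c)}.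
  by rewrite continuous_open_subspace// in cc; apply: cc; rewrite inE.
have := continuous_comp ccx (cf _ (ex_intro2 _ _ x Dx erefl)).
rewrite /prop_for /continuous_at /= pc//; apply: cvg_trans; apply: near_eq_cvg.
have : \forall y \near x, dom c y by apply: open_nbhs_nbhs; split.
by apply: filterS => y Dy; rewrite /= pc.
Qed.

(** * Convergence over one chart, for every frequency *)

Section chart_mixing.
Context (R : realType) (n r : nat) (lam : {measure set (borel 'rV[R]_n) -> \bar R}).
Hypothesis hlam : is_lebesgue lam.
Context (M : ptopologicalType) (U : chart M 'rV[R]_n) (cU : is_chart U).
Context (m : probability (borel M) R).
Hypothesis mU : forall B : set (borel 'rV[R]_n), measurable B -> lam B = 0%E ->
  m (crd U @^-1` B `&` dom U) = 0%E.
Context (w : M -> 'rV[R]_r) (cw : Cdiff 1 (crd U @` dom U) (w \o par U)).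
Hypothesis null : m (\bigcup_(xi in [set xi : 'rV[int]_r | xi != 0])
  ([set x | dom U x /\
      forall y : 'rV[R]_n, 'd (fun z => dotZ xi (w (par U z))) (crd U x) y = 0]
   `\` [set x | dom U x /\ dotZ xi (w x) = 0])) = 0%E.

(** Where the phase vanishes the integral is constant in [t]. Elsewhere the critical points are null
    by [null], and [chart_oscint_cvg0] gives the limit 0. For [xi = 0] the phase vanishes
    identically. *)
Lemma chart_mixing (xi : 'rV[int]_r) (al : R) (C : set (borel M)) :
  measurable C -> C `<=` dom U ->
  cvg (oscint m (fun x => dotZ xi (w x)) al t C @[t --> +oo]).
Proof.
move=> mC CU.
have oD : open (dom U) by case: cU.
have oO : open (crd U @` dom U) by case: cU.
have mD : measurable (dom U : set (borel M)) by exact: sub_sigma_algebra.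
have pK x : dom U x -> par U (crd U x) = x by case: cU => _ _ [[_ _ H _] _]; exact: H.
have moo (E : set (borel M)) : measurable E -> (m E < +oo)%E.
  by move=> mE; rewrite ltey_eq fin_num_measure.
have [->|xi0] := eqVneq xi 0.
  have -> : (fun t => oscint m (fun x => dotZ 0 (w x)) al t C) =
      (fun=> oscint m (fun=> 0) al 0 C).
    apply/funext => t; rewrite /oscint; apply: eq_Rintegral => x _.
    rewrite /osc /dotZ big1 ?mulr0// => i _.
    by rewrite mxE mul0r.
  exact: is_cvg_cst.
(* Cut off outside the chart, as [w] is only controlled on [dom U]. *)
pose phi (eta : 'rV[int]_r) : M -> R := (fun x => dotZ eta (w x)) \_ (dom U).
have phiE eta x : dom U x -> phi eta x = dotZ eta (w x) by move=> Dx; rewrite /phi patchE mem_set.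
have dphi eta : Cdiff 1 (crd U @` dom U) (fun z => dotZ eta (w (par U z))).
  exact: (Cdiff1_dotZ eta oO cw).
have dphi' eta : Cdiff 1 (crd U @` dom U) (phi eta \o par U).
  by apply: Cdiff_ext oO _ (dphi eta) => _ [x Dx <-] /=; rewrite phiE pK.
have critE eta : critical U (phi eta) = [set x | dom U x /\
    forall y : 'rV[R]_n, 'd (fun z => dotZ eta (w (par U z))) (crd U x) y = 0].
  have E x : dom U x -> 'd (phi eta \o par U) (crd U x) = 'd (fun z => dotZ eta (w (par U z))) (crd U x) :> (_ -> _).
    move=> Dx; have Ox : (crd U @` dom U) (crd U x) by exists x.
    have nO : nbhs (crd U x) (crd U @` dom U) by exact: open_nbhs_nbhs.
    apply: (near_diff _ ((dphi eta).1 _ Ox)).2; apply: filterS nO => _ [z Dz <-].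
    by rewrite /= phiE pK.
  apply/seteqP; split => x [Dx H]; split => // y; first by rewrite -E.
  by rewrite E.
have mphi eta : measurable_fun setT (phi eta : borel M -> R).
  apply/measurable_restrict => //; rewrite setTI.
  apply: open_measurable_real => //; apply: (chart_continuous cU) => z Oz.
  exact: (differentiable_continuous ((dphi eta).1 z Oz)).
pose Z eta : set (borel M) := phi eta @^-1` [set 0].
have mZ eta : measurable (Z eta).
  by rewrite -[X in measurable X]setTI; exact: mphi.
have -> : (fun t => oscint m (fun x => dotZ xi (w x)) al t C) =
    (fun t => oscint m (phi xi : borel M -> R) al t (C `&` Z xi) +
              oscint m (phi xi : borel M -> R) al t (C `\` Z xi)).
  apply/funext => t.
  have mCZ : measurable (C `&` Z xi) by exact: measurableI.
  have mCD : measurable (C `\` Z xi) by exact: measurableD.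
  rewrite -(oscintU (mphi xi))//.
  - rewrite setUIDK; apply: eq_Rintegral => x xC.
    by rewrite /osc phiE//; apply: CU; exact: set_mem.
  - by apply: moo; exact: measurableU.
  - by apply/seteqP; split => x // [[_ cx] [_ /(_ cx)]].
apply: is_cvgD.
  have -> : (fun t => oscint m (phi xi : borel M -> R) al t (C `&` Z xi)) =
      (fun=> oscint m (fun=> 0) al 0 (C `&` Z xi)).
    apply/funext => t; apply: eq_Rintegral => x xC.
    by have [_ zx] := set_mem xC; rewrite /osc zx !mulr0.
  exact: is_cvg_cst.
have mN eta : measurable (critical U (phi eta) `\` (dom U `&` Z eta)).
  apply: measurableD; first exact: measurable_critical.
  exact: measurableI.
apply/cvg_ex; exists (0 : R).
apply: (chart_oscint_cvg0 hlam cU mU (dphi' xi)) => //.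
- exact: measurableD.
- by move=> x [/CU].
(* [null] concerns the union over all nonzero frequencies, of which the set at hand lies in one
   term. Integer vectors are countable, so the union is measurable. *)
pose N := \bigcup_(eta in [set eta : 'rV[int]_r | eta != 0]) (critical U (phi eta) `\` (dom U `&` Z eta)).
have mNN : measurable N.
  rewrite /N bigcup_mkcond; apply: countable_bigcupT_measurable => [|eta]; first exact: countableP.
  by case: ifP.
apply: (@subset_measure0 _ _ _ m _ N) => //.
- by apply: measurableI; [exact: measurableD|exact: measurable_critical].
- by move=> x [[Cx nZ] cx]; exists xi => //; split => // -[_ /nZ].
rewrite -null; congr (m _); apply: eq_bigcupr => eta _; rewrite critE.
apply: congr1; apply/seteqP; split => x [Dx H]; split => //; move: H; rewrite /Z /preimage /= phiE//.
Qed.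

End chart_mixing.

Unset Implicit Arguments.

Theorem theorem6p7 (R : realType)
  (d : nat) (G : pTopGroupType) (AG : set (chart G 'rV[R]_d))
  (hG : is_lie_group AG) (hGc : compact [set: G]) (hGcon : connected [set: G])
  (c0 : chart G 'rV[R]_d) (hc0 : AG c0) (hc0e : dom c0 1%g)
  (H : probability (borel G) R) (hH : normalized_haar H)
  (n : nat) (M : ptopologicalType) (A : set (chart M 'rV[R]_n))
  (hMT2 : hausdorff_space M) (hML : lindelof M) (hA : is_atlas 1 A)
  (Omega : ptopologicalType) (pi : Omega -> M)
  (psi : chart M 'rV[R]_n -> Omega -> M * G)
  (psiV : chart M 'rV[R]_n -> M * G -> Omega)
  (hbundle : is_bundle A pi psi psiV)
  (mu : probability (borel Omega) R)
  (hmu : compatible_measure A pi psi mu H)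
  (g : R -> Omega -> Omega) (v : chart M 'rV[R]_n -> M -> 'rV[R]_d)
  (hg : is_flow g) (hgv : compatible_flow A pi psi psiV AG c0 v g)
  (T : set G) (hT : is_maximal_torus AG T)
  (r : nat) (chi : G -> 'rV[circle R]_r) (hchi : torus_isomorphism AG T chi)
  (h : 'rV[R]_d -> G)
  (hmeas : measurable_fun [set: borel 'rV[R]_d] (h : borel 'rV[R]_d -> borel G))
  (hH_v : forall u : 'rV[R]_d,
     lie_orbit_closure AG c0 u `<=` [set (h u * x * (h u)^-1)%g | x in T])
  (lam : {measure set (borel 'rV[R]_n) -> \bar R}) (hlam : is_lebesgue lam) :
  let w (U : chart M 'rV[R]_n) (x : M) : 'rV[R]_r :=
    Dchi c0 T chi (Ad AG c0 (h (v U x))^-1%g (v U x)) in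
  (forall U, A U ->
    [/\ Cdiff 1 (crd U @` dom U) (w U \o par U),
        chart_abs_continuous pi mu lam U &
        base_measure pi mu
          (\bigcup_(xi in [set xi : 'rV[int]_r | xi != 0])
             ([set x | dom U x /\
                 forall y : 'rV[R]_n,
                   'd (fun z => dotZ xi (w U (par U z))) (crd U x) y = 0]
              `\` [set x | dom U x /\ dotZ xi (w U x) = 0])) = 0%E]) ->
  keplerian_shear mu g.
Proof.
move=> w hw.
have [GT2 _ _ invS] := hG.
have mulc := lie_mul_continuous hG.
have invc : continuous (fun x : G => x^-1%g) by move=> x; exact: (invS 0%N).1.
have [chiD chiS [theta [thetaT chiK thetaK thetaS]]] := hchi.
have [[subT _] _] := hT.
have [T1 TM TV] := subT.
have chi1E := chi1 subT chiD.
have thetaC : continuous theta by move=> x; exact: (thetaS 0%N).1.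
pose th (s : 'rV[R]_r) := theta (torus_proj s).
have thc : continuous th.
  by move=> s; apply: (@continuous_comp _ _ _ (@torus_proj R r) theta); [exact: torus_proj_continuous|exact: thetaC].
(* [theta] is a homomorphism because [chi] is: apply [chi] and come back with [thetaK]. *)
have thD s u : th (s + u) = (th s * th u)%g.
  rewrite -[RHS]thetaK; last by apply: TM; exact: thetaT.
  by rewrite /th chiD// !chiK -torus_projD.
have thZ (s : 'rV[R]_r) : (forall j, exists k : int, s 0 j = k%:~R) -> th s = 1%g.
  move=> sZ; rewrite -[RHS]thetaK// chi1E -torus_proj0 /th; congr theta.
  by apply/torus_proj_eq => j; have [k Hk] := sZ j; exists k; rewrite mxE subr0.
have [UG [UGA UGcov]] := lindelof_atlas_seq (compact_lindelof hGc) (lie_chart hG) (lie_cover hG).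
have [KG KGB] := atlas_compact_base (fun i => lie_chart hG (UGA i)) UGcov.
have [cA covA _] := hA.
have [U [UA Ucov]] := lindelof_atlas_seq hML cA covA.
have cU i := cA _ (UA i).
have [KM KMB] := atlas_compact_base cU Ucov.
have [pic hb] := hbundle.
have mpi := borel_measurable pic.
pose piF : {mfun borel Omega >-> borel M} := mfun_Sub (mem_set mpi).
pose m : probability (borel M) R := distribution mu piF.
have oD i : open (dom (U i)) by case: (cU i).
have mD i : measurable (dom (U i) : set (borel M)) by exact: sub_sigma_algebra.
(* The hypothesis on [w] is stated in coordinates; differentiability there gives continuity on the
   chart domain, and hence measurability. *)
have cw i : forall x, dom (U i) x -> {for x, continuous (w (U i))}.
  apply: (chart_continuous (cU i)) => z Oz; have [[dw _] _ _] := hw _ (UA i).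
  exact: (differentiable_continuous (dw z Oz)).
have mw i : measurable_fun (dom (U i) : set (borel M)) (w (U i) : borel M -> borel 'rV[R]_r).
  apply: borel_measurable_on => //; rewrite continuous_open_subspace// => x /[!inE].
  exact: cw.
have mk i : measurable_fun (dom (U i) : set (borel M)) ((fun x => h (v (U i) x)) : borel M -> borel G).
  have [mv _] := hgv _ (UA i).
  exact: (measurableT_comp hmeas mv).
have gE i t x y : dom (U i) x -> dom (U i) (pi (g t (psiV (U i) (x, y)))) /\
    psi (U i) (g t (psiV (U i) (x, y))) =
    (x, (h (v (U i) x) * th (t *: w (U i) x) * (h (v (U i) x))^-1 * y)%g).
  have [_ Hg] := hgv _ (UA i); move=> /(Hg t x y)[Dg ->]; split => //.
  by rewrite (lie_exp_conj hG hc0 hc0e subT chiD chiS thetaK thetaC (hH_v _)).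
apply: (@bundle_flow_shear R r M Omega G H hH KM KG KMB KGB GT2 mulc invc th thD thc thZ
  mu pi pic (fun i => dom (U i)) oD Ucov (fun i => psi (U i)) (fun i => psiV (U i))
  (fun i => (hb _ (UA i)).1) (fun i => (hb _ (UA i)).2) (fun i => hmu _ (UA i))
  (fun i x => h (v (U i) x)) (fun i => w (U i)) mk mw g gE m) => // xi al B mB.
(* Each part of [B] lies in a single chart, where [fiber_angle] is the [w] of that chart. *)
have -> : B = \bigcup_i (B `&` piece (fun i => dom (U i)) i).
  rewrite -setI_bigcupr; apply/seteqP; split => x // => [Bx|[]//]; split => //.
  by have [i ix] := piece_cover Ucov x; exists i.
apply: oscint_cvg_bigcup.
- apply: (measurableT_comp (borel_measurable_real (@dotZ_continuous R r xi))).
  exact: (measurable_fiber_angle oD Ucov mw).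
- by move=> i; apply: measurableI => //; exact: measurable_piece.
- apply/trivIsetP => i j _ _ ij; apply/seteqP; split => x // [[_ xi_] [_ xj]].
  by rewrite -(piece_indexE Ucov xi_) -(piece_indexE Ucov xj) eqxx in ij.
move=> i; have [dw mU nU] := hw _ (UA i).
have mC : measurable (B `&` piece (fun i => dom (U i)) i).
  by apply: measurableI => //; exact: measurable_piece.
have CM := @chart_mixing R n r lam hlam M (U i) (cU i) m mU (w (U i)) dw nU xi al _ mC.
set C := B `&` _ in mC CM *.
have E t : oscint m (fun x => dotZ xi (fiber_angle Ucov (fun i => w (U i)) x)) al t C =
    oscint m (fun x => dotZ xi (w (U i) x)) al t C.
  apply: eq_Rintegral => x /set_mem[_ xi_].
  by rewrite /osc /fiber_angle (piece_indexE Ucov xi_).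
under eq_fun do rewrite E.
by apply: CM => x [_ /piece_sub].
Qed.
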